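(* Let $(A,\mathfrak{m})$ be a Noetherian local ring of dimension $d\ge 1$ with infinite residue field and let $\mathfrak{a}$ be an $\mathfrak{m}$-primary ideal. Let $\mathcal{F}=\{\mathfrak{a}_n\}_{n\ge 0}$ be a multiplicative $\mathfrak{a}$-stable filtration. Suppose that for some integer $c\ge 1$, setting $J=\mathfrak{a}_c$, the filtration $\mathcal{F}^{<c>}$ is $J$-adic (that is, $\mathfrak{a}_{cn}=J^n$ for all $n\ge 0$), and that the reduction number of $J^n$ is $<d$ for all $n\gg 0$. Then the $a$-invariant of $G_{\mathcal{F}}(A)$ is negative.
   Context: A multiplicative $\mathfrak{a}$-stable filtration is a decreasing sequence $\mathcal{F}=\{\mathfrak{a}_n\}_{n\ge 0}$ of ideals of $A$ such that $\mathfrak{a}_0=A$; $\mathfrak{a}\subseteq\mathfrak{a}_1$ and $\mathfrak{a}_1\ne A$; $\mathfrak{a}_n\mathfrak{a}_m\subseteq\mathfrak{a}_{n+m}$ for all $n,m\ge 0$; and $\mathfrak{a}\mathfrak{a}_n=\mathfrak{a}_{n+1}$ for all $n\gg 0$. $\mathcal{F}^{<c>}=\{\mathfrak{a}_{nc}\}_{n\ge 0}$. $G_{\mathcal{F}}(A)=\bigoplus_{n\ge 0}\mathfrak{a}_n/\mathfrak{a}_{n+1}$ is a finitely generated graded module over $G_{\mathfrak{a}}(A)=\bigoplus_{n\ge 0}\mathfrak{a}^n/\mathfrak{a}^{n+1}$. The $a$-invariant of $G_{\mathcal{F}}(A)$ is $$a_{\mathcal{F}}(A)=\max\{n\mid H^d_{G_{\mathfrak{a}}(A)_+}(G_{\mathcal{F}}(A))_n\ne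 0\}.$$ For an $\mathfrak{m}$-primary ideal $I$ and a minimal reduction $\mathfrak{c}$ of $I$, set $\operatorname{red}_{\mathfrak{c}}(I)=\min\{n\mid \mathfrak{c}I^n=I^{n+1}\}$; the reduction number of $I$ is the minimum of $\operatorname{red}_{\mathfrak{c}}(I)$ over all minimal reductions $\mathfrak{c}$ of $I$. *)

(* Defs.v *)
From HB Require Import structures.
From mathcomp Require Import all_boot all_order all_algebra.
From mathcomp Require Import generic_quotient ring_quotient.
From mathcomp Require Import boolp classical_sets cardinality.

Set Implicit Arguments.
Unset Strict Implicit.
Unset Printing Implicit Defensive.

Import Order.TTheory GRing.Theory Num.Theory.

Local Open Scope quotient_scope.
Local Open Scope classical_set_scope.
Local Open Scope ring_scope.

Section Ideals.
Variable A : comNzRingType.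
Implicit Types (I J m : set A).

Definition is_ideal I : Prop :=
  [/\ I 0, forall x y, I x -> I y -> I (x + y) & forall r x, I x -> I (r * x)].

Definition ideal_gen (S : set A) : set A :=
  \bigcap_(I in [set I | is_ideal I /\ S `<=` I]) I.

Definition mul_ideal I J : set A :=
  ideal_gen [set z | exists2 x, I x & exists2 y, J y & z = x * y].

Definition exp_ideal I (n : nat) : set A := iter n (mul_ideal I) setT.

Definition is_prime (p : set A) : Prop :=
  [/\ is_ideal p, p <> setT & forall x y, p (x * y) -> p x \/ p y].

Definition is_maximal m : Prop :=
  [/\ is_ideal m, m <> setT &
      forall I, is_ideal I -> m `<=` I -> I <> setT -> I = m].

Definition radical I : set A := [set x | exists n, I (x ^+ n)].

Definition is_primary I : Prop :=
  [/\ is_ideal I, I <> setT &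
      forall x y, I (x * y) -> I x \/ exists n, I (y ^+ n)].

Definition primary_to m I : Prop := is_primary I /\ radical I = m.

Definition noetherian : Prop :=
  forall I, is_ideal I -> exists s : seq A, I = ideal_gen [set x | x \in s].

Definition local_ring m : Prop :=
  is_maximal m /\ forall m', is_maximal m' -> m' = m.

(* p 0 ( p 1 ( ... ( p n, a chain of primes with n strict inclusions *)
Definition prime_chain (n : nat) (p : nat -> set A) : Prop :=
  (forall i, (i <= n)%N -> is_prime (p i)) /\
  (forall i, (i < n)%N -> p i `<` p i.+1).

Definition krull_dim (d : nat) : Prop :=
  (exists p, prime_chain d p) /\
  (forall n p, prime_chain n p -> (n <= d)%N).

(* the underlying set of A / m, as the set of cosets of m *)
Definition residue_classes m : set (set A) :=
  [set C | exists x, C = [set y | m (y - x)]].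

Definition is_reduction J I : Prop :=
  [/\ is_ideal J, J `<=` I &
      exists n, mul_ideal J (exp_ideal I n) = exp_ideal I n.+1].

Definition minimal_reduction J I : Prop :=
  is_reduction J I /\
  forall J', is_reduction J' I -> J' `<=` J -> J' = J.

Definition is_min (P : set nat) (r : nat) : Prop :=
  P r /\ forall s, P s -> (r <= s)%N.

Definition reduction_number_wrt J I : nat -> Prop :=
  is_min [set n | mul_ideal J (exp_ideal I n) = exp_ideal I n.+1].

Definition reduction_number I : nat -> Prop :=
  is_min [set r | exists2 J, minimal_reduction J I & reduction_number_wrt J I r].

Lemma ideal_gen_sub (S : set A) : S `<=` ideal_gen S.
Proof. by move=> x Sx I [_ SI]; exact: SI. Qed.

Lemma ideal_gen_min (S I : set A) : is_ideal I -> S `<=` I -> ideal_gen S `<=` I.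
Proof. by move=> idI SI x; apply. Qed.

Lemma ideal_gen_ideal (S : set A) : is_ideal (ideal_gen S).
Proof.
split=> [I [[]] //|x y Sx Sy I IS|r x Sx I IS].
- by case: (IS) => -[_ h _] _; apply: h; [exact: Sx|exact: Sy].
- by case: (IS) => -[_ _ h] _; apply: h; exact: Sx.
Qed.

Lemma mul_idealP I J x y : I x -> J y -> mul_ideal I J (x * y).
Proof. by move=> Ix Jy; apply: ideal_gen_sub; exists x => //; exists y. Qed.

Lemma setT_ideal : is_ideal setT. Proof. by []. Qed.

Lemma exp_ideal_ideal I n : is_ideal (exp_ideal I n).
Proof. by case: n => [|n]; [exact: setT_ideal | exact: ideal_gen_ideal]. Qed.

Lemma mul_ideal_subr I J : is_ideal J -> mul_ideal I J `<=` J.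
Proof.
move=> idJ; apply: ideal_gen_min => // _ [x _ [y Jy ->]].
by case: idJ => _ _; apply.
Qed.

Lemma exp_ideal_mul I n k x y :
  exp_ideal I n x -> exp_ideal I k y -> exp_ideal I (n + k) (x * y).
Proof.
move=> + Iy; elim: n x => [|n IHn] x.
  by move=> _; rewrite add0n; case: (exp_ideal_ideal I k) => _ _; apply.
case: (exp_ideal_ideal I (n.+1 + k)) => I0 ID IM.
apply: (@ideal_gen_min _ [set x | exp_ideal I (n.+1 + k) (x * y)]).
  split=> [|u v /= Iu Iv|r u /= Iu]; first by rewrite /= mul0r.
    by rewrite mulrDl; exact: ID.
  by rewrite -mulrA; exact: IM.
move=> _ [u Iu [v Iv ->]] /=; rewrite -mulrA.
by apply: mul_idealP => //; exact: IHn.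
Qed.

End Ideals.

Record filtration (A : comNzRingType) := Filtration {
  fil :> nat -> set A;
  fil_ideal : forall n, is_ideal (fil n);
  fil_decr : forall n, fil n.+1 `<=` fil n;
  fil0 : fil 0 = setT;
  fil1 : fil 1 <> setT;
  fil_mul : forall n k, mul_ideal (fil n) (fil k) `<=` fil (n + k)
}.

Record properIdeal (A : comNzRingType) := ProperIdeal {
  pid :> set A;
  pid_ideal : is_ideal pid;
  pid_proper : pid <> setT
}.

Record stableFiltration (A : comNzRingType) (a : properIdeal A) :=
  StableFiltration {
    sfil :> filtration A;
    sfil_sub : a `<=` sfil 1;
    sfil_stable : exists N, forall n, (N <= n)%N ->
      mul_ideal a (sfil n) = sfil n.+1
}.

Definition veronese (A : comNzRingType) (F : nat -> set A) (c : nat) :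
  nat -> set A := fun n => F (n * c)%N.

Section Adic.
Variables (A : comNzRingType) (a : properIdeal A).

Lemma adic_decr n : exp_ideal a n.+1 `<=` exp_ideal a n.
Proof. by apply: mul_ideal_subr; exact: exp_ideal_ideal. Qed.

Lemma exp_ideal1 (I : set A) : is_ideal I -> exp_ideal I 1 = I.
Proof.
move=> idI; apply/seteqP; split=> [|x Ix].
  apply: ideal_gen_min => // _ [x Ix [y _ ->]].
  by rewrite mulrC; case: idI => _ _; apply.
by rewrite -[x]mulr1; exact: mul_idealP.
Qed.

Lemma adic1 : exp_ideal a 1 <> setT.
Proof. by rewrite exp_ideal1; [exact: pid_proper | exact: pid_ideal]. Qed.

Lemma adic_mul n k :
  mul_ideal (exp_ideal a n) (exp_ideal a k) `<=` exp_ideal a (n + k).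
Proof.
apply: ideal_gen_min; first exact: exp_ideal_ideal.
by move=> _ [x Ix [y Iy ->]]; exact: exp_ideal_mul.
Qed.

Definition adic : filtration A :=
  Filtration (exp_ideal_ideal a) adic_decr erefl adic1 adic_mul.

End Adic.

(* The associated graded ring of F is realised as R_F / R_F(+1), where
   R_F = \bigoplus_n F_n X^n is the Rees algebra, a subring of A[X], and
   R_F(+1) = \bigoplus_n F_{n+1} X^n. *)
Section AssociatedGraded.
Variables (A : comNzRingType) (F : filtration A).

Definition rees_pred : {pred {poly A}} :=
  fun p => `[< forall i, F i p`_i >].

Lemma rees_predP (p : {poly A}) :
  reflect (forall i, F i p`_i) (p \in rees_pred).
Proof. exact: asboolP. Qed.

Lemma filN n x : F n x -> F n (- x).
Proof. by case: (fil_ideal F n) => _ _ h Fx; rewrite -mulN1r; exact: h. Qed.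

Lemma fil_sum n (I : Type) (s : seq I) (P : pred I) (f : I -> A) :
  (forall i, P i -> F n (f i)) -> F n (\sum_(i <- s | P i) f i).
Proof.
case: (fil_ideal F n) => F0 FD _ h.
by apply: (big_ind (F n)).
Qed.

Lemma filM n k x y : F n x -> F k y -> F (n + k)%N (x * y).
Proof. by move=> Fx Fy; apply: fil_mul; exact: mul_idealP. Qed.

Lemma rees_subring : subring_closed rees_pred.
Proof.
split=> [|p q /rees_predP hp /rees_predP hq|p q /rees_predP hp /rees_predP hq];
  apply/rees_predP => i.
- rewrite coef1; case: i => [|i] /=; first by rewrite fil0.
  by case: (fil_ideal F i.+1).
- rewrite coefB; case: (fil_ideal F i) => _ FD _.
  by apply: FD => //; apply: filN.
- rewrite coefM; apply: fil_sum => j _.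
  by rewrite -{1}(subnKC (ltnSE (ltn_ord j))); exact: filM.
Qed.

HB.instance Definition _ :=
  GRing.isSubringClosed.Build {poly A} rees_pred rees_subring.

Record rees := Rees { rees_val :> {poly A}; reesP : rees_val \in rees_pred }.

HB.instance Definition _ := [isSub for rees_val].
HB.instance Definition _ := [Choice of rees by <:].
HB.instance Definition _ := [SubChoice_isSubComNzRing of rees by <:].

Definition rees_shift : {pred rees} :=
  fun p => `[< forall i, F i.+1 (val p)`_i >].

Lemma rees_shiftP (p : rees) :
  reflect (forall i, F i.+1 (val p)`_i) (p \in rees_shift).
Proof. exact: asboolP. Qed.

Lemma rees_shift_ideal : idealr_closed rees_shift.
Proof.
split.
- by apply/rees_shiftP => i; rewrite rmorph0 coef0; case: (fil_ideal F i.+1).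
- apply/negP => /rees_shiftP /(_ 0); rewrite rmorph1 coef1 /= => F1.
  apply: (@fil1 _ F); apply/seteqP; split=> // x _; rewrite -[x]mulr1.
  by case: (fil_ideal F 1) => _ _; apply.
- move=> r u v /rees_shiftP hu /rees_shiftP hv; apply/rees_shiftP => i.
  case: (fil_ideal F i.+1) => _ FD _.
  rewrite rmorphD rmorphM coefD; apply: FD => //.
  rewrite coefM; apply: fil_sum => j _.
  rewrite -{1}(subnKC (ltnSE (ltn_ord j))) -addnS; apply: filM => //.
  exact/rees_predP/reesP.
Qed.

HB.instance Definition _ := isIdealr.Build rees rees_shift rees_shift_ideal.

Definition gr := {ideal_quot rees_shift}.
HB.instance Definition _ := GRing.ComNzRing.on gr.
HB.instance Definition _ : EqQuotient rees (Quotient.equiv rees_shift) gr :=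
  EqQuotient.on gr.


Definition gr_pi (p : rees) : gr := \pi_gr p.

(* F_n / F_{n+1}: the classes of the x X^n with x in F_n *)
Definition gr_comp (n : nat) : set gr :=
  [set z | exists2 p : rees, z = gr_pi p & exists x, val p = x *: 'X^n].

End AssociatedGraded.

Section GrMorphism.
Variables (A : comNzRingType) (F : filtration A).

Lemma gr_pi_zmod : zmod_morphism (@gr_pi A F).
Proof. by move=> p q; rewrite /gr_pi /= !piE. Qed.

Lemma gr_pi_monoid : monoid_morphism (@gr_pi A F).
Proof. by split=> [|p q]; rewrite /gr_pi /= !piE. Qed.

HB.instance Definition _ :=
  GRing.isZmodMorphism.Build (rees F) (gr F) (@gr_pi A F) gr_pi_zmod.
HB.instance Definition _ :=
  GRing.isMonoidMorphism.Build (rees F) (gr F) (@gr_pi A F) gr_pi_monoid.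

Lemma gr_pi_eq0 (p : rees F) :
  gr_pi p = 0 <-> forall i, F i.+1 (val p)`_i.
Proof.
rewrite -(rmorph0 (@gr_pi A F)) /gr_pi.
split=> [/eqP|h]; last apply/eqP; rewrite -Quotient.idealrBE subr0.
  by move/rees_shiftP.
exact/rees_shiftP.
Qed.

Lemma gr_repr (z : gr F) : gr_pi (repr z) = z.
Proof. exact: reprK. Qed.

End GrMorphism.

(* G_F(A) as a module over G_a(A), through the ring morphism
   G_a(A) -> G_F(A) induced by the inclusions a^n `<=` F_n. *)
Section GrModule.
Variables (A : comNzRingType) (a : properIdeal A) (F : stableFiltration a).

Lemma exp_sub_sfil n : exp_ideal a n `<=` F n.
Proof.
elim: n => [|n IHn]; first by rewrite fil0.
apply: ideal_gen_min; first exact: fil_ideal.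
move=> _ [x ax [y ay ->]]; rewrite -add1n; apply: filM.
  exact: sfil_sub.
exact: IHn.
Qed.

Lemma rees_inclP (p : rees (adic a)) : (val p : {poly A}) \in rees_pred F.
Proof.
by apply/rees_predP => i; apply: exp_sub_sfil; exact: (rees_predP _ _ (reesP p)).
Qed.

Definition rees_incl (p : rees (adic a)) : rees F := Rees (rees_inclP p).

Definition gr_map (z : gr (adic a)) : gr F := gr_pi (rees_incl (repr z)).

Lemma gr_map_pi (p : rees (adic a)) : gr_map (gr_pi p) = gr_pi (rees_incl p).
Proof.
apply/eqP; rewrite -subr_eq0 -rmorphB; apply/eqP/gr_pi_eq0 => i.
rewrite rmorphB /= -[rees_val (repr _) - _]/(val (repr (gr_pi p)) - val p).
rewrite -rmorphB; apply: exp_sub_sfil.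
suff /gr_pi_eq0 : gr_pi (repr (gr_pi p) - p) = 0 by apply.
by rewrite rmorphB /= gr_repr subrr.
Qed.

Lemma gr_map_zmod : zmod_morphism gr_map.
Proof.
move=> x y; rewrite -[x]gr_repr -[y]gr_repr -rmorphB !gr_map_pi -rmorphB.
by congr gr_pi; apply: val_inj.
Qed.

Lemma gr_map_monoid : monoid_morphism gr_map.
Proof.
split=> [|x y].
  rewrite -(rmorph1 (@gr_pi _ _)) gr_map_pi -(rmorph1 (@gr_pi _ _)).
  by congr gr_pi; apply: val_inj.
rewrite -[x]gr_repr -[y]gr_repr -rmorphM !gr_map_pi -rmorphM.
by congr gr_pi; apply: val_inj.
Qed.

HB.instance Definition _ :=
  GRing.isZmodMorphism.Build (gr (adic a)) (gr F) gr_map gr_map_zmod.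
HB.instance Definition _ :=
  GRing.isMonoidMorphism.Build (gr (adic a)) (gr F) gr_map gr_map_monoid.

Definition gr_module := gr F.
HB.instance Definition _ := GRing.Zmodule.on gr_module.

Definition gr_scale (r : gr (adic a)) (x : gr_module) : gr_module :=
  (gr_map r * x : gr F).

Lemma gr_scaleA r s x : gr_scale r (gr_scale s x) = gr_scale (r * s) x.
Proof. by rewrite /gr_scale rmorphM mulrA. Qed.

Lemma gr_scale1 : left_id 1 gr_scale.
Proof. by move=> x; rewrite /gr_scale rmorph1 mul1r. Qed.

Lemma gr_scaleDr : right_distributive gr_scale +%R.
Proof. by move=> r x y; rewrite /gr_scale mulrDr. Qed.

Lemma gr_scaleDl x : {morph gr_scale^~ x : r s / r + s}.
Proof. by move=> r s; rewrite /gr_scale rmorphD mulrDl. Qed.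

HB.instance Definition _ :=
  GRing.Zmodule_isLmodule.Build (gr (adic a)) gr_module
    gr_scaleA gr_scale1 gr_scaleDr gr_scaleDl.

Definition gr_module_comp (n : int) : set gr_module :=
  if n is Posz k then @gr_comp A F k else [set 0].

End GrModule.

(* Z-graded modules over a ring R with homogeneous components gr n *)
Record gradedModule (R : comNzRingType) (gr : nat -> set R) := GradedModule {
  gm_sort :> lmodType R;
  gm_comp : int -> set gm_sort;
  gm_comp0 : forall n, gm_comp n 0;
  gm_compB : forall n x y, gm_comp n x -> gm_comp n y -> gm_comp n (x - y);
  gm_compZ : forall i n r x,
    gr i r -> gm_comp n x -> gm_comp (i%:Z + n) (r *: x);
  gm_gen : forall x : gm_sort, exists (s : seq int) (f : int -> gm_sort),
    (forall n, gm_comp n (f n)) /\ x = \sum_(n <- s) f n;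
  gm_free : forall (s : seq int) (f : int -> gm_sort),
    uniq s -> (forall n, gm_comp n (f n)) -> \sum_(n <- s) f n = 0 ->
    forall n, n \in s -> f n = 0
}.

Section GrGradedModule.
Variables (A : comNzRingType) (a : properIdeal A) (F : stableFiltration a).
Local Notation M := (gr_module F).
Local Notation comp := (@gr_module_comp A a F).

Lemma monom_rees k x : F k x -> x *: 'X^k \in rees_pred F.
Proof.
move=> Fx; apply/rees_predP => i; rewrite coefZ coefXn.
case: eqP => [->|_]; first by rewrite mulr1.
by rewrite mulr0; case: (fil_ideal F i).
Qed.

Lemma gr_module_comp0 n : comp n 0.
Proof.
case: n => [k|k] //; exists 0; first by rewrite rmorph0.
by exists 0; rewrite rmorph0 scale0r.
Qed.

Lemma gr_module_compB n x y : comp n x -> comp n y -> comp n (x - y).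
Proof.
case: n => [k|k] /=; last by move=> -> ->; rewrite subrr.
move=> [p -> [u pu]] [q -> [v qv]]; exists (p - q).
  by rewrite rmorphB.
by exists (u - v); rewrite scalerBl -pu -qv; exact: rmorphB.
Qed.

Lemma gr_module_compZ i n (r : gr (adic a)) (x : M) :
  gr_comp i r -> comp n x -> comp (i%:Z + n) (r *: x).
Proof.
case: n => [k|k] gr_r; last by move=> ->; rewrite scaler0; exact: gr_module_comp0.
case: gr_r => p -> [u pu] [q -> [v qv]]; exists (rees_incl F p * q).
  by rewrite rmorphM /= -gr_map_pi.
exists (u * v).
transitivity ((u *: 'X^i) * (v *: 'X^k) : {poly A}).
  by rewrite -pu -qv; exact: (rmorphM _ (rees_incl F p) q).
by rewrite -scalerAl -scalerAr scalerA exprD.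
Qed.

Lemma gr_module_gen (x : M) : exists (s : seq int) (f : int -> M),
  (forall n, comp n (f n)) /\ x = \sum_(n <- s) f n.
Proof.
pose p := repr (x : gr F).
have Fp k : F k (val p)`_k by exact: (rees_predP _ _ (reesP p)).
pose q k : rees F := Rees (monom_rees (Fp k)).
exists (map Posz (iota 0 (size (val p)))).
exists (fun n => if n is Posz k then gr_pi (q k) else 0); split.
  by case=> [k|k] //; exists (q k) => //; exists (val p)`_k.
rewrite big_map -[LHS](@gr_repr _ F) -/p.
transitivity (gr_pi (\sum_(k <- iota 0 (size (val p))) q k)); last first.
  exact: (rmorph_sum (@gr_pi A F)).
congr gr_pi; apply: val_inj; rewrite rmorph_sum /=.
by rewrite -{1}[rees_val p]coefK poly_def -(big_mkord xpredT
  (fun i => (rees_val p)`_i *: 'X^i)) /index_iota subn0.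
Qed.

Lemma gr_module_free (s : seq int) (f : int -> M) :
  uniq s -> (forall n, comp n (f n)) -> \sum_(n <- s) f n = 0 ->
  forall n, n \in s -> f n = 0.
Proof.
move=> us fP s0.
have [q qP] : {q : int -> rees F & forall n, f n = gr_pi (q n) /\
    exists x, val (q n) = if n is Posz k then x *: 'X^k else 0}.
  apply: (@choice _ _ (fun n (p : rees F) => f n = gr_pi p /\
    exists x, val p = if n is Posz k then x *: 'X^k else 0)) => n.
  move: (fP n); case: n => [k [p fp [x px]]|k ->].
    by exists p; split=> //; exists x.
  by exists 0; split; [rewrite rmorph0 | exists 0; rewrite rmorph0].
case=> [k|k] ks; last exact: (fP (Negz k)).
have [-> [x qx]] := qP (Posz k).
have : gr_pi (\sum_(n <- s) q n) = 0.
  by rewrite rmorph_sum -[RHS]s0; apply: eq_bigr => n _; case: (qP n).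
move=> /gr_pi_eq0 /(_ k); rewrite rmorph_sum coef_sum (bigD1_seq (Posz k)) //=.
rewrite big1 ?addr0 => [Fx|n nk].
  apply/gr_pi_eq0 => i; move: Fx; rewrite -[rees_val _]/(val (q k)) qx.
  rewrite !coefZ !coefXn eqxx mulr1; case: eqP => [->|_]; first by rewrite mulr1.
  by rewrite mulr0; case: (fil_ideal F i.+1).
have [_ [y]] := qP n; rewrite -[rees_val _]/(val (q n)) => ->.
case: n nk => [j|j] nk; last by rewrite coef0.
rewrite coefZ coefXn; suff /negPf-> : k != j by rewrite mulr0.
by apply: contraNneq nk => ->.
Qed.

Definition assoc_graded_module : gradedModule (@gr_comp A (adic a)) :=
  GradedModule gr_module_comp0 gr_module_compB gr_module_compZ
    gr_module_gen gr_module_free.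

End GrGradedModule.

Section LocalCohomology.
Variables (R : comNzRingType) (gr : nat -> set R).
Local Notation gmod := (gradedModule gr).

Record gradedHom (M N : gmod) := GradedHom {
  gh_fun :> {linear M -> N};
  gh_deg : forall n x, gm_comp n x -> gm_comp n (gh_fun x)
}.

(* injective object of the category of graded modules and degree 0 maps *)
Definition graded_injective (E : gmod) : Prop :=
  forall (L N : gmod) (u : gradedHom L N) (f : gradedHom L E),
    injective u -> exists g : gradedHom N E, forall x, g (u x) = f x.

Record injectiveResolution (M : gmod) := InjectiveResolution {
  ir_obj : nat -> gmod;
  ir_aug : gradedHom M (ir_obj 0);
  ir_diff : forall i, gradedHom (ir_obj i) (ir_obj i.+1);
  ir_inj : forall i, graded_injective (ir_obj i);
  ir_aug_inj : injective ir_aug;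
  ir_exact0 : forall x, ir_diff 0 x = 0 <-> exists y, x = ir_aug y;
  ir_exact : forall i x, ir_diff i.+1 x = 0 <-> exists y, x = ir_diff i y
}.

Definition torsion (I : set R) (M : gmod) : set M :=
  [set x | exists k, forall r, exp_ideal I k r -> r *: x = 0].

(* H^i_I(M) is the i-th cohomology of the complex \Gamma_I(E) of torsion
   submodules of a graded injective resolution E of M; its component of
   degree n is lc_cycles i n / lc_boundaries i n. *)
Section Cohomology.
Variables (I : set R) (M : gmod) (E : injectiveResolution M).

Definition lc_cycles (i : nat) (n : int) : set (ir_obj E i) :=
  [set x | [/\ torsion I x, gm_comp n x & ir_diff E i x = 0]].

Definition lc_boundaries (i : nat) (n : int) : set (ir_obj E i) :=
  match i return set (ir_obj E i) with
  | 0 => [set 0]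
  | j.+1 => [set x | exists y, [/\ torsion I y, gm_comp n y & x = ir_diff E j y]]
  end.

Definition lc_nonzero (i : nat) (n : int) : Prop :=
  ~ (@lc_cycles i n `<=` @lc_boundaries i n).

Definition is_a_invariant (d : nat) (b : int) : Prop :=
  lc_nonzero d b /\ forall n, lc_nonzero d n -> n <= b.

End Cohomology.

Definition irrelevant_ideal : set R :=
  ideal_gen (\bigcup_(n in [set n | (0 < n)%N]) gr n).

End LocalCohomology.

(* Main.v *)
(* Write G for the ring G_F(A). The ideal a has a reduction generated by d elements
   y_1, ..., y_d that are algebraically independent in the fiber cone: a reduction with
   the least number l of generators is independent by Noether normalisation (the residue
   field is infinite), and comparing the growth of the length of A / a^n with chains of
   primes gives l = d.  In the same way every minimal reduction of J^n is generated by d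
   elements.  Let Y_i be the class of y_i in G.  Dimension shifting along the subcomplexes
   of the given injective resolution killed by powers of y_1, ..., y_j identifies H^d(G)
   with the direct limit over t of the G / (Y_1^t, ..., Y_d^t), the transition maps being
   multiplication by Y_1 ... Y_d.

   Vanishing in degree 0: for n large there is Q = (f_1, ..., f_d) with
   Q J^(n(d-1)) = J^(nd), and f_i = sum_j a_ij Y_j^t in G.  The class of g / (Y^t), with g of
   degree dt, equals that of det(a) g / (f), and det(a) g has degree cnd, hence lies in (f).
   Since Y_1 acts surjectively on the limit, it vanishes in all degrees >= 0.

   Nonvanishing: G is finite over A[Y], and by independence no polynomial with a coefficient
   outside m maps G into m G; so G / mG is not a torsion (A/m)[Y]-module, and a torsion-free
   generator of a quotient would make a monomial multiple of a nonzero polynomial h lie in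
   (Y_i^(s+t)) with t larger than the degree of h. *)

Require Import Defs.
From HB Require Import structures.
From mathcomp Require Import all_boot all_order all_algebra.
From mathcomp Require Import boolp classical_sets cardinality.
From mathcomp Require Import mpoly ring zify.

Set Implicit Arguments.
Unset Strict Implicit.
Unset Printing Implicit Defensive.

Import Order.TTheory GRing.Theory Num.Theory.

Local Open Scope classical_set_scope.
Local Open Scope ring_scope.

(** * Ideals *)

(** Local cohomology is given through an arbitrary graded injective resolution, so the only handle
    on its terms is the extension property. It enters solely through [killed_divisible]: an element
    killed by powers of the earlier parameters can be divided by any power of y_j, up to a further
    power of y_j. This replaces localisation and turns statements on H^d into membership in ideals
    of G ([vanishing_ideal]). As G may fail to be Cohen-Macaulay, the transition maps of the limit
    may fail to be injective, whence the extra exponent [s] in [vanishing]. The Veronese hypothesis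
    is used in [reduction_of_power]: it makes a full component of G, in a degree as large as
    desired, lie in (f). The maximum in the a-invariant exists because the nonvanishing degrees form
    a nonempty set of negative integers. *)

Section IdealBasics.
Variable A : comNzRingType.
Implicit Types (I J K L : set A).

Lemma ideal0 I : is_ideal I -> I 0. Proof. by case. Qed.

Lemma idealD I x y : is_ideal I -> I x -> I y -> I (x + y).
Proof. by case=> _ + _; apply. Qed.

Lemma ideal_mull I r x : is_ideal I -> I x -> I (r * x).
Proof. by case=> _ _; apply. Qed.

Lemma ideal_mulr I r x : is_ideal I -> I x -> I (x * r).
Proof. by rewrite mulrC; exact: ideal_mull. Qed.

Lemma idealN I x : is_ideal I -> I x -> I (- x).
Proof. by rewrite -mulN1r; exact: ideal_mull. Qed.

Lemma idealB I x y : is_ideal I -> I x -> I y -> I (x - y).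
Proof. by move=> Ii Ix Iy; apply: idealD => //; exact: idealN. Qed.

Lemma ideal_sum I (T : Type) (s : seq T) (P : pred T) (f : T -> A) :
  is_ideal I -> (forall i, P i -> I (f i)) -> I (\sum_(i <- s | P i) f i).
Proof. by move=> [I0 ID _] h; apply: (big_ind I). Qed.

Lemma ideal_eqT I : is_ideal I -> I 1 -> I = setT.
Proof.
by move=> Ii I1; apply/seteqP; split=> // x _; rewrite -[x]mulr1; exact: ideal_mull.
Qed.

Lemma set0_ideal : is_ideal [set 0 : A].
Proof.
by split=> [//|x y -> ->|r x ->] /=; rewrite ?addr0 ?mulr0.
Qed.

Definition add_ideal I J : set A := [set z | exists2 x, I x & exists2 y, J y & z = x + y].

Lemma add_ideal_ideal I J : is_ideal I -> is_ideal J -> is_ideal (add_ideal I J).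
Proof.
move=> Ii Ij; split.
- exists 0; first exact: ideal0.
  by exists 0; [exact: ideal0 | rewrite addr0].
- move=> _ _ [x Ix [y Jy ->]] [x' Ix' [y' Jy' ->]].
  exists (x + x'); first exact: idealD.
  by exists (y + y'); [exact: idealD | rewrite addrACA].
- move=> r _ [x Ix [y Jy ->]]; exists (r * x); first exact: ideal_mull.
  by exists (r * y); [exact: ideal_mull | rewrite mulrDr].
Qed.

Lemma add_ideal_subl I J : is_ideal J -> I `<=` add_ideal I J.
Proof. by move=> Ij x Ix; exists x => //; exists 0; [exact: ideal0|rewrite addr0]. Qed.

Lemma add_ideal_subr I J : is_ideal I -> J `<=` add_ideal I J.
Proof. by move=> Ij x Jx; exists 0; [exact: ideal0|exists x => //; rewrite add0r]. Qed.

Lemma add_ideal_min I J K : is_ideal K -> I `<=` K -> J `<=` K -> add_ideal I J `<=` K.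
Proof. by move=> Ik IK JK _ [x /IK Kx [y /JK Ky ->]]; exact: idealD. Qed.

Lemma add_ideal_mono I J I' J' :
  I `<=` I' -> J `<=` J' -> add_ideal I J `<=` add_ideal I' J'.
Proof. by move=> II JJ _ [x /II Ix [y /JJ Jy ->]]; exists x => //; exists y. Qed.

Lemma add_idealC I J : add_ideal I J = add_ideal J I.
Proof.
by apply/seteqP; split=> z [x Ix [y Jy ->]]; exists y => //; exists x; rewrite // addrC.
Qed.

Lemma add_idealA I J K : add_ideal I (add_ideal J K) = add_ideal (add_ideal I J) K.
Proof.
apply/seteqP; split=> z.
  move=> [x Ix [_ [y Jy [t Kt ->]] ->]]; exists (x + y); first by exists x => //; exists y.
  by exists t; rewrite // addrA.
move=> [_ [x Ix [y Jy ->]] [t Kt ->]]; exists x => //; exists (y + t); last by rewrite addrA.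
by exists y => //; exists t.
Qed.

Definition principal (x : A) : set A := [set z | exists r, z = r * x].

Lemma principal_ideal x : is_ideal (principal x).
Proof.
split=> [|_ _ [r ->] [s ->]|r _ [s ->]].
- by exists 0; rewrite mul0r.
- by exists (r + s); rewrite mulrDl.
- by exists (r * s); rewrite mulrA.
Qed.

Lemma principal_self x : principal x x.
Proof. by exists 1; rewrite mul1r. Qed.

Definition multiples I (z : A) : set A := [set y | exists2 b, I b & y = b * z].

Lemma multiples_ideal I z : is_ideal I -> is_ideal (multiples I z).
Proof.
move=> Ii; split=> [|_ _ [b Ib ->] [c Ic ->]|t _ [b Ib ->]].
- by exists 0; [exact: ideal0|rewrite mul0r].
- by exists (b + c); [exact: idealD|rewrite mulrDl].
- by exists (t * b); [exact: ideal_mull|rewrite mulrA].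
Qed.

Definition colon I (x : A) : set A := [set r | I (r * x)].

Lemma colon_ideal I x : is_ideal I -> is_ideal (colon I x).
Proof.
move=> Ii; split=> [|r s Ir Is|r s Is]; rewrite /colon /=.
- by rewrite mul0r; exact: ideal0.
- by rewrite mulrDl; exact: idealD.
- by rewrite -mulrA; exact: ideal_mull.
Qed.

Definition fspan n (x : 'I_n -> A) : set A :=
  [set z | exists c : 'I_n -> A, z = \sum_i c i * x i].

(** Equal to [mul_ideal (fspan x) I] for an ideal [I] ([mul_fspan]), but with one coefficient per
    generator: [mul_ideal] is an intersection of ideals and hands out no coefficients. *)
Definition fmul n (x : 'I_n -> A) I : set A :=
  [set z | exists2 c : 'I_n -> A, forall i, I (c i) & z = \sum_i c i * x i].

Lemma fmul_ideal n (x : 'I_n -> A) I : is_ideal I -> is_ideal (fmul x I).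
Proof.
move=> Ii; split=> [|_ _ [c Ic ->] [c' Ic' ->]|r _ [c Ic ->]].
- exists (fun=> 0) => [i|]; first exact: ideal0.
  by rewrite big1 // => i _; rewrite mul0r.
- exists (fun i => c i + c' i) => [i|]; first exact: idealD.
  by rewrite -big_split /=; apply: eq_bigr => i _; rewrite mulrDl.
- exists (fun i => r * c i) => [i|]; first exact: ideal_mull.
  by rewrite mulr_sumr; apply: eq_bigr => i _; rewrite mulrA.
Qed.

Lemma fspanE n (x : 'I_n -> A) : fspan x = fmul x setT.
Proof. by apply/seteqP; split=> z [c]; [move->; exists c | move=> _ ->; exists c]. Qed.

Lemma fspan_ideal n (x : 'I_n -> A) : is_ideal (fspan x).
Proof. by rewrite fspanE; exact: fmul_ideal. Qed.

Lemma fmul_gen n (x : 'I_n -> A) I i c : is_ideal I -> I c -> fmul x I (c * x i).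
Proof.
move=> Ii Ic; exists (fun j => if j == i then c else 0) => [j|].
  by case: ifP => _ //; exact: ideal0.
by rewrite (bigD1 i) //= eqxx big1 ?addr0 // => j /negPf ->; rewrite mul0r.
Qed.

Lemma fspan_gen n (x : 'I_n -> A) i : fspan x (x i).
Proof. by rewrite fspanE -[x i]mul1r; exact: fmul_gen. Qed.

Lemma fspan_min n (x : 'I_n -> A) I : is_ideal I -> (forall i, I (x i)) -> fspan x `<=` I.
Proof. by move=> Ii Ix _ [c ->]; apply: ideal_sum => // i _; exact: ideal_mull. Qed.

Lemma mul_fspan n (x : 'I_n -> A) I : is_ideal I -> mul_ideal (fspan x) I = fmul x I.
Proof.
move=> Ii; apply/seteqP; split.
  apply: ideal_gen_min; first exact: fmul_ideal.
  move=> _ [_ [c ->] [y Iy ->]]; exists (fun i => c i * y) => [i|].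
    exact: ideal_mull.
  by rewrite mulr_suml; apply: eq_bigr => i _; rewrite mulrAC.
move=> _ [c Ic ->]; apply: ideal_sum => [|i _]; first exact: ideal_gen_ideal.
by rewrite mulrC; apply: mul_idealP => //; exact: fspan_gen.
Qed.

Lemma ideal_gen_seq (s : seq A) :
  ideal_gen [set x | x \in s] = fspan (fun i : 'I_(size s) => nth 0 s i).
Proof.
apply/seteqP; split.
  apply: ideal_gen_min; first exact: fspan_ideal.
  move=> x /= xs; have lt : (index x s < size s)%N by rewrite index_mem.
  rewrite -[x](nth_index 0 xs) -[index x s]/(nat_of_ord (Ordinal lt)).
  exact: fspan_gen.
apply: fspan_min; first exact: ideal_gen_ideal.
by move=> i; apply: ideal_gen_sub; exact: mem_nth.
Qed.

Lemma fspan_seq n (x : 'I_n -> A) : fspan x = ideal_gen [set z | z \in codom x].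
Proof.
apply/seteqP; split.
  apply: fspan_min; first exact: ideal_gen_ideal.
  by move=> i; apply: ideal_gen_sub; exact: codom_f.
apply: ideal_gen_min; first exact: fspan_ideal.
by move=> z /= /codomP[i ->]; exact: fspan_gen.
Qed.

Lemma noetherian_fspan I : noetherian A -> is_ideal I ->
  exists n (x : 'I_n -> A), I = fspan x.
Proof. by move=> nA /nA [s ->]; rewrite ideal_gen_seq; eexists; eexists. Qed.

Lemma mul_ideal_ideal I J : is_ideal (mul_ideal I J).
Proof. exact: ideal_gen_ideal. Qed.

Lemma mul_ideal_min I J K : is_ideal K ->
  (forall x y, I x -> J y -> K (x * y)) -> mul_ideal I J `<=` K.
Proof. by move=> Ik h; apply: ideal_gen_min => // _ [x Ix [y Jy ->]]; exact: h. Qed.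

Lemma mul_ideal_mono I J I' J' :
  I `<=` I' -> J `<=` J' -> mul_ideal I J `<=` mul_ideal I' J'.
Proof.
move=> II JJ; apply: mul_ideal_min; first exact: mul_ideal_ideal.
by move=> x y /II Ix /JJ Jy; exact: mul_idealP.
Qed.

Lemma mul_idealC I J : mul_ideal I J = mul_ideal J I.
Proof.
by apply/seteqP; split; apply: mul_ideal_min; try exact: mul_ideal_ideal;
  move=> x y Ix Jy; rewrite mulrC; exact: mul_idealP.
Qed.

Lemma mul_ideal_subl I J : is_ideal I -> mul_ideal I J `<=` I.
Proof. by rewrite mul_idealC; exact: mul_ideal_subr. Qed.

Lemma mul_idealA I J K : mul_ideal I (mul_ideal J K) = mul_ideal (mul_ideal I J) K.
Proof.
apply/seteqP; split; apply: mul_ideal_min; try exact: mul_ideal_ideal.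
- move=> x y Ix Jy; suff : colon (mul_ideal (mul_ideal I J) K) x y.
    by rewrite /colon /= mulrC.
  move: y Jy; apply: mul_ideal_min; first exact/colon_ideal/mul_ideal_ideal.
  move=> y z Jy Kz; rewrite /colon /= mulrC mulrA.
  by apply: mul_idealP => //; exact: mul_idealP.
- move=> x y Ix Jy; suff : colon (mul_ideal I (mul_ideal J K)) y x by [].
  move: x Ix; apply: mul_ideal_min; first exact/colon_ideal/mul_ideal_ideal.
  move=> x z Jy' Kz; rewrite /colon /= -mulrA.
  by apply: mul_idealP => //; exact: mul_idealP.
Qed.

Lemma mul_idealT I : is_ideal I -> mul_ideal setT I = I.
Proof.
move=> Ii; apply/seteqP; split; first exact: mul_ideal_subr.
by move=> x Ix; rewrite -[x]mul1r; exact: mul_idealP.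
Qed.

Lemma exp_idealS I n : exp_ideal I n.+1 = mul_ideal I (exp_ideal I n).
Proof. by []. Qed.

Lemma exp_ideal_gen I x k : I x -> exp_ideal I k (x ^+ k).
Proof. by move=> Ix; elim: k => // k IHk; rewrite exprS; exact: mul_idealP. Qed.

Lemma exp_idealD I n k :
  exp_ideal I (n + k) = mul_ideal (exp_ideal I n) (exp_ideal I k).
Proof.
elim: n => [|n IHn]; first by rewrite mul_idealT //; exact: exp_ideal_ideal.
by rewrite addSn /= -mul_idealA -IHn.
Qed.

Lemma exp_idealSr I n : exp_ideal I n.+1 = mul_ideal (exp_ideal I n) I.
Proof. by rewrite mul_idealC. Qed.

Lemma exp_ideal_le I n k : (n <= k)%N -> exp_ideal I k `<=` exp_ideal I n.
Proof.
move=> /subnK <-; rewrite exp_idealD; apply: mul_ideal_subr; exact: exp_ideal_ideal.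
Qed.

Lemma exp_ideal_mono I J n : I `<=` J -> exp_ideal I n `<=` exp_ideal J n.
Proof. by move=> IJ; elim: n => // n IHn; exact: mul_ideal_mono. Qed.

Lemma exp_idealM I n k : exp_ideal (exp_ideal I n) k = exp_ideal I (n * k).
Proof.
elim: k => [|k IHk]; first by rewrite muln0.
by rewrite mulnS exp_idealD -IHk.
Qed.

Lemma exp_ideal_sub_self I n : is_ideal I -> (0 < n)%N -> exp_ideal I n `<=` I.
Proof. by move=> Ii n0; rewrite -{2}(exp_ideal1 Ii); exact: exp_ideal_le. Qed.

(** Each term of an expanded product of [a + b] elements of [I + J] has at least [a] factors from
    [I] or at least [b] from [J]. In the induction on [a + b], a factor from [I] lowers [a] and one
    from [J] lowers [b]. *)
Lemma exp_add_ideal I J a b (P := add_ideal I J) : is_ideal I -> is_ideal J ->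
  exp_ideal P (a + b) `<=` add_ideal (mul_ideal (exp_ideal I a) (exp_ideal P b))
                                     (mul_ideal (exp_ideal J b) (exp_ideal P a)).
Proof.
move=> Ii Ij; have IP : I `<=` P by exact: add_ideal_subl.
have JP : J `<=` P by exact: add_ideal_subr.
pose T a' b' := add_ideal (mul_ideal (exp_ideal I a') (exp_ideal P b'))
                          (mul_ideal (exp_ideal J b') (exp_ideal P a')).
have mulA K L L' K' x z : K x -> mul_ideal L L' z -> (forall u, K u -> K' u) ->
    mul_ideal (mul_ideal K L) L' (x * z) /\ mul_ideal L (mul_ideal K' L') (x * z).
  move=> Kx Lz KK; split; first by rewrite -mul_idealA; exact: mul_idealP.
  rewrite mul_idealA [mul_ideal L K']mul_idealC -mul_idealA.
  by apply: mul_idealP => //; exact: KK.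
move: {2}(a + b)%N (leqnn (a + b)) => n; elim: n a b => [|n IHn] a b.
  rewrite leqn0 addn_eq0 => /andP[/eqP -> /eqP ->] x _.
  exists x; first by rewrite mul_idealT //; exact: setT_ideal.
  by exists 0; [exact: (ideal0 (mul_ideal_ideal _ _))|rewrite addr0].
case: a b => [|a] [|b] le x Px.
- exists x; first by rewrite mul_idealT.
  by exists 0; [exact: (ideal0 (mul_ideal_ideal _ _))|rewrite addr0].
- exists x; first by rewrite mul_idealT //; exact: (exp_ideal_ideal P b.+1).
  by exists 0; [exact: (ideal0 (mul_ideal_ideal _ _))|rewrite addr0].
- rewrite addn0 in Px; exists 0; first exact: (ideal0 (mul_ideal_ideal _ _)).
  by exists x; rewrite ?add0r // mul_idealT //; exact: (exp_ideal_ideal P a.+1).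
have Ti a' b' : is_ideal (T a' b') by apply: add_ideal_ideal; exact: mul_ideal_ideal.
have leb : (a + b.+1 <= n)%N by move: le; lia.
have lea : (a.+1 + b <= n)%N by move: le; lia.
move: x Px; rewrite addSn exp_idealS; apply: (mul_ideal_min (Ti a.+1 b.+1)).
move=> _ w [i Ii' [j Jj ->]] Pw; rewrite mulrDl; apply: (idealD (Ti a.+1 b.+1)).
  have [u hu [v hv ->]] := IHn a b.+1 leb w Pw; rewrite mulrDr.
  exists (i * u); first exact: (mulA _ _ _ _ _ _ Ii' hu IP).1.
  by exists (i * v) => //; exact: (mulA _ _ _ _ _ _ Ii' hv IP).2.
have Pw' : exp_ideal P (a.+1 + b) w by rewrite addSnnS.
have [u hu [v hv ->]] := IHn a.+1 b lea w Pw'; rewrite mulrDr.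
exists (j * u); first exact: (mulA _ _ _ _ _ _ Jj hu JP).2.
by exists (j * v) => //; exact: (mulA _ _ _ _ _ _ Jj hv JP).1.
Qed.

Lemma principal_exp x n : exp_ideal (principal x) n = principal (x ^+ n).
Proof.
elim: n => [|n IHn].
  by apply/seteqP; split=> // z _; exists z; rewrite mulr1.
apply/seteqP; split.
  rewrite exp_idealS IHn; apply: mul_ideal_min; first exact: principal_ideal.
  by move=> _ _ [r ->] [s ->]; exists (r * s); rewrite exprS mulrACA.
move=> _ [r ->]; rewrite exp_idealS IHn exprS mulrA.
by apply: mul_idealP; [exists r | exact: principal_self].
Qed.

Lemma fspan_recr n (x : 'I_n.+1 -> A) :
  fspan x = add_ideal (fspan (fun i => x (widen_ord (leqnSn n) i))) (principal (x ord_max)).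
Proof.
apply/seteqP; split; last first.
  apply: add_ideal_min; first exact: fspan_ideal.
    by apply: fspan_min; [exact: fspan_ideal | move=> i; exact: fspan_gen].
  by move=> _ [r ->]; apply: ideal_mull; [exact: fspan_ideal | exact: fspan_gen].
move=> _ [c ->]; rewrite big_ord_recr /=.
eexists; first by eexists; reflexivity.
by eexists; first by eexists; reflexivity.
Qed.

(* By the pigeonhole principle a monomial of degree n N + 1 is divisible by some x i ^ N. *)
Lemma exp_fspan n (x : 'I_n -> A) N : exp_ideal (fspan x) (n * N).+1 `<=`
  fmul (fun i => x i ^+ N) (exp_ideal (fspan x) (n.-1 * N).+1).
Proof.
elim: n x => [|n IHn] x.
  rewrite mul0n exp_ideal1; last exact: fspan_ideal.
  by move=> _ [c ->]; exists (fun=> 0); rewrite ?big_ord0 // => -[].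
set P := fspan x; pose I := fspan (fun i => x (widen_ord (leqnSn n) i)).
have PE : P = add_ideal I (principal (x ord_max)) := fspan_recr x.
have Ki : is_ideal (fmul (fun i => x i ^+ N) (exp_ideal P (n * N).+1)).
  exact/fmul_ideal/exp_ideal_ideal.
rewrite mulSnr -addSn {1}PE; apply: subset_trans.
  by apply: exp_add_ideal; [exact: fspan_ideal | exact: principal_ideal].
rewrite -PE; apply: (add_ideal_min Ki); last first.
  rewrite principal_exp; apply: (mul_ideal_min Ki) => _ w [r ->] Pw.
  rewrite mulrAC mulrC mulrC; apply: (fmul_gen _ ord_max); first exact: exp_ideal_ideal.
  exact: (ideal_mull _ (exp_ideal_ideal P (n * N).+1)).
apply: (mul_ideal_min Ki) => u w /IHn [c Ic ->] Pw.
rewrite mulr_suml; apply: (ideal_sum _ Ki) => i _; rewrite mulrAC.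
apply: (fmul_gen _ (widen_ord (leqnSn n) i)); first exact: exp_ideal_ideal.
have IP : I `<=` P by rewrite PE; exact/add_ideal_subl/principal_ideal.
(* The index [i : 'I_n] forces [n > 0], so [n.-1] is a true predecessor. *)
have -> : (n * N).+1 = ((n.-1 * N).+1 + N)%N.
  by rewrite addSn -mulSnr prednK //; case: (i) => /= k; case: (n).
by rewrite exp_idealD; apply: mul_idealP => //; exact: (exp_ideal_mono IP).
Qed.

End IdealBasics.

(** * Chain conditions in Noetherian rings *)

Section Noetherian.
Variable A : comNzRingType.
Hypothesis nA : noetherian A.
Implicit Types (I J K L : set A).

Lemma noetherian_acc (I : nat -> set A) : (forall n, is_ideal (I n)) ->
  (forall n, I n `<=` I n.+1) -> exists k, forall n, (k <= n)%N -> I n = I k.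
Proof.
move=> Ii Ile.
have le n k : (n <= k)%N -> I n `<=` I k.
  move=> /subnKC <-; elim: (k - n)%N => [|j IHj]; first by rewrite addn0.
  by rewrite addnS; exact: subset_trans (Ile _).
pose U := [set x | exists n, I n x].
have Ui : is_ideal U.
  split=> [|x y [n Ix] [k Iy]|r x [n Ix]].
  - by exists 0; exact: ideal0.
  - exists (maxn n k); apply: idealD => //.
      by apply: (le n) => //; exact: leq_maxl.
    by apply: (le k) => //; exact: leq_maxr.
  - by exists n; exact: ideal_mull.
have [n [x Ux]] := noetherian_fspan nA Ui.
have Uk : forall i, exists k, I k (x i).
  by move=> i; have : U (x i) by rewrite Ux; exact: fspan_gen.
have [k kP] := choice Uk.
exists (\max_i k i)%N => j kj; apply/seteqP; split; last exact: le.
move=> z Iz; have : U z by exists j.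
rewrite Ux; apply: fspan_min => // i.
by apply: (le (k i)); [exact: leq_bigmax|].
Qed.

(** Otherwise iterated strict enlargements contradict [noetherian_acc]. Later inductions over ideals
    take a maximal counterexample from here. *)
Lemma noetherian_max (P : set A -> Prop) I0 : is_ideal I0 -> P I0 ->
  exists I, [/\ is_ideal I, P I, I0 `<=` I &
    forall J, is_ideal J -> P J -> I `<=` J -> J = I].
Proof.
move=> Ii0 PI0; apply: contrapT => nomax.
pose T := {I : set A | [/\ is_ideal I, P I & I0 `<=` I]}.
have step (I : T) : {J : T | sval I `<=` sval J /\ sval J <> sval I}.
  apply: cid; case: I => I [Ii PI I0I] /=; apply: contrapT => h.
  apply: nomax; exists I; split=> // J Ij PJ IJ; apply: contrapT => JI.
  by apply: h; exists (exist _ J (And3 Ij PJ (subset_trans I0I IJ))).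
pose f n : T := iter n (fun I : T => sval (step I)) (exist _ I0 (And3 Ii0 PI0 (@subset_refl _ I0))).
have fi n : is_ideal (sval (f n)) by case: (f n) => ? [].
have [k kP] := noetherian_acc fi (fun n => (svalP (step (f n))).1).
by have [_] := svalP (step (f k)); apply; exact: (kP k.+1 (leqnSn k)).
Qed.

End Noetherian.

(** * Noetherian local rings: units, Nakayama, m-primary ideals *)

Section Local.
Variables (A : comNzRingType) (m : set A).
Hypotheses (nA : noetherian A) (loc : local_ring m).
Implicit Types (I J K L : set A).

Lemma local_ideal : is_ideal m. Proof. by case: loc => -[]. Qed.

Lemma local_proper : m <> setT. Proof. by case: loc => -[]. Qed.

Lemma local_n1 : ~ m 1.
Proof. by move=> /(ideal_eqT local_ideal); exact: local_proper. Qed.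

Lemma proper_sub_local I : is_ideal I -> I <> setT -> I `<=` m.
Proof.
move=> Ii IT.
have [J [Ij JT IJ Jmax]] := noetherian_max nA (P := fun J => J <> setT) Ii IT.
by have <- : J = m by apply: loc.2; split=> // K Ik JK KT; exact: Jmax.
Qed.

Lemma local_unit x : ~ m x -> exists y, y * x = 1.
Proof.
move=> mx; have : principal x = setT.
  apply: contrapT => h; apply: mx; apply: (proper_sub_local _ h).
    exact: principal_ideal.
  exact: principal_self.
move=> /seteqP [_ /(_ 1 I)] [r ->]; by exists r.
Qed.

Lemma local_prime : is_prime m.
Proof.
split; [exact: local_ideal|exact: local_proper|move=> x y mxy].
have [|/local_unit [u ux]] := EM (m x); first by left.
right; rewrite -[y]mul1r -ux -mulrA; exact: ideal_mull local_ideal mxy.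
Qed.

Lemma local_unit1D x : m x -> exists y, y * (1 - x) = 1.
Proof.
move=> mx; apply: local_unit => m1; apply: local_n1.
by rewrite -[1](subrK x); exact: idealD local_ideal m1 mx.
Qed.

(** Take [J] maximal among the ideals that contain [L] but not [K], and z in [K] outside [J]. Then
    [K] lies in J + (z), so m K lies in J + m z, and (1 - r) z is in [J] for some r in [m]; as 1 - r
    is a unit, z is in [J]. *)
Lemma nakayama K L : is_ideal L -> K `<=` add_ideal L (mul_ideal m K) -> K `<=` L.
Proof.
move=> Li KL; apply: contrapT => nKL.
have [J [Ij nKJ LJ Jmax]] := noetherian_max nA (P := fun J => ~ K `<=` J) Li nKL.
have [z Kz nJz] : exists2 z, K z & ~ J z.
  apply: contrapT => h; apply: nKJ => z Kz; apply: contrapT => nJz.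
  by apply: h; exists z.
have mi := local_ideal.
have KJz : K `<=` add_ideal J (principal z).
  apply: contrapT => nK; apply: nJz.
  rewrite -(Jmax _ (add_ideal_ideal Ij (principal_ideal z)) nK).
    exact/add_ideal_subr/principal_self.
  exact/add_ideal_subl/principal_ideal.
have [l Ll [w mKw zE]] := KL z Kz.
have : add_ideal J (multiples m z) w.
  move: w mKw {zE}; apply: mul_ideal_min.
    exact: add_ideal_ideal (multiples_ideal z mi).
  move=> x y mx /KJz [j Jj [_ [r ->] ->]]; exists (x * j); first exact: ideal_mull.
  exists (x * (r * z)); last by rewrite mulrDr.
  by exists (x * r); [exact: ideal_mulr|rewrite mulrA].
move=> [j Jj [_ [r mr ->] wE]].
have [u uE] := local_unit1D mr.
apply: nJz; rewrite -[z]mul1r -uE -mulrA; apply: ideal_mull => //.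
have -> : (1 - r) * z = l + j by rewrite mulrBl mul1r {1}zE wE; ring.
by apply: idealD => //; exact: LJ.
Qed.

Lemma primary_exp I : primary_to m I -> exists e, exp_ideal m e `<=` I.
Proof.
move=> [[Ii _ _] rad]; have [n [x mx]] := noetherian_fspan nA local_ideal.
have h i : exists k, I (x i ^+ k).
  have : radical I (x i) by rewrite rad mx; exact: fspan_gen.
  by [].
have [k kP] := choice h.
(* The pigeonhole exponent of [exp_fspan] for the common power [\max_i k i]. *)
exists (n * \max_i k i).+1%N; rewrite mx.
apply: subset_trans; first exact: exp_fspan.
move=> _ [c _ ->]; apply: ideal_sum => // i _; apply: ideal_mull => //.
have le : (k i <= \max_i k i)%N by exact: leq_bigmax.
by rewrite -(subnK le) exprD; exact: ideal_mull.
Qed.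

End Local.

(** * The Hilbert basis theorem and Rees algebras *)

Section HilbertBasis.
Variable R : comNzRingType.
Hypothesis nR : noetherian R.

Let lead_ideal (I : set {poly R}) n : set R :=
  [set c | exists p, [/\ I p, (size p <= n.+1)%N & p`_n = c]].

Let lead_ideal_ideal I n : is_ideal I -> is_ideal (lead_ideal I n).
Proof.
move=> Ii; split.
- by exists 0; rewrite size_poly0 coef0; split=> //; exact: ideal0.
- move=> _ _ [p [Ip sp <-]] [q [Iq sq <-]]; exists (p + q); split.
  + exact: idealD.
  + by rewrite (leq_trans (size_polyD _ _)) // geq_max sp sq.
  + by rewrite coefD.
- move=> r _ [p [Ip sp <-]]; exists (r%:P * p); split.
  + exact: ideal_mull.
  + by rewrite mul_polyC (leq_trans (size_scale_leq _ _)).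
  + by rewrite coefCM.
Qed.

Let lead_ideal_le I n : is_ideal I -> lead_ideal I n `<=` lead_ideal I n.+1.
Proof.
move=> Ii _ [p [Ip sp <-]]; exists ('X * p); split.
- exact: ideal_mull.
- apply/leq_sizeP => -[|j] // le; rewrite coefXM /=.
  by move/leq_sizeP : sp; apply.
- by rewrite coefXM.
Qed.

Let lead_approx I n : is_ideal I -> exists2 s : seq {poly R},
  {in s, forall p, I p} & forall p, I p -> (size p <= n.+1)%N ->
  exists2 q, ideal_gen [set x | x \in s] q & (size (p - q)%R <= n)%N.
Proof.
move=> Ii; have [k [x xP]] := noetherian_fspan nR (lead_ideal_ideal n Ii).
have h i : exists p, [/\ I p, (size p <= n.+1)%N & p`_n = x i].
  by have : lead_ideal I n (x i) by rewrite xP; exact: fspan_gen.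
have [g gP] := choice h.
exists (codom g) => [p /codomP[i ->]|p Ip sp]; first by case: (gP i).
have : lead_ideal I n p`_n by exists p.
rewrite xP => -[c cE]; exists (\sum_i (c i)%:P * g i).
  by rewrite -fspan_seq; exists (fun i => (c i)%:P).
apply/leq_sizeP => j; rewrite leq_eqVlt coefB coef_sum => /orP[/eqP <-|nj].
  apply/eqP; rewrite subr_eq0 cE; apply/eqP/eq_bigr => i _.
  by rewrite coefCM; case: (gP i) => _ _ ->.
rewrite (leq_sizeP _ _ sp) // big1 ?subr0 // => i _.
by have [_ sg _] := gP i; rewrite coefCM (leq_sizeP _ _ sg) ?mulr0.
Qed.

Lemma noetherian_poly : noetherian {poly R}.
Proof.
move=> I Ii.
have [k kP] := noetherian_acc nR (fun n => lead_ideal_ideal n Ii) (fun n => @lead_ideal_le I n Ii).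
pose approx (s : seq {poly R}) n := {in s, forall p, I p} /\ forall p, I p -> (size p <= n.+1)%N ->
  exists2 q, ideal_gen [set x | x \in s] q & (size (p - q)%R <= n)%N.
have h n : exists s : seq {poly R}, approx s n.
  by have [s sI sP] := lead_approx n Ii; exists s.
have [s sP] := choice h.
pose S := flatten [seq s i | i <- iota 0 k.+1].
have SI : ideal_gen [set x | x \in S] `<=` I.
  apply: ideal_gen_min => // p /= /flattenP[t /mapP[i _ ->]].
  by case: (sP i) => + _; apply.
exists S; apply/seteqP; split=> // p Ip.
have gi := ideal_gen_ideal [set x | x \in S].
have gen i q : (i <= k)%N -> ideal_gen [set x | x \in s i] q ->
    ideal_gen [set x | x \in S] q.
  move=> ik; move: q; apply: ideal_gen_min => // q qs.
  apply: ideal_gen_sub; apply/flattenP; exists (s i) => //.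
  by apply/mapP; exists i => //; rewrite mem_iota.
move: {2}(size p) (leqnn (size p)) => n; elim: n p Ip => [|n IHn] p Ip sp.
  by move: sp; rewrite leqn0 size_poly_eq0 => /eqP ->; exact: ideal0.
have [q [gq Iq spq]] : exists q, [/\ ideal_gen [set x | x \in S] q, I q & (size (p - q)%R <= n)%N].
  have [nk|kn] := leqP n k.
    have [_ /(_ p Ip sp)[q /(gen _ _ nk) gq spq]] := sP n.
    by exists q; split=> //; exact: SI.
  (* Past [k] the leading ideals agree with that of degree [k]: the top coefficient of [p] is
     cancelled by ['X^(n - k)] times some p' of degree at most [k], itself replaced, modulo lower
     degree, by an element of the span. *)
  have : lead_ideal I n p`_n by exists p.
  rewrite kP; last exact: ltnW.
  move=> [p' [Ip' sp' p'E]].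
  have [_ /(_ p' Ip' sp')[q /(gen _ _ (leqnn k)) gq spq]] := sP k.
  exists ('X^(n - k) * q); split; first exact: (ideal_mull _ gi).
    by apply: SI; exact: (ideal_mull _ gi).
  have -> : p - 'X^(n - k) * q = (p - 'X^(n - k) * p') + 'X^(n - k) * (p' - q) by ring.
  apply/leq_sizeP => j; rewrite coefD coefB !coefXnM => nj.
  case: ltnP => [|jnk]; first by move: nj kn; lia.
  rewrite [X in _ + X](leq_sizeP _ _ spq) ?addr0; last by move: nj kn; lia.
  move: nj; rewrite leq_eqVlt => /orP[/eqP <-|nj].
    by rewrite subKn ?p'E ?subrr // ltnW.
  by rewrite (leq_sizeP _ _ sp) // (leq_sizeP _ _ sp') ?subrr //; move: nj kn; lia.
have gpq := IHn _ (idealB Ii Ip Iq) spq.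
by rewrite -[p](subrK q); exact: (idealD gi).
Qed.

End HilbertBasis.

Lemma noetherian_surj (R S : comNzRingType) (f : {rmorphism R -> S}) :
  (forall s, exists r, f r = s) -> noetherian R -> noetherian S.
Proof.
move=> fs nR I Ii; pose J := [set r | I (f r)].
have Ji : is_ideal J.
  split=> [|x y Ix Iy|r x Ix]; rewrite /J /= ?rmorph0 ?rmorphD ?rmorphM.
  - exact: ideal0.
  - exact: idealD.
  - exact: ideal_mull.
have [n [x xP]] := noetherian_fspan nR Ji.
exists (codom (f \o x)); rewrite -fspan_seq; apply/seteqP; split.
  move=> s; have [r <-] := fs s => Ifr.
  have : J r by []. rewrite xP => -[c ->].
  by exists (f \o c); rewrite rmorph_sum; apply: eq_bigr => i _; rewrite rmorphM.
by apply: fspan_min => // i; have : J (x i) by rewrite xP; exact: fspan_gen.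
Qed.

Fixpoint iter_poly (R : comNzRingType) (n : nat) : comNzRingType :=
  if n is n'.+1 then {poly iter_poly R n'} : comNzRingType else R.

Lemma noetherian_iter_poly (R : comNzRingType) n :
  noetherian R -> noetherian (iter_poly R n).
Proof. by move=> nR; elim: n => // n IHn; exact: noetherian_poly. Qed.

(** Only the image is recorded: when it contains algebra generators of [S], the map is onto and
    [noetherian_surj] applies. *)
Lemma iter_poly_morph (R S : comNzRingType) (f : {rmorphism R -> S}) n (x : nat -> S) :
  exists g : {rmorphism iter_poly R n -> S},
    (forall r, exists p, g p = f r) /\ forall i, (i < n)%N -> exists p, g p = x i.
Proof.
elim: n => [|n [g [gf gx]]].
  by exists f; split=> // r; exists r.
have cg : commr_rmorph g (x n) by move=> r; exact: mulrC.
pose h : {rmorphism {poly iter_poly R n} -> S} := horner_morph cg.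
have hC p : h p%:P = g p by exact: horner_morphC.
exists h; split=> [r|i].
  by have [p <-] := gf r; exists p%:P.
rewrite ltnS leq_eqVlt => /orP[/eqP ->|/gx [p <-]]; last by exists p%:P.
by exists 'X; exact: horner_morphX.
Qed.

(** * Monomials of Rees algebras, finite generation, Artin-Rees *)

Section Monomials.
Variables (A : comNzRingType) (F : filtration A).

Lemma monom_in_rees n x : F n x -> x *: 'X^n \in rees_pred F.
Proof.
move=> Fx; apply/rees_predP => i; rewrite coefZ coefXn.
case: eqP => [->|_]; first by rewrite mulr1.
by rewrite mulr0; exact: (ideal0 (fil_ideal F i)).
Qed.

Lemma const_in_rees c : c%:P \in rees_pred F.
Proof.
apply/rees_predP => -[|i]; rewrite coefC /=; first by rewrite fil0.
exact: (ideal0 (fil_ideal F i.+1)).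
Qed.

Definition rees_const c : rees F := Rees (const_in_rees c).

Lemma rees_const_zmod : zmod_morphism rees_const.
Proof. by move=> x y; apply: val_inj; rewrite rmorphB; exact: polyCB. Qed.

Lemma rees_const_monoid : monoid_morphism rees_const.
Proof. by split=> [|x y]; apply: val_inj; rewrite ?rmorph1 ?rmorphM //; exact: polyCM. Qed.

HB.instance Definition _ := GRing.isZmodMorphism.Build A (rees F) rees_const rees_const_zmod.
HB.instance Definition _ := GRing.isMonoidMorphism.Build A (rees F) rees_const rees_const_monoid.

(* The element x X^n of the Rees algebra; junk value 0 if x is not in F n. *)
Definition rmono n x : rees F := insubd 0 (x *: 'X^n : {poly A}).

Lemma val_rmono n x : F n x -> val (rmono n x) = x *: 'X^n.
Proof. by move=> Fx; rewrite insubdK //; exact: monom_in_rees. Qed.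

Lemma fil_coef (p : rees F) i : F i (val p)`_i.
Proof. exact: (rees_predP _ _ (reesP p)). Qed.

Lemma rees_sum_rmono (p : rees F) n : (size (val p) <= n)%N ->
  p = \sum_(i < n) rmono i (val p)`_i.
Proof.
move=> sp; apply: val_inj; rewrite rmorph_sum /=.
rewrite (eq_bigr (fun i : 'I_n => (val p)`_i *: 'X^i)).
  apply/polyP => j; rewrite coef_sum; case: (ltnP j n) => [jn|nj].
    rewrite (bigD1 (Ordinal jn)) //= coefZ coefXn eqxx mulr1 big1 ?addr0 //.
    by move=> i ij; rewrite coefZ coefXn; case: eqP => [ji|];
      [move/eqP: ij; case; apply/val_inj|rewrite mulr0].
  rewrite nth_default ?(leq_trans sp) // big1 // => i _.
  by rewrite coefZ coefXn; case: eqP => [ji|]; [move: nj; rewrite ji leqNgt ltn_ord|rewrite mulr0].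
by move=> i _; rewrite -[RHS]val_rmono //; exact: fil_coef.
Qed.

End Monomials.

(** The Rees algebra is generated over [A] by the [x i *: 'X], where the [x i] generate [a]: an
    element of a^(k+1) is a combination of the [x i] with coefficients in a^k. *)
Lemma noetherian_rees (A : comNzRingType) (a : properIdeal A) :
  noetherian A -> noetherian (rees (adic a)).
Proof.
move=> nA; have [n [x ax]] := noetherian_fspan nA (pid_ideal a).
pose F := adic a; have Fx i : F 1 (x i).
  suff : exp_ideal a 1 (x i) by [].
  by rewrite exp_ideal1 ?ax; [exact: fspan_gen|exact: fspan_ideal].
pose y j := if insub j is Some i then rmono F 1 (x i) else 0.
have [g [gc gx]] := iter_poly_morph (rees_const F : {rmorphism _ -> _}) n y.
apply: (noetherian_surj (f := g)); last exact: noetherian_iter_poly.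
have gmono k c : F k c -> exists p, g p = rmono F k c.
  elim: k c => [|k IHk] c Fc.
    have [p pE] := gc c; exists p; rewrite pE; apply: val_inj.
    by rewrite val_rmono //= expr0 alg_polyC.
  have : fmul x (exp_ideal a k) c by rewrite -mul_fspan -?ax //; exact: exp_ideal_ideal.
  move=> [e eP cE].
  have [q qE] := choice (fun i => IHk _ (eP i)).
  have [z zE] := choice (fun i : 'I_n => gx i (ltn_ord i)).
  exists (\sum_i q i * z i); rewrite rmorph_sum /=; apply: val_inj.
  rewrite val_rmono // cE scaler_suml rmorph_sum /=; apply: eq_bigr => i _.
  rewrite rmorphM qE zE /y valK -[rees_val _]/(val _) rmorphM /= -![rees_val _]/(val _).
  rewrite !val_rmono //; last exact: eP.
  by rewrite -scalerAl -scalerAr scalerA -exprD addn1.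
move=> p; rewrite (rees_sum_rmono (leqnn (size (val p)))).
have [q qE] := choice (fun i : nat => gmono i _ (fil_coef p i)).
by exists (\sum_(i < size (val p)) q i); rewrite rmorph_sum; apply: eq_bigr => i _.
Qed.

Lemma noetherian_gr (A : comNzRingType) (a : properIdeal A) :
  noetherian A -> noetherian (gr (adic a)).
Proof.
move=> nA; apply: (noetherian_surj (f := @gr_pi A (adic a))); last exact: noetherian_rees.
by move=> z; exists (repr z); exact: gr_repr.
Qed.

(** The elements of the Rees algebra with all coefficients in [V] form a finitely generated ideal,
    and [k] bounds the sizes of the generators. The n-th coefficient of a combination of them pairs
    coefficients in [V] of index j < k with elements of a^(n-j). *)
Lemma artin_rees (A : comNzRingType) (a : properIdeal A) (V : set A) :
  noetherian A -> is_ideal V -> exists k, forall n, (k <= n)%N ->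
    exp_ideal a n `&` V `<=` mul_ideal (exp_ideal a (n - k)) V.
Proof.
move=> nA Vi; pose F := adic a.
pose N := [set p : rees F | forall i, V (val p)`_i].
have Ni : is_ideal N.
  split=> [i|p q Np Nq i|r p Np i].
  - by rewrite rmorph0 coef0; exact: ideal0.
  - by rewrite rmorphD coefD; exact: idealD.
  - rewrite rmorphM coefM; apply: ideal_sum => // j _; exact: ideal_mull.
have [r [s NE]] := noetherian_fspan (noetherian_rees nA) Ni.
have Ns i : N (s i) by rewrite NE; exact: fspan_gen.
pose k := (\max_i size (val (s i)))%N; exists k => n kn v [av Vv].
have : N (rmono F n v).
  move=> i; rewrite val_rmono // coefZ coefXn; case: eqP => _.
    by rewrite mulr1.
  by rewrite mulr0; exact: ideal0.
rewrite NE => -[c /(congr1 (fun p : rees F => (val p)`_n))]; cbv beta.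
rewrite val_rmono // coefZ coefXn eqxx mulr1 => ->.
rewrite rmorph_sum coef_sum; have Mi := mul_ideal_ideal (exp_ideal a (n - k)) V.
apply: ideal_sum => // i _; rewrite rmorphM coefMr; apply: ideal_sum => // j _.
have [jk|kj] := ltnP j k; last first.
  rewrite [X in _ * X]nth_default ?mulr0; first exact: ideal0.
  by apply: leq_trans kj; rewrite /k (bigD1 i) //= leq_maxl.
apply: mul_idealP; last exact: Ns.
have : F (n - j)%N (val (c i))`_(n - j) by exact: fil_coef.
by apply: exp_ideal_le; move: jk; lia.
Qed.

(** * Length and dimension *)

Section Length.
Variable A : comNzRingType.
Implicit Types (L : set A).

(** Chains are weakly increasing and [jumps] counts the strict steps: adding (z) or taking the colon
    by z keeps a chain weakly increasing but may collapse steps. *)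
Definition ideals_above L (I : nat -> set A) : Prop :=
  [/\ forall i, is_ideal (I i), forall i, L `<=` I i & forall i, I i `<=` I i.+1].

Definition jumps (I : nat -> set A) r : nat := (\sum_(i < r) `[< I i <> I i.+1 >])%N.

(* A / L has length at most N. *)
Definition length_le L N : Prop :=
  forall I r, ideals_above L I -> (jumps I r <= N)%N.

(* A / L has length at least N. *)
Definition length_ge L N : Prop :=
  exists I r, ideals_above L I /\ (N <= jumps I r)%N.

Lemma length_ge_le L M N : length_ge L M -> length_le L N -> (M <= N)%N.
Proof. by move=> [I [r [IL MI]]] LN; exact: leq_trans (LN I r IL). Qed.

Lemma length_le_sub L L' N N' :
  L `<=` L' -> (N <= N')%N -> length_le L N -> length_le L' N'.
Proof.
move=> LL NN h I r [Ii IL Im]; apply: leq_trans NN; apply: h; split=> // i.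
exact: subset_trans (IL i).
Qed.

Lemma length_ge_sub L L' N : L `<=` L' -> length_ge L' N -> length_ge L N.
Proof.
move=> LL [I [r [[Ii IL Im] h]]]; exists I, r; split=> //; split=> // i.
exact: subset_trans (IL i).
Qed.

Lemma length_ge1 L : is_ideal L -> L <> setT -> length_ge L 1.
Proof.
move=> Li LT; exists (fun i => if i is 0 then L else setT), 1; split.
  by split=> -[].
by rewrite /jumps big_ord1 /=; case: asboolP.
Qed.

Lemma length_leT : length_le setT 0.
Proof.
move=> I r [_ IT _]; have IE i : I i = setT by apply/seteqP; split=> // x _; exact: IT.
by rewrite /jumps big1 // => i _; case: asboolP => //; rewrite !IE.
Qed.

(* The exact sequence 0 -> A / (L : z) -> A / L -> A / (L + z) -> 0, in terms of chains. *)
Lemma length_le_colon L z N M : length_le (add_ideal L (principal z)) N ->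
  length_le (colon L z) M -> length_le L (N + M).
Proof.
move=> hN hM I r [Ii IL Im].
pose I1 i := add_ideal (I i) (principal z); pose I2 i := colon (I i) z.
have le1 : (jumps I1 r <= N)%N.
  apply: hN; split=> i; first exact: add_ideal_ideal (principal_ideal z).
    exact: add_ideal_mono.
  exact: add_ideal_mono.
have le2 : (jumps I2 r <= M)%N.
  apply: hM; split=> i; first exact: colon_ideal.
    by move=> x; exact: IL.
  by move=> x; exact: Im.
apply: leq_trans (leq_add le1 le2); rewrite /jumps -big_split leq_sum //= => i _.
case: asboolP => // nI; case: asboolP => // /contrapT E1; case: asboolP => // /contrapT E2.
(* If the step is stationary after adding (z) and after taking the colon, it is stationary: v = w +
   s z with w in [I i], so s is in the colon of [I i.+1], which is that of [I i]. *)
case: nI; apply/seteqP; split=> // v Iv.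
have : I1 i v by rewrite E1; exact: add_ideal_subl (principal_ideal z) _ Iv.
move=> [w Iw [_ [s ->] vE]]; rewrite vE; apply: (idealD (Ii i)) => //.
suff : I2 i s by []. rewrite E2 /I2 /colon /= -[s * z](addKr w) -vE addrC.
by apply: (idealB (Ii _)) => //; exact: Im.
Qed.

(** The chain above [colon L z], multiplied by [z] and added to [L], is followed by the chain above
    L + (z). Multiplication by [z] collapses no strict step, as each [J i] contains [colon L z]. *)
Lemma length_ge_colon L z N M : is_ideal L -> length_ge (add_ideal L (principal z)) N ->
  length_ge (colon L z) M -> length_ge L (N + M).
Proof.
move=> Li [I [r [[Ii IL Im] NI]]] [J [s [[Ji JL Jm] MJ]]].
pose Jz i := add_ideal L (multiples (J i) z).
have Jzi i : is_ideal (Jz i) by exact: add_ideal_ideal (multiples_ideal z (Ji i)).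
have Jzm i : Jz i `<=` Jz i.+1.
  by apply: add_ideal_mono => // _ [b Jb ->]; exists b => //; exact: Jm.
have JzI i : Jz i `<=` I 0.
  apply: subset_trans (IL 0%N); apply: add_ideal_mono => // _ [b _ ->]; by exists b.
have JzE i : Jz i = Jz i.+1 -> J i = J i.+1.
  move=> E; apply/seteqP; split=> // b Jb.
  have : Jz i (b * z) by rewrite E; apply: add_ideal_subr => //; exists b.
  move=> [l Ll [_ [c Jc ->] bE]]; rewrite -[b](subrK c).
  apply: (idealD (Ji i)) => //; apply: JL; rewrite /colon /= mulrBl bE.
  by rewrite addrK.
pose H i := if (i <= s)%N then Jz i else I (i - s.+1)%N.
exists H, (s.+1 + r)%N; split; first split=> i.
- by rewrite /H; case: ifP.
- rewrite /H; case: ifP => _; first exact: add_ideal_subl (multiples_ideal z (Ji i)).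
  by apply: subset_trans (IL _); exact/add_ideal_subl/principal_ideal.
- rewrite /H; case: (ltngtP i s) => [lt|lt|->].
  + exact: Jzm.
  + by rewrite subSn; [exact: Im|].
  + by rewrite subnn.
rewrite /jumps big_split_ord /= addnC; apply: leq_add.
  apply: leq_trans MJ _; rewrite big_ord_recr /= -[X in (X <= _)%N]addn0; apply: leq_add => //.
  rewrite /jumps leq_sum // => i _; rewrite /H (ltnW (ltn_ord i)) ltn_ord.
  by case: asboolP => // nJ; case: asboolP => // /contrapT /JzE.
apply: leq_trans NI _; rewrite /jumps leq_sum // => i _.
have HE j : H (s.+1 + j)%N = I j.
  by rewrite /H ifF ?addKn // addSn; apply: negbTE; rewrite -ltnNge ltnS leq_addr.
by rewrite HE -addnS HE.
Qed.

(** The colon of L + (z^(n+1)) by [z] contains L + (z^n), so each further power of [z] costs at most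
    [N]. *)
Lemma length_le_expr L z N n : is_ideal L -> length_le (add_ideal L (principal z)) N ->
  length_le (add_ideal L (principal (z ^+ n))) (n * N).
Proof.
move=> Li hN; elim: n => [|n IHn].
  have -> : add_ideal L (principal (z ^+ 0)) = setT.
    apply/seteqP; split=> // x _; apply: add_ideal_subr => //.
    by exists x; rewrite mulr1.
  exact: length_leT.
rewrite mulSn; apply: (@length_le_colon _ z).
  apply: length_le_sub hN => //; apply: add_ideal_mono => //.
  exact/add_ideal_subl/principal_ideal.
apply: length_le_sub IHn => // x [l Ll [_ [r ->] ->]].
exists (l * z); first exact: (ideal_mulr z Li Ll).
by exists (r * z ^+ n * z) => //; [exists r; rewrite exprSr mulrA|rewrite mulrDl].
Qed.

(** Generators are replaced by their powers one at a time. This bounds growth by the number of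
    generators, for [reduction_ge_dim]. *)
Lemma length_le_fspan L n (x : 'I_n -> A) k N : is_ideal L ->
  length_le (add_ideal L (fspan x)) N ->
  length_le (add_ideal L (fspan (fun i => x i ^+ k))) (k ^ n * N).
Proof.
move=> + hN; elim: n x L N hN => [|n IHn] x L N hN Li.
  rewrite expn0 mul1n; apply: length_le_sub hN => //; apply: add_ideal_mono => //.
  by move=> _ [c ->]; exists c; rewrite !big_ord0.
rewrite fspan_recr add_idealA expnS -mulnA; apply: length_le_expr.
  exact: add_ideal_ideal (fspan_ideal _).
rewrite -add_idealA [X in add_ideal _ X]add_idealC add_idealA; apply: IHn.
  by rewrite -add_idealA [X in add_ideal _ X]add_idealC -fspan_recr.
exact: add_ideal_ideal (principal_ideal _).
Qed.

End Length.

(** * Krull dimension as the growth rate of the length of A / I^n *)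

Section Dimension.
Variables (A : comNzRingType) (m : set A).
Hypotheses (nA : noetherian A) (loc : local_ring m).
Implicit Types (I J K L : set A).

Let mi := local_ideal loc.

Lemma length_le_local : length_le m 1.
Proof.
move=> I r [Ii Im Ile].
have Ic i : I i = m \/ I i = setT.
  have [->|IT] := EM (I i = setT); first by right.
  left; apply/seteqP; split=> //; exact: (proper_sub_local nA loc).
suff : (jumps I r <= `[< I r = setT >])%N by move=> /leq_trans; apply; case: asboolP.
elim: r => [|r IHr]; first by rewrite /jumps big_ord0.
rewrite /jumps big_ord_recr /= -/(jumps I r); case: asboolP IHr => [IrT IHr|IrT].
  have -> : I r.+1 = setT by apply/seteqP; split=> // x _; apply: Ile; rewrite IrT.
  by rewrite IrT; case: asboolP => // _; case: asboolP => // _; rewrite addn0.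
rewrite leqn0 => /eqP ->; rewrite add0n; case: asboolP => // nI; case: asboolP => // nT.
by case: nI; case: (Ic r) => // ->; case: (Ic r.+1).
Qed.

(** A maximal counterexample [J] has a z outside [J] with m z inside [J], a socle element of A / J;
    the length then exceeds that of A / (J + (z)) by at most one. *)
Lemma length_fin L e : is_ideal L -> exp_ideal m e `<=` L -> exists N, length_le L N.
Proof.
move=> Li meL; apply: contrapT => nfin.
have [J [Ji nJ LJ Jmax]] := noetherian_max nA (P := fun J => ~ exists N, length_le J N) Li nfin.
have meJ := subset_trans meL LJ.
have JT : J <> setT by move=> JT; apply: nJ; exists 0%N; rewrite JT; exact: length_leT.
have [i [miJ mi1J]] : exists i, ~ (exp_ideal m i `<=` J) /\ exp_ideal m i.+1 `<=` J.
  elim: e meJ {meL} => [h|e IHe h].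
    by case: JT; apply/seteqP; split.
  have [|h'] := EM (exp_ideal m e `<=` J); first exact: IHe.
  by exists e.
have [z mz Jz] : exists2 z, exp_ideal m i z & ~ J z.
  apply: contrapT => h; apply: miJ => z mz; apply: contrapT => Jz.
  by apply: h; exists z.
apply: nJ.
have [N hN] : exists N, length_le (add_ideal J (principal z)) N.
  apply: contrapT => h; apply: Jz.
  rewrite -(Jmax _ (add_ideal_ideal Ji (principal_ideal z)) h).
    exact/add_ideal_subr/principal_self.
  exact/add_ideal_subl/principal_ideal.
exists (N + 1)%N; apply: (length_le_colon hN); apply: length_le_sub length_le_local => //.
by move=> r mr; apply: mi1J; exact: mul_idealP.
Qed.

(** Let x be in [p 1] outside the prime [p 0]. Artin-Rees for p 0 + (x) puts the colon of p 0 + a^n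
    by x inside p 0 + a^(n-k), so the length for [p 0] at n is at least that for [p 1] at n plus
    that for [p 0] at n - k. Iterating N times turns N^r into N^(r+1). *)
Lemma length_ge_chain (a : properIdeal A) r p : prime_chain r p ->
  exists k, forall N, (0 < N)%N ->
    length_ge (add_ideal (p 0%N) (exp_ideal a (k * N))) (N ^ r).
Proof.
have anm n : (0 < n)%N -> exp_ideal a n `<=` m.
  move=> n0; apply: subset_trans (proper_sub_local nA loc (pid_ideal a) (@pid_proper _ a)).
  exact: exp_ideal_sub_self (pid_ideal a) n0.
elim: r p => [|r IHr] p [pp plt].
  have [p0i p0T _] := pp 0%N isT.
  exists 1%N => N N0; rewrite expn0 mul1n; apply: length_ge1.
    exact: add_ideal_ideal (exp_ideal_ideal _ _).
  move=> E; apply: (local_n1 loc); have : [set: A] 1 by []. rewrite -E.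
  by apply: add_ideal_min => //; [exact: (proper_sub_local nA loc)|exact: anm].
have [|k0 hk0] := IHr (fun i => p i.+1).
  by split=> i ir; [exact: pp|exact: plt].
have [p0i p0T p0p] := pp 0%N isT.
have [p01 p10] := plt 0%N isT.
have [x p1x p0x] : exists2 x, p 1%N x & ~ p 0%N x.
  apply: contrapT => h; apply: p10 => x p1x; apply: contrapT => p0x.
  by apply: h; exists x.
have [p1i _ _] := pp 1%N isT.
have Vi := add_ideal_ideal p0i (principal_ideal x).
have [k ar] := artin_rees a nA Vi.
have Li n : is_ideal (add_ideal (p 0%N) (exp_ideal a n)).
  exact: add_ideal_ideal (exp_ideal_ideal _ _).
have col n : (k <= n)%N ->
    colon (add_ideal (p 0%N) (exp_ideal a n)) x `<=` add_ideal (p 0%N) (exp_ideal a (n - k)).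
  move=> kn b [u pu [v av bE]].
  have : mul_ideal (exp_ideal a (n - k)) (add_ideal (p 0%N) (principal x)) v.
    apply: ar => //; split=> //; exists (- u); first exact: idealN.
    by exists (b * x); [exists b|rewrite bE addKr].
  move=> hv; suff : add_ideal (p 0%N) (multiples (exp_ideal a (n - k)) x) v.
    move=> [u' pu' [_ [c ac ->] vE]].
    exists (b - c); last by exists c; rewrite ?subrK.
    have : p 0%N ((b - c) * x).
      rewrite mulrBl bE vE addrA addrK; exact: idealD.
    by case/p0p.
  move: v hv {av bE}; apply: mul_ideal_min.
    exact: add_ideal_ideal (multiples_ideal x (exp_ideal_ideal _ _)).
  move=> c _ ac [u' pu' [_ [s ->] ->]]; exists (c * u'); first exact: ideal_mull.
  exists (c * (s * x)); last by rewrite mulrDr.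
  by exists (c * s); [exact: (ideal_mulr _ (exp_ideal_ideal _ _))|rewrite mulrA].
have rec n r1 r2 : (k <= n)%N ->
    length_ge (add_ideal (p 1%N) (exp_ideal a n)) r1 ->
    length_ge (add_ideal (p 0%N) (exp_ideal a (n - k))) r2 ->
    length_ge (add_ideal (p 0%N) (exp_ideal a n)) (r1 + r2).
  move=> kn h1 h2; apply: (length_ge_colon (z := x) (Li n)).
    apply: length_ge_sub h1; apply: add_ideal_min.
    - exact: add_ideal_ideal (exp_ideal_ideal _ _).
    - exact: add_ideal_mono.
    - by move=> _ [s ->]; apply/add_ideal_subl; [exact: exp_ideal_ideal|exact: ideal_mull].
  apply: length_ge_sub h2; exact: col.
have iter n r1 j : length_ge (add_ideal (p 1%N) (exp_ideal a n)) r1 ->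
    length_ge (add_ideal (p 0%N) (exp_ideal a (n + j * k))) (j * r1).
  move=> h1; elim: j => [|j IHj].
    exists (fun=> setT), 0%N; rewrite mul0n; split=> //.
  rewrite [X in length_ge _ X]mulSn; apply: rec.
  - by rewrite mulSn; lia.
  - apply: length_ge_sub h1; apply: add_ideal_mono => //.
    by apply: exp_ideal_le; lia.
  - by have -> : (n + j.+1 * k - k = n + j * k)%N by rewrite mulSn; lia.
(* The [N] iterations start at exponent [k0 * N] and raise it by [k] each. *)
exists (k0 + k)%N => N N0; rewrite expnS mulnDl [(k * N)%N]mulnC.
by apply: iter; exact: hk0.
Qed.

(** An ideal p maximal among those whose lengths are not O(n^e) is prime: bounds for p + (x) and for
    [colon p x] would add up to one for p. In the inductive step x is in [I] outside p; a bound of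
    order n^e for p + (x) would sum to one of order n^(e+1) for p, so a chain above p + (x) exists
    by induction and p is put in front of it. *)
Lemma length_poly_bound I e0 : is_ideal I -> exp_ideal m e0 `<=` I ->
  forall e L, is_ideal L ->
  ~ (exists C, forall n, (0 < n)%N -> length_le (add_ideal L (exp_ideal I n)) (C * n ^ e)) ->
  exists2 p, prime_chain e.+1 p & L `<=` p 0%N.
Proof.
move=> Ii meI.
pose bounded e L := exists C, forall n, (0 < n)%N ->
  length_le (add_ideal L (exp_ideal I n)) (C * n ^ e).
have LIi L n : is_ideal L -> is_ideal (add_ideal L (exp_ideal I n)).
  by move=> Li; exact: add_ideal_ideal (exp_ideal_ideal _ _).
have fin_bounded e L : is_ideal L -> (exists N, length_le L N) -> bounded e L.
  move=> Li [N hN]; exists N => n n0; apply: length_le_sub hN.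
    exact/add_ideal_subl/exp_ideal_ideal.
  by rewrite leq_pmulr // expn_gt0 n0.
have maxprime e L : is_ideal L -> ~ bounded e L ->
    exists p, [/\ is_prime p, L `<=` p & ~ bounded e p].
  move=> Li nL; have [p [pi np Lp pmax]] := noetherian_max nA (P := fun J => ~ bounded e J) Li nL.
  exists p; split=> //; split=> //.
    move=> pT; apply: np; apply: fin_bounded => //; exists 0%N; rewrite pT; exact: length_leT.
  move=> x y pxy; apply: contrapT => /not_orP [npx npy].
  have [C hC] : bounded e (add_ideal p (principal x)).
    apply: contrapT => h; apply: npx.
    rewrite -(pmax _ (add_ideal_ideal pi (principal_ideal x)) h).
      exact/add_ideal_subr/principal_self.
    exact/add_ideal_subl/principal_ideal.
  have [D hD] : bounded e (colon p x).
    apply: contrapT => h; apply: npy.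
    rewrite -(pmax _ (colon_ideal x pi) h); first by rewrite /colon /= mulrC.
    by move=> z pz; exact: ideal_mulr.
  apply: np; exists (C + D)%N => n n0; rewrite mulnDl; apply: (@length_le_colon _ _ x).
    apply: length_le_sub (hC n n0) => //; apply: add_ideal_min.
    - exact: add_ideal_ideal (LIi _ _ pi) (principal_ideal x).
    - by apply: add_ideal_mono => //; exact/add_ideal_subl/exp_ideal_ideal.
    - apply: subset_trans; first exact: (add_ideal_subr pi).
      exact/add_ideal_subl/principal_ideal.
  apply: length_le_sub (hD n n0) => //; apply: add_ideal_min.
  - exact/colon_ideal/LIi.
  - by move=> z pz; apply: add_ideal_subl => //; exact: exp_ideal_ideal.
  - move=> z Iz; apply: add_ideal_subr => //; exact: (ideal_mulr _ (exp_ideal_ideal _ _)).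
elim=> [|e IHe] L Li nL; have [p [pp Lp np]] := maxprime _ L Li nL; have [pi pT _] := pp.
  have pm : p `<=` m by exact: (proper_sub_local nA loc).
  exists (fun i => if i is 0 then p else m) => //; split.
    by move=> [|i] _ //; exact: (local_prime nA loc).
  move=> [|i] // _; split=> // mp; apply: np; apply: fin_bounded => //.
  by exists 1%N; apply: length_le_sub length_le_local.
have [x Ix px] : exists2 x, I x & ~ p x.
  apply: contrapT => h; apply: np; apply: fin_bounded => //.
  apply: (@length_fin p e0) => // z mz; apply: contrapT => pz.
  by apply: h; exists z => //; exact: meI.
have pxi := add_ideal_ideal pi (principal_ideal x).
have [|q [qp qlt] pq] := IHe (add_ideal p (principal x)) pxi.
  move=> [C hC]; apply: np; exists C; elim=> [//|n IHn] _.
  have hn : length_le (add_ideal (add_ideal p (exp_ideal I n.+1)) (principal x)) (C * n.+1 ^ e).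
    apply: length_le_sub (hC n.+1 isT) => //; apply: add_ideal_min.
    - exact: add_ideal_ideal (LIi _ _ pi) (principal_ideal x).
    - by apply: add_ideal_mono => //; exact/add_ideal_subl/exp_ideal_ideal.
    - apply: subset_trans; first exact: (add_ideal_subr pi).
      exact/add_ideal_subl/principal_ideal.
  (* At exponent 1 the element [x] already lies in p + I, so the bound for p + (x) suffices. *)
  case: n IHn hn => [|n] IHn hn.
    rewrite !exp1n !muln1 in hn *; apply: length_le_sub hn => //; apply: add_ideal_min => //.
      exact: LIi.
    move=> _ [s ->]; apply: add_ideal_subr => //.
    by rewrite exp_ideal1 //; exact: ideal_mull.
  have le : (C * n.+2 ^ e + C * n.+1 ^ e.+1 <= C * n.+2 ^ e.+1)%N.
    rewrite -mulnDr leq_mul2l [(n.+2 ^ e.+1)%N]expnS mulSn leq_add2l [(n.+1 ^ _)%N]expnS.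
    by rewrite leq_mul2l; case: (e) => [|e2]; rewrite ?expn0 ?leqnn ?leq_exp2r ?leqnSn ?orbT.
  suff hc : length_le (colon (add_ideal p (exp_ideal I n.+2)) x) (C * n.+1 ^ e.+1).
    exact: length_le_sub le (length_le_colon hn hc).
  apply: length_le_sub (IHn isT) => // _ [u pu [v Iv ->]].
  exists (u * x); first exact: ideal_mulr.
  by exists (v * x); [rewrite mulrC; exact: mul_idealP|rewrite mulrDl].
exists (fun i => if i is j.+1 then q j else p) => //; split.
  by move=> [|i] // ie; exact: qp.
move=> [|i] ie; last exact: qlt.
split; first by apply: subset_trans pq; exact/add_ideal_subl/principal_ideal.
by move=> qp0; apply: px; apply: qp0; apply: pq; exact/add_ideal_subr/principal_self.
Qed.

Lemma length_le_krull d I e0 : krull_dim A d -> is_ideal I -> exp_ideal m e0 `<=` I ->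
  exists C, forall n, (0 < n)%N -> length_le (exp_ideal I n) (C * n ^ d).
Proof.
move=> [_ dmax] Ii meI.
have [C hC] : exists C, forall n, (0 < n)%N ->
    length_le (add_ideal [set 0] (exp_ideal I n)) (C * n ^ d).
  apply: contrapT => h; have [p pc _] := length_poly_bound Ii meI (@set0_ideal A) h.
  by have := dmax _ _ pc; rewrite ltnn.
exists C => n n0; apply: length_le_sub (hC n n0) => //.
by apply: add_ideal_min => // [|_ ->]; [|apply: ideal0]; exact: exp_ideal_ideal.
Qed.

End Dimension.

(** * Polynomials modulo a prime ideal *)

Lemma seq_max_ex d (T : orderType d) (s : seq T) : s != [::] ->
  exists2 x, x \in s & {in s, forall y, (y <= x)%O}.
Proof.
elim: s => // x [|z s] IHs _.
  by exists x; rewrite ?mem_head // => y; rewrite inE => /eqP ->.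
have [//|w ws wmax] := IHs.
have [xw|wx] := leP x w.
  exists w; first by rewrite inE ws orbT.
  by move=> y; rewrite inE => /orP[/eqP ->|/wmax].
exists x; first exact: mem_head.
move=> y; rewrite inE => /orP[/eqP -> //|/wmax yw].
exact: le_trans yw (ltW wx).
Qed.

Section PolynomialsModIdeal.
Variables (A : comNzRingType) (m : set A).

Definition coefs_in n (p : {mpoly A[n]}) : Prop := forall k, m p@_k.

Hypothesis mp : is_prime m.

Let mi : is_ideal m. Proof. by case: mp. Qed.

(** Let k and j be the largest monomials of [p] and [q] with coefficient outside [m]. In the
    coefficient of [p * q] at k + j every other term has a factor in [m]. *)
Lemma coefs_in_mul n (p q : {mpoly A[n]}) :
  coefs_in (p * q) -> coefs_in p \/ coefs_in q.
Proof.
have lead (r : {mpoly A[n]}) : ~ coefs_in r ->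
    exists k, ~ m r@_k /\ forall j, (k < j)%O -> m r@_j.
  move=> nr; pose s := [seq k <- msupp r | `[< ~ m r@_k >]].
  have sP k : ~ m r@_k -> k \in s.
    move=> nk; rewrite mem_filter; apply/andP; split; first exact/asboolP.
    rewrite mcoeff_msupp; apply/eqP => r0; apply: nk; rewrite r0; exact: ideal0.
  have [|k] := @seq_max_ex _ _ s.
    apply/eqP => s0; apply: nr => k; apply: contrapT => /sP.
    by rewrite s0.
  rewrite mem_filter => /andP[/asboolP nk _] kmax; exists k; split=> // j kj.
  by apply: contrapT => /sP /kmax; rewrite leNgt kj.
move=> pq; apply: contrapT => /not_orP[/lead [k [nk kP]] /lead [j [nj jP]]].
suff : m (p@_k * q@_j) by case: mp => _ _ h /h [].
have := pq (k + j)%MM; rewrite mcoeffM.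
pose N := (mdeg (k + j)).+1.
have lk : (mdeg k < N)%N by rewrite /N mdegD ltnS leq_addr.
have lj : (mdeg j < N)%N by rewrite /N mdegD ltnS leq_addl.
rewrite (bigD1 (BMultinom lk, BMultinom lj)) //= => hs.
rewrite -[X in m X](addrK (\sum_(i : 'X_{1..n < N, N} | (k + j == i.1 + i.2)%MM &&
  (i != (BMultinom lk, BMultinom lj))) p@_i.1 * q@_i.2)).
apply: idealB => //; apply: ideal_sum => // -[[u ulN] [v vN]] /= /andP[/eqP E ne].
have [uk|ku|uE] := ltgtP u k.
- apply: ideal_mull => //; apply: jP; rewrite ltNge; apply/negP => vj.
  have : ((u + v)%MM < (k + j)%MM)%O by exact: ltmc_le_add.
  by rewrite -E ltxx.
- by apply: ideal_mulr => //; exact: kP.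
- case/eqP: ne; congr pair; apply: val_inj => //=.
  by apply: (@addmI _ k); rewrite E uE.
Qed.

Lemma coefs_in_exp n (p : {mpoly A[n]}) e : coefs_in (p ^+ e) -> coefs_in p.
Proof.
elim: e => [|e IHe]; last by rewrite exprS => /coefs_in_mul [].
move=> /(_ 0%MM); rewrite mcoeff1 eqxx => m1; case: mp => _ mT _.
by case: mT; exact: ideal_eqT.
Qed.

Hypothesis inf : infinite_set (residue_classes m).

Lemma incongruent N : exists s : nat -> A, forall i j, (i < j < N)%N -> ~ m (s i - s j).
Proof.
elim: N => [|N [s sP]]; first by exists (fun=> 0) => i j; rewrite ltn0 andbF.
have [x xP] : exists x, forall i, (i < N)%N -> ~ m (s i - x).
  apply: contrapT => nx; apply: inf.
  pose cl x : set A := [set y | m (y - x)].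
  apply: (@sub_finite_set _ _ (cl @` (s @` `I_N))); last first.
    by do 2 apply: finite_image; exact: finite_II.
  move=> _ [x ->]; apply: contrapT => h; apply: nx; exists x => i iN mx.
  apply: h; exists (s i); first by exists i.
  apply/seteqP; split=> y; rewrite /cl /= => my.
    have -> : y - x = (y - s i) + (s i - x) by ring.
    exact: idealD.
  have -> : y - s i = (y - x) - (s i - x) by ring.
  exact: idealB.
exists (fun i => if i == N then x else s i) => i j /andP[ij].
rewrite ltnS leq_eqVlt => /orP[/eqP jN|jN].
  by rewrite jN eqxx ltn_eqF; [apply: xP|]; rewrite -jN.
by rewrite !ltn_eqF; [apply: sP; rewrite ij jN| | exact: ltn_trans jN].
Qed.

(** The factor theorem does the work of a Vandermonde determinant: dividing p - p(s_0) by X - s_0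
    gives a quotient with values in [m] at the remaining sample points, because the s_j - s_0 lie
    outside the prime [m]. *)
Lemma poly_coefs_in (p : {poly A}) : (forall s, m p.[s]) -> forall i, m p`_i.
Proof.
move=> pm; have [s sP] := incongruent (size p).
suff gen : forall N (q : {poly A}) (t : nat -> A), (size q <= N)%N ->
    (forall i j, (i < j < N)%N -> ~ m (t i - t j)) ->
    (forall i, (i < N)%N -> m q.[t i]) -> forall i, m q`_i.
  by apply: (gen (size p) p s).
elim=> [|N IHN] {sP pm s} p s.
  by rewrite leqn0 size_poly_eq0 => /eqP -> *; rewrite coef0; exact: ideal0.
move=> sp sP pm i.
have /factor_theorem [q qE] : root (p - p.[s 0%N]%:P) (s 0%N).
  by rewrite /root hornerD hornerN hornerC subrr.
have sq : (size q <= N)%N.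
  have [->|q0] := eqVneq q 0; first by rewrite size_poly0.
  have : size (p - p.[s 0%N]%:P) = (size q).+1.
    by rewrite qE size_Mmonic ?monicXsubC // size_XsubC addn2.
  move=> sE; rewrite -ltnS -sE (leq_trans (size_polyD _ _)) // geq_max sp size_polyN.
  by rewrite (leq_trans (size_polyC_leq1 _)).
have qm : forall i, m q`_i.
  apply: (IHN q (fun i => s i.+1) sq) => [j k /andP[jk kN]|j jN].
    by apply: sP; rewrite ltnS jk ltnS.
  have : m ((s j.+1 - s 0%N) * q.[s j.+1]).
    have -> : (s j.+1 - s 0%N) * q.[s j.+1] = p.[s j.+1] - p.[s 0%N].
      have := congr1 (fun r : {poly A} => r.[s j.+1]) qE.
      by rewrite hornerM hornerD hornerN !hornerC hornerXsubC mulrC => ->.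
    by apply: idealB => //; apply: pm.
  case: mp => _ _ h /h [] // /(idealN mi); rewrite opprB => ms.
  by case: (sP 0%N j.+1 _ ms); rewrite ltnS.
have -> : p = q * ('X - (s 0%N)%:P) + p.[s 0%N]%:P by rewrite -qE subrK.
rewrite mulrBr coefD coefB coefMX coefMC coefC.
apply: idealD => //; last by case: ifP => _; [apply: pm|exact: ideal0].
by apply: idealB => //; [case: ifP => _ //; exact: ideal0|exact: ideal_mulr].
Qed.

(** Uniqueness of base-[B] digits, for Kronecker substitution. *)
Lemma digits_inj n B (f g : 'I_n -> nat) : (forall i, (f i < B)%N) ->
  (forall i, (g i < B)%N) ->
  (\sum_i f i * B ^ i = \sum_i g i * B ^ i)%N -> f =1 g.
Proof.
elim: n f g => [|n IHn] f g fB gB; first by move=> _ [].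
have split h : (\sum_(i < n.+1) h i * B ^ i = h ord0 + B * \sum_(i < n) h (lift ord0 i) * B ^ i)%N.
  rewrite big_ord_recl expn0 muln1; congr (_ + _)%N; rewrite big_distrr /=.
  by apply: eq_bigr => i _; rewrite expnS mulnCA.
rewrite !split => E.
have f0 : f ord0 = g ord0.
  have := congr1 (modn^~ B) E; rewrite ![(B * _)%N]mulnC ![(_ + _ * B)%N]addnC.
  by rewrite !modnMDl !modn_small.
have E' : (\sum_(i < n) f (lift ord0 i) * B ^ i = \sum_(i < n) g (lift ord0 i) * B ^ i)%N.
  have B0 : (0 < B)%N by exact: leq_ltn_trans (fB ord0).
  by move/eqP: E; rewrite f0 eqn_add2l eqn_pmul2l // => /eqP.
move=> i; case: (unliftP ord0 i) => [j ->|->] //.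
exact: (IHn (fun i => f (lift ord0 i)) (fun i => g (lift ord0 i))).
Qed.

(* Kronecker substitution x_i = s ^ (B ^ i) reduces to one variable. *)
Lemma mpoly_coefs_in n (p : {mpoly A[n]}) : (forall v, m p.@[v]) -> coefs_in p.
Proof.
(* [msize p] exceeds every exponent in [p], so these exponents are base-[B] digits. *)
move=> pm; pose B := msize p; pose w (k : 'X_{1..n}) := (\sum_i k i * B ^ i)%N.
have wi (j k : 'X_{1..n}) : j \in msupp p -> k \in msupp p -> w j = w k -> j = k.
  have lt (l : 'X_{1..n}) : l \in msupp p -> forall i, (l i < B)%N.
    move=> /msize_mdeg_lt le i; apply: leq_ltn_trans le.
    by rewrite mdegE (bigD1 i) //= leq_addr.
  by move=> /lt jB /lt kB /(digits_inj jB kB) jk; apply/mnmP.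
pose q := \sum_(k <- msupp p) p@_k *: 'X^(w k).
have qm : forall i, m q`_i.
  apply: poly_coefs_in => s; suff -> : q.[s] = p.@[fun i => s ^+ (B ^ i)] by [].
  rewrite mevalE horner_sum; apply: eq_bigr => k _.
  rewrite hornerZ hornerXn; congr (_ * _); rewrite /w -prodrXr.
  by apply: eq_bigr => i _; rewrite mulnC exprM.
move=> k; have [kp|/memN_msupp_eq0 ->] := boolP (k \in msupp p); last exact: ideal0.
have := qm (w k); rewrite coef_sum (bigD1_seq k) ?msupp_uniq //=.
rewrite coefZ coefXn eqxx mulr1 big_seq_cond big1 ?addr0 // => j /andP[jp jk].
rewrite coefZ coefXn; case: eqP => [/wi h|]; last by rewrite mulr0.
by rewrite h ?eqxx // in jk.
Qed.

End PolynomialsModIdeal.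

(** * Reductions *)

Section Reductions.
Variables (A : comNzRingType) (m : set A).
Hypotheses (nA : noetherian A) (loc : local_ring m).
Hypothesis inf : infinite_set (residue_classes m).
Implicit Types (I J K L : set A).

Let mi := local_ideal loc.
Let mp := local_prime nA loc.

(* The fiber cone of I is a polynomial ring in the classes of the x i: no form
   with a coefficient outside m vanishes there. *)
Definition analytically_independent I n (x : 'I_n -> A) : Prop :=
  forall D (p : {mpoly A[n]}), p \is D.-homog ->
    mul_ideal m (exp_ideal I D) p.@[x] -> coefs_in m p.

Definition generates_reduction I n (x : 'I_n -> A) : Prop :=
  (forall i, I (x i)) /\
  exists r, mul_ideal (fspan x) (exp_ideal I r) = exp_ideal I r.+1.

Lemma generates_reduction_fspan I n (x : 'I_n -> A) : is_ideal I ->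
  generates_reduction I x <-> is_reduction (fspan x) I.
Proof.
move=> Ii; split=> [[Ix [r rE]]|[_ xI [r rE]]].
  by split; [exact: fspan_ideal|exact: fspan_min|exists r].
by split; [move=> i; apply: xI; exact: fspan_gen|exists r].
Qed.

Lemma reduction_exp J I r : mul_ideal J (exp_ideal I r) = exp_ideal I r.+1 ->
  forall D, mul_ideal (exp_ideal J D) (exp_ideal I r) = exp_ideal I (D + r).
Proof.
move=> rE; elim=> [|D IHD]; first by rewrite mul_idealT //; exact: exp_ideal_ideal.
rewrite exp_idealSr -mul_idealA rE addSn !exp_idealS mul_idealA.
by rewrite [mul_ideal _ I]mul_idealC -mul_idealA IHD.
Qed.

Lemma reduction_later J I r s : mul_ideal J (exp_ideal I r) = exp_ideal I r.+1 ->
  (r <= s)%N -> mul_ideal J (exp_ideal I s) = exp_ideal I s.+1.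
Proof.
move=> rE /subnK <-; elim: (s - r)%N => // k IHk.
by rewrite addSn !exp_idealS mul_idealA [mul_ideal J I]mul_idealC -mul_idealA IHk.
Qed.

Lemma mmap1_in_exp I n (x : 'I_n -> A) (k : 'X_{1..n}) :
  (forall i, I (x i)) -> exp_ideal I (mdeg k) (\prod_i x i ^+ k i).
Proof.
move=> Ix; rewrite mdegE.
have : forall P : pred 'I_n, exp_ideal I (\sum_(i | P i) k i) (\prod_(i | P i) x i ^+ k i).
  move=> P; elim/big_rec2: _ => // i j y _ IHy.
  by apply: exp_ideal_mul => //; exact: exp_ideal_gen.
exact.
Qed.

Lemma meval_in_exp I n (x : 'I_n -> A) D (p : {mpoly A[n]}) :
  (forall i, I (x i)) -> p \is D.-homog -> exp_ideal I D p.@[x].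
Proof.
move=> Ix /dhomogP ph; rewrite mevalE big_seq; apply: ideal_sum => [|k kp].
  exact: exp_ideal_ideal.
apply: (ideal_mull _ (exp_ideal_ideal I D)).
by rewrite -(ph k kp); exact: mmap1_in_exp.
Qed.

Lemma meval_scale n (t : A) (x : 'I_n -> A) D (p : {mpoly A[n]}) :
  p \is D.-homog -> p.@[fun i => t * x i] = t ^+ D * p.@[x].
Proof.
move=> /dhomogP ph; rewrite !mevalE mulr_sumr !big_seq; apply: eq_bigr => k kp.
rewrite mulrCA; congr (_ * _); rewrite -(ph k kp) /= mdegE -prodrXr -big_split /=.
by apply: eq_bigr => i _; rewrite exprMn.
Qed.

(* Modulo the x i - c i x_j, every form of degree D becomes a multiple of x_j ^ D. *)
Lemma meval_project n (x c : 'I_n -> A) j D (p : {mpoly A[n]}) :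
  p \is D.+1.-homog ->
  mul_ideal (fspan (fun i => x i - c i * x j)) (exp_ideal (fspan x) D)
    (p.@[x] - p.@[c] * x j ^+ D.+1).
Proof.
move=> /dhomogP ph; rewrite !mevalE mulr_suml -sumrB big_seq.
apply: ideal_sum => [|k /ph kD]; first exact: mul_ideal_ideal.
rewrite -mulrA -mulrBr; apply: (ideal_mull _ (mul_ideal_ideal _ _)).
rewrite -[\prod_i x i ^+ k i]/(mmap1 x k) -[\prod_i c i ^+ k i]/(mmap1 c k).
move: kD => /= kD; elim: D k kD {p ph} => [|D IHD] k kD.
  have /mdeg1P [i /eqP ->] : mdeg k == 1%N by exact/eqP.
  rewrite !mmap1U expr1 -[X in mul_ideal _ _ X]mulr1; apply: mul_idealP => //.
  exact: (fspan_gen (fun i => x i - c i * x j)).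
have [i ki] : exists i, (0 < k i)%N.
  apply: contrapT => h; have : mdeg k = 0%N.
    rewrite mdegE big1 // => i _; apply/eqP; rewrite -leqn0 leqNgt.
    by apply/negP => ki; apply: h; exists i.
  by rewrite kD.
have kE : (k = U_(i) + (k - U_(i)))%MM.
  rewrite addmC submK //; apply/mnm_lepP => l; rewrite mnm1E.
  by case: eqP => [<-|].
move: kD; rewrite kE mdegD mdeg1 add1n => -[kD].
rewrite !commr_mmap1_M ?mmap1U; try by move=> ? ?; exact: mulrC.
set X := mmap1 x _; set C := mmap1 c _; have hXC := IHD _ kD; rewrite -/X -/C in hXC.
have -> : x i * X - c i * C * x j ^+ D.+2 =
    (x i - c i * x j) * X + c i * x j * (X - C * x j ^+ D.+1).
  by rewrite !exprS; ring.
apply: (idealD (mul_ideal_ideal _ _)).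
  apply: mul_idealP; first exact: (fspan_gen (fun i => x i - c i * x j)).
  by rewrite -kD; apply: mmap1_in_exp => l; exact: fspan_gen.
rewrite -mulrA; apply: (ideal_mull _ (mul_ideal_ideal _ _)).
rewrite exp_idealS mul_idealA [X in mul_ideal X _]mul_idealC -mul_idealA.
by apply: mul_idealP => //; exact: fspan_gen.
Qed.

Lemma exp_span_split (P P' : set A) y D : P `<=` add_ideal P' (principal y) -> is_ideal P ->
  P y -> exp_ideal P D.+1 `<=` add_ideal (mul_ideal P' (exp_ideal P D)) (principal (y ^+ D.+1)).
Proof.
move=> PP Pi Py; elim: D => [|D IHD].
  rewrite exp_ideal1 // expr1; apply: subset_trans PP _.
  by apply: add_ideal_mono => // z P'z; rewrite -[z]mulr1; exact: mul_idealP.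
have Ki := add_ideal_ideal (mul_ideal_ideal P' (exp_ideal P D.+1)) (principal_ideal (y ^+ D.+2)).
rewrite exp_idealS; apply: (mul_ideal_min Ki).
move=> _ w /PP [u P'u [_ [r ->] ->]] Pw; rewrite mulrDl; apply: (idealD Ki).
  by apply: add_ideal_subl; [exact: principal_ideal|exact: mul_idealP].
rewrite -mulrA; apply: (ideal_mull _ Ki).
have [v hv [_ [s ->] ->]] := IHD _ Pw.
exists (y * v); last first.
  by exists (s * y ^+ D.+2); [exists s|rewrite !exprS; ring].
rewrite exp_idealS mul_idealA [X in mul_ideal X _]mul_idealC -mul_idealA.
exact: mul_idealP.
Qed.

(* One step of Noether normalisation of the fiber cone. *)
Lemma dependent_reduction I n (x : 'I_n -> A) : is_ideal I ->
  generates_reduction I x -> ~ analytically_independent I x ->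
  exists n' (x' : 'I_n' -> A), [/\ (n' < n)%N, forall i, fspan x (x' i) & generates_reduction I x'].
Proof.
move=> Ii [Ix [r rE]] /existsNP [D /existsNP [p /not_implyP [ph /not_implyP [pm np]]]].
have [v nv] : exists v, ~ m p.@[v].
  apply: contrapT => h; apply: np; apply: (mpoly_coefs_in mp inf) => v.
  by apply: contrapT => nv; apply: h; exists v.
(* Degree 0 cannot occur: a constant takes at [v] the value it takes at [x], which is in [m]. *)
case: D ph pm => [|D] ph pm.
  have pE w : p.@[w] = p.@[fun=> 0].
    rewrite -[p.@[w]]mul1r -(expr0 0) -(meval_scale 0 w ph).
    by apply: meval_eq => i; rewrite mul0r.
  by case: nv; rewrite pE -(pE x); exact: mul_ideal_subl mi _ pm.
have [j nvj] : exists j, ~ m (v j).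
  apply: contrapT => h; apply: nv; have vm i : m (v i).
    by apply: contrapT => nvi; apply: h; exists i.
  exact: (exp_ideal_sub_self mi (ltn0Sn D) (meval_in_exp vm ph)).
case: n x Ix rE p ph pm np v nv j nvj => [|n] x Ix rE p ph pm np v nv j nvj.
  by case: j {nvj}.
(* Scaling [v] by the inverse of [v j] gives [c j = 1]; then [y j = 0], which removes one
   generator. *)
have [u uv] := local_unit nA loc nvj.
pose c i := u * v i.
have nc : ~ m p.@[c].
  move=> mc; apply: nv; have -> : p.@[v] = p.@[fun i => v j * c i].
    by apply: meval_eq => i; rewrite /c mulrA [v j * u]mulrC uv mul1r.
  by rewrite (meval_scale _ _ ph); exact: ideal_mull.
have [w wc] := local_unit nA loc nc.
pose y i := x i - c i * x j.
have yj : y j = 0 by rewrite /y /c uv mul1r subrr.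
have Px i : fspan x (x i) by exact: fspan_gen.
have Pi := fspan_ideal x.
have Py i : fspan x (y i) by apply: (idealB Pi) => //; exact: (ideal_mull _ Pi).
exists n, (fun i => y (lift j i)); split=> //.
set x' := fun i => y (lift j i).
have x'y : fspan x' = fspan y.
  apply/seteqP; split; apply: fspan_min; try exact: fspan_ideal.
    by move=> i; exact: fspan_gen.
  move=> i; case: (unliftP j i) => [i' ->|->]; first exact: (fspan_gen x').
  by rewrite yj; exact: (ideal0 (fspan_ideal _)).
split; first by move=> i; apply: (fspan_min Ii Ix); exact: Py.
exists (D + r)%N; rewrite x'y.
have PI : fspan x `<=` I by exact: fspan_min.
have yI : fspan y `<=` I by apply: fspan_min => // i; exact: PI.
apply/seteqP; split; first by rewrite exp_idealS; exact: mul_ideal_mono.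
set L := mul_ideal _ _.
have Li : is_ideal L by exact: mul_ideal_ideal.
(* Modulo (y) I^(D+r), the ideal I^(D+1+r) = (x)^(D+1) I^r comes from x_j^(D+1) I^r. Up to (y)
   (x)^D, p(c) x_j^(D+1) equals p(x), an element of m I^(D+1), and p(c) is a unit. *)
apply: (nakayama nA loc) => //.
have Ki := add_ideal_ideal Li (mul_ideal_ideal m (exp_ideal I (D + r).+1)).
have EI := exp_ideal_ideal I r.
have E := reduction_exp rE D.+1; rewrite addSn in E.
rewrite -{1}E; apply: (mul_ideal_min Ki).
move=> s t Ps It.
have [|||s' hs' [_ [q ->] ->]] := @exp_span_split (fspan x) (fspan y) (x j) D _ _ _ s Ps => //.
  apply: fspan_min; first exact: add_ideal_ideal (fspan_ideal y) (principal_ideal _).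
  move=> i; exists (y i); first exact: fspan_gen.
  by exists (c i * x j); [exists (c i)|rewrite /y subrK].
have hL z : mul_ideal (fspan y) (exp_ideal (fspan x) D) z -> L (z * t).
  move=> hz; rewrite /L exp_idealD mul_idealA; apply: mul_idealP => //.
  by move: z hz; apply: mul_ideal_mono => //; exact: exp_ideal_mono.
rewrite mulrDl; apply: (idealD Ki).
  by apply: add_ideal_subl; [exact: mul_ideal_ideal|exact: hL].
have -> : q * x j ^+ D.+1 * t = q * w * (p.@[x] * t) -
    q * w * ((p.@[x] - p.@[c] * x j ^+ D.+1) * t) by rewrite -[q in LHS]mulr1 -wc !exprS; ring.
apply: (idealB Ki); apply: (ideal_mull _ Ki).
  apply: add_ideal_subr => //; rewrite -addSn exp_idealD mul_idealA.
  exact: mul_idealP.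
apply: add_ideal_subl; first exact: mul_ideal_ideal.
by apply: hL; exact: meval_project.
Qed.

(** The new generators stay in [fspan x] so that minimality of a reduction can be applied to them in
    [minimal_reduction_gen]. *)
Lemma independent_reduction I n (x : 'I_n -> A) : is_ideal I -> generates_reduction I x ->
  exists l (y : 'I_l -> A), [/\ forall i, fspan x (y i), generates_reduction I y
    & analytically_independent I y].
Proof.
move=> Ii; elim/ltn_ind: n x => n IHn x rx.
have [ind|/(dependent_reduction Ii rx) [n' [x' [lt xx' rx']]]] := EM (analytically_independent I x).
  by exists n, x; split=> // i; exact: fspan_gen.
have [l [y [xy ry iy]]] := IHn n' lt x' rx'; exists l, y; split=> // i.
by apply: (fspan_min (fspan_ideal x) xx').
Qed.

(** The N^n monomials with exponents below [N] are added to I^(nN+1) by decreasing degree. A step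
    that is not strict writes a monomial of degree D, up to I^(D+1), through others of degree at
    least D. Those of larger degree also lie in I^(D+1), hence in m I^D; what remains is a form of
    degree D with a coefficient 1, against independence. *)
Lemma length_ge_independent I n (x : 'I_n -> A) N : is_ideal I -> I `<=` m ->
  (forall i, I (x i)) -> analytically_independent I x ->
  length_ge (exp_ideal I (n * N).+1) (N ^ n).
Proof.
move=> Ii Im Ix ind.
pose T := {ffun 'I_n -> 'I_N}.
pose mon (e : T) : 'X_{1..n} := [multinom (e i : nat) | i < n].
have moni : injective mon.
  move=> e f /mnmP ef; apply/ffunP => i; apply: val_inj.
  by have := ef i; rewrite !mnmE.
pose ge (e f : T) := (mdeg (mon f) <= mdeg (mon e))%N.
pose s := sort ge (enum T).
have ss : size s = (N ^ n)%N by rewrite size_sort -cardE card_ffun !card_ord.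
have us : uniq s by rewrite sort_uniq enum_uniq.
have so : sorted ge s by apply: sort_sorted => e f; exact: leq_total.
have ge_tr : transitive ge by move=> e f g; rewrite /ge => h1 h2; exact: leq_trans h1.
pose X (e : T) := \prod_i x i ^+ mon e i.
pose XT k (i : 'I_(minn k (size s))) :=
  X (tnth (in_tuple (take k s)) (cast_ord (esym (size_take_min k s)) i)).
pose M k := fspan (XT k).
pose K k := add_ideal (exp_ideal I (n * N).+1) (M k).
have Mmem k e : e \in take k s -> M k (X e).
  move=> es; have lt : (index e (take k s) < minn k (size s))%N.
    by rewrite -size_take_min index_mem.
  have := fspan_gen (XT k) (Ordinal lt).
  by rewrite /XT (tnth_nth e) /= nth_index.
have Mmin k J : is_ideal J -> (forall e, e \in take k s -> J (X e)) -> M k `<=` J.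
  by move=> Ji h; apply: fspan_min => // i; apply: h; exact: mem_tnth.
have Ki k : is_ideal (K k) by apply: add_ideal_ideal; [exact: exp_ideal_ideal|exact: fspan_ideal].
exists K, (N ^ n)%N; split.
  split=> // k; first exact/add_ideal_subl/fspan_ideal.
  apply: add_ideal_mono => //; apply: Mmin; first exact: fspan_ideal.
  move=> e es; apply: Mmem.
  have [ks|sk] := ltnP k (size s).
    by rewrite (take_nth e) // mem_rcons inE es orbT.
  by move: es; rewrite !take_oversize ?(leqW sk).
rewrite /jumps -[leqLHS]card_ord -sum1_card leq_sum // => i _.
case: asboolP => // /contrapT E; exfalso.
have [e0 _] : exists e : T, e \in s.
  have : (0 < size s)%N by rewrite ss; exact: leq_ltn_trans (ltn_ord i).
  by case: (s) => // e s' _; exists e; rewrite mem_head.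
have is_ : (i < size s)%N by rewrite ss.
pose e := nth e0 s i.
have : K i (X e).
  rewrite E; apply: add_ideal_subr; first exact: exp_ideal_ideal.
  by apply: Mmem; rewrite (take_nth e0) // mem_rcons mem_head.
pose D := mdeg (mon e).
have DN : (D <= n * N)%N.
  rewrite /D mdegE; apply: (@leq_trans (\sum_(i < n) N)%N).
    by apply: leq_sum => l _; rewrite mnmE ltnW.
  by rewrite sum_nat_const card_ord.
move=> [w Iw [_ [c ->] XE]].
pose t := in_tuple (take i s).
pose ti (l : 'I_(minn i (size s))) := tnth t (cast_ord (esym (size_take_min i s)) l).
pose p : {mpoly A[n]} := 'X_[mon e] - \sum_(l | mdeg (mon (ti l)) == D) c l *: 'X_[mon (ti l)].
have ph : p \is D.-homog.
  apply: rpredB; first by rewrite dhomogX.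
  by apply: rpred_sum => l lD; apply: rpredZ; rewrite dhomogX.
have tie l : mon (ti l) != mon e.
  apply/eqP => /moni h; have : e \in take i s by rewrite -h; exact: mem_tnth.
  by rewrite in_take_leq ?(ltnW is_) // /e index_uniq // ltnn.
have geD l : (D <= mdeg (mon (ti l)))%N.
  have : ti l \in take i s by exact: mem_tnth.
  move=> h; have [/nthP-/(_ e0) [b]] : ti l \in take i s by [].
  rewrite size_take is_ => bi <-; rewrite nth_take //.
  exact: (sorted_leq_nth ge_tr (fun _ => leqnn _) e0 so b i (ltn_trans bi is_) is_ (ltnW bi)).
have pX : p.@[x] = w + \sum_(l | mdeg (mon (ti l)) != D) c l * X (ti l).
  rewrite mevalB mevalX -/(X e) XE rmorph_sum /= (bigID (fun l => mdeg (mon (ti l)) == D)) /=.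
  apply/eqP; rewrite subr_eq -addrA; apply/eqP; congr (w + _); rewrite addrC.
  by congr (_ + _); apply: eq_bigr => l _; rewrite mevalZ mevalX.
have mpx : mul_ideal m (exp_ideal I D) p.@[x].
  have sub : exp_ideal I D.+1 `<=` mul_ideal m (exp_ideal I D).
    by rewrite exp_idealS; exact: mul_ideal_mono.
  apply: sub; have Ei := exp_ideal_ideal I D.+1; rewrite pX; apply: (idealD Ei).
    by apply: exp_ideal_le Iw; rewrite ltnS.
  apply: (ideal_sum _ Ei) => l lD; apply: (ideal_mull _ Ei).
  apply: exp_ideal_le (mmap1_in_exp _ Ix).
  by rewrite ltn_neqAle eq_sym lD geD.
have := ind D p ph mpx (mon e); rewrite mcoeffB mcoeffX eqxx raddf_sum /= big1 ?subr0.
  exact: local_n1.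
by move=> l _; rewrite mcoeffZ mcoeffX (negPf (tie l)) mulr0.
Qed.

Lemma pow_dominated l d C k : (forall N, (0 < N)%N -> (N ^ l <= C * (k * N) ^ d)%N) ->
  (l <= d)%N.
Proof.
move=> h; rewrite leqNgt; apply/negP => dl.
pose N := (C * k ^ d).+1; have := h N isT.
rewrite expnMn mulnA leqNgt => /negP; apply.
apply: (@leq_trans (N * N ^ d)%N).
  by rewrite ltn_pmul2r ?expn_gt0.
by rewrite -expnS leq_pexp2l.
Qed.

Variables (d e0 : nat).
Hypothesis dimA : krull_dim A d.

Lemma independent_le_dim I n (x : 'I_n -> A) : is_ideal I -> I `<=` m ->
  exp_ideal m e0 `<=` I -> (forall i, I (x i)) -> analytically_independent I x -> (n <= d)%N.
Proof.
move=> Ii Im mI Ix ind; have [C hC] := length_le_krull nA loc dimA Ii mI.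
(* The factor [n.+1] is chosen because [n.+1 * N] is at least [(n * N).+1]. *)
apply: (@pow_dominated _ _ C n.+1) => N N0.
have ge := length_ge_independent N Ii Im Ix ind.
have := hC (n.+1 * N)%N; rewrite muln_gt0 N0 => /(_ isT) => le.
apply: (length_ge_le ge); apply: length_le_sub le => //.
by apply: exp_ideal_le; rewrite mulSn addnC -addn1 leq_add2l.
Qed.

(** For a chain of primes from p 0, the ideal p 0 + a^(kN) contains the powers x_i^(kN), so N^d is
    at most l (kN)^n, where l bounds the length of A / (x). *)
Lemma reduction_ge_dim (a : properIdeal A) n (x : 'I_n -> A) :
  exp_ideal m e0 `<=` a -> generates_reduction a x -> (d <= n)%N.
Proof.
move=> ma [ax [r rE]]; have ai := pid_ideal a.
have xi := fspan_ideal x.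
have [l hl] : exists l, length_le (fspan x) l.
  apply: (length_fin nA loc (e := e0 * r.+1)) => //.
  rewrite -exp_idealM; apply: subset_trans (exp_ideal_mono ma) _.
  by rewrite -rE; exact: mul_ideal_subl.
have [[p pc] _] := dimA.
have [k hk] := length_ge_chain nA loc a pc.
apply: (@pow_dominated _ _ l k) => N N0.
apply: (length_ge_le (hk N N0)).
have := @length_le_fspan _ [set 0] n x (k * N) l (@set0_ideal A).
rewrite [(_ * l)%N]mulnC => h; apply: length_le_sub (h _) => //.
  apply: add_ideal_min.
  - by apply: add_ideal_ideal; [case: (pc.1 0%N isT)|exact: exp_ideal_ideal].
  - move=> _ ->; apply: ideal0; apply: add_ideal_ideal;
      [by case: (pc.1 0%N isT)|exact: exp_ideal_ideal].
  - apply: subset_trans; last first.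
      by apply: add_ideal_subr; case: (pc.1 0%N isT).
    by apply: fspan_min; [exact: exp_ideal_ideal|move=> i; exact: exp_ideal_gen].
by apply: length_le_sub hl => //; apply: add_ideal_subr; exact: set0_ideal.
Qed.

Lemma exists_parameters (a : properIdeal A) : exp_ideal m e0 `<=` a ->
  exists y : 'I_d -> A, generates_reduction a y /\ analytically_independent a y.
Proof.
move=> ma; have ai := pid_ideal a.
have [n [x xE]] := noetherian_fspan nA ai.
have rx : generates_reduction a x.
  split; first by rewrite xE => i; exact: fspan_gen.
  by exists 0%N; rewrite -xE.
have [l [y [_ ry iy]]] := independent_reduction ai rx.
have am := proper_sub_local nA loc ai (@pid_proper _ a).
have ld : (l <= d)%N := independent_le_dim ai am ma ry.1 iy.
have dl := reduction_ge_dim ma ry.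
have E : l = d by apply/eqP; rewrite eqn_leq ld.
by move: y ry iy; rewrite E => y ry iy; exists y.
Qed.

(** An independent reduction inside [Q] equals [Q] by minimality. It has at most [d] generators, and
    zeros pad the list. *)
Lemma minimal_reduction_gen I Q : is_ideal I -> I `<=` m -> exp_ideal m e0 `<=` I ->
  minimal_reduction Q I -> exists f : 'I_d -> A, Q = fspan f.
Proof.
move=> Ii Im mI [Qred Qmin]; have [Qi QI [r rE]] := Qred.
have [n [x xE]] := noetherian_fspan nA Qi.
have rx : generates_reduction I x by apply/generates_reduction_fspan => //; rewrite -xE.
have [l [y [xy ry iy]]] := independent_reduction Ii rx.
have ld : (l <= d)%N := independent_le_dim Ii Im mI ry.1 iy.
have <- : fspan y = Q.
  apply: Qmin; first exact/generates_reduction_fspan.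
  by rewrite xE; apply: fspan_min => //; exact: fspan_ideal.
exists (fun i => if insub (i : nat) is Some j then y j else 0).
apply/seteqP; split; apply: fspan_min; try exact: fspan_ideal.
  move=> i; have := fspan_gen (fun i : 'I_d => if insub (i : nat) is Some j then y j else 0)
    (widen_ord ld i).
  by rewrite /= valK.
move=> i; case: insubP => [j _ _|_]; first exact: fspan_gen.
exact: (ideal0 (fspan_ideal _)).
Qed.

End Reductions.

(** * Graded modules *)

Section GradedModules.
Variables (R : comNzRingType) (gr : nat -> set R).
Local Notation gmod := (gradedModule gr).

Section Projections.
Variable M : gmod.
Implicit Types (n : int) (x y : M).

Lemma gm_compN n x : gm_comp n x -> gm_comp n (- x).
Proof. by move=> xn; rewrite -sub0r; apply: gm_compB => //; exact: gm_comp0. Qed.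

Lemma gm_compD n x y : gm_comp n x -> gm_comp n y -> gm_comp n (x + y).
Proof. by move=> xn yn; rewrite -[y]opprK; apply: gm_compB => //; exact: gm_compN. Qed.

Lemma gm_comp_sum n (T : Type) (s : seq T) (P : pred T) (f : T -> M) :
  (forall i, P i -> gm_comp n (f i)) -> gm_comp n (\sum_(i <- s | P i) f i).
Proof. by move=> h; apply: (big_ind (gm_comp n)) => //; [exact: gm_comp0|exact: gm_compD]. Qed.

(** The list in [gm_gen] may repeat degrees. A finitely supported family is unique
    ([decomposition_uniq]), so projections are well defined. *)
Definition decomposition x (f : int -> M) : Prop :=
  (forall n, gm_comp n (f n)) /\
  exists s : seq int, [/\ uniq s, forall n, n \notin s -> f n = 0 & x = \sum_(n <- s) f n].

Lemma decomposition_ex x : exists f, decomposition x f.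
Proof.
have [s [f [fn ->]]] := gm_gen x.
exists (fun n => \sum_(i <- s) if i == n then f i else 0); split.
  move=> n; apply: gm_comp_sum => i _; case: eqP => [->|_] //; exact: gm_comp0.
exists (undup s); split; first exact: undup_uniq.
  move=> n; rewrite mem_undup => ns; rewrite big_seq big1 // => i is_.
  by case: eqP => // E; rewrite -E is_ in ns.
rewrite exchange_big /= !big_seq; apply: eq_bigr => i is_.
rewrite (bigD1_seq i) ?mem_undup ?undup_uniq //= eqxx big1 ?addr0 // => j ji.
by rewrite eq_sym (negPf ji).
Qed.

Lemma sum_support (f : int -> M) (s t : seq int) : uniq s -> uniq t -> {subset s <= t} ->
  (forall n, n \notin s -> f n = 0) -> \sum_(n <- t) f n = \sum_(n <- s) f n.
Proof.
move=> us ut st f0; rewrite (bigID (mem s)) /= [X in _ + X]big1 ?addr0; last first.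
  by move=> n /f0.
rewrite -big_filter; apply: perm_big; apply: uniq_perm => //; first exact: filter_uniq.
by move=> n; rewrite mem_filter; case: (boolP (n \in s)) => //= /st ->.
Qed.

Lemma decomposition_uniq x f g : decomposition x f -> decomposition x g -> f =1 g.
Proof.
move=> [fn [s [us fs xs]]] [gn [t [ut gt xt]]] n.
pose u := undup (s ++ t).
have su : {subset s <= u} by move=> k ks; rewrite mem_undup mem_cat ks.
have tu : {subset t <= u} by move=> k ks; rewrite mem_undup mem_cat ks orbT.
have fg0 : \sum_(k <- u) (f k - g k) = 0.
  by rewrite sumrB (@sum_support f s u) ?(@sum_support g t u) ?undup_uniq // -xs -xt subrr.
have [nu|] := boolP (n \in u); last first.
  by rewrite mem_undup mem_cat => /norP [/fs -> /gt ->].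
apply/eqP; rewrite -subr_eq0; apply/eqP.
apply: (@gm_free _ _ M u (fun k => f k - g k)) => //; first exact: undup_uniq.
by move=> k; exact: gm_compB.
Qed.

Definition gm_proj n x : M := sval (cid (decomposition_ex x)) n.

Lemma gm_projP x : decomposition x (gm_proj ^~ x).
Proof. exact: svalP (cid (decomposition_ex x)). Qed.

Lemma gm_proj_comp n x : gm_comp n (gm_proj n x).
Proof. by have [h _] := gm_projP x; exact: h. Qed.

Lemma gm_proj_sum x : exists2 s : seq int, uniq s & x = \sum_(n <- s) gm_proj n x.
Proof. by have [_ [s [us _ xs]]] := gm_projP x; exists s. Qed.

Lemma gm_proj_eq x f n : decomposition x f -> gm_proj n x = f n.
Proof. by move=> h; apply: (decomposition_uniq (gm_projP x) h). Qed.

Lemma decompositionD x y f g : decomposition x f -> decomposition y g ->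
  decomposition (x + y) (fun n => f n + g n).
Proof.
move=> [fn [s [us fs xs]]] [gn [t [ut gt xt]]]; split=> [n|]; first exact: gm_compD.
pose u := undup (s ++ t).
have su : {subset s <= u} by move=> k ks; rewrite mem_undup mem_cat ks.
have tu : {subset t <= u} by move=> k ks; rewrite mem_undup mem_cat ks orbT.
exists u; split; first exact: undup_uniq.
  by move=> n; rewrite mem_undup mem_cat => /norP[/fs -> /gt ->]; rewrite addr0.
by rewrite big_split /= (@sum_support f s u) ?(@sum_support g t u) ?undup_uniq // -xs -xt.
Qed.

Lemma gm_projD n x y : gm_proj n (x + y) = gm_proj n x + gm_proj n y.
Proof. by rewrite (gm_proj_eq n (decompositionD (gm_projP x) (gm_projP y))). Qed.

Lemma decomposition_homog n x : gm_comp n x ->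
  decomposition x (fun k => if k == n then x else 0).
Proof.
move=> xn; split=> [k|]; first by case: eqP => [->|_] //; exact: gm_comp0.
exists [:: n]; split=> // [k|]; first by rewrite inE => /negPf ->.
by rewrite big_seq1 eqxx.
Qed.

Lemma gm_proj_homog n x k : gm_comp n x -> gm_proj k x = if k == n then x else 0.
Proof. by move=> xn; rewrite (gm_proj_eq k (decomposition_homog xn)). Qed.

Lemma gm_proj0 n : gm_proj n 0 = 0.
Proof. by rewrite (gm_proj_homog _ (gm_comp0 M 0)) if_same. Qed.

Lemma gm_projZ (i : nat) n r x : gr i r -> gm_proj (i%:Z + n) (r *: x) = r *: gm_proj n x.
Proof.
move=> ri; pose f k : M := r *: gm_proj (k - i%:Z) x.
rewrite (@gm_proj_eq _ f); first by rewrite /f addrC addKr.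
have [h [s [us fs xs]]] := gm_projP x; split=> [k|].
  by have := gm_compZ ri (h (k - i%:Z)); rewrite addrC subrK.
exists [seq k + i%:Z | k <- s]; split.
- by rewrite map_inj_uniq //; exact: addIr.
- move=> k ks; rewrite /f fs ?scaler0 //; apply: contra ks => ks.
  by apply/mapP; exists (k - i%:Z) => //; rewrite subrK.
- by rewrite {1}xs scaler_sumr big_map; apply: eq_bigr => k _; rewrite /f addrK.
Qed.

End Projections.

Lemma gm_proj_hom (M N : gmod) (h : gradedHom M N) n x :
  gm_proj n (h x) = h (gm_proj n x).
Proof.
apply: (@gm_proj_eq N _ (fun k => h (gm_proj k x))); have [fn [s [us fs xs]]] := gm_projP x; split=> [k|].
  exact: gh_deg.
exists s; split=> // [k /fs ->|]; first by rewrite linear0.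
by rewrite {1}xs linear_sum.
Qed.

(** [gradedModule] accepts any family [gr] of subsets. To make the ring and its homogeneous ideals
    into graded modules, on which injectivity is tested, [gr] has to grade the ring. *)
Record grading : Prop := Grading {
  gr_deg0 : forall n, gr n 0;
  gr_degB : forall n r s, gr n r -> gr n s -> gr n (r - s);
  gr_deg1 : gr 0 1;
  gr_degM : forall i j r s, gr i r -> gr j s -> gr (i + j) (r * s);
  gr_gen : forall r, exists (s : seq nat) (f : nat -> R),
    (forall n, gr n (f n)) /\ r = \sum_(n <- s) f n;
  gr_free : forall (s : seq nat) (f : nat -> R),
    uniq s -> (forall n, gr n (f n)) -> \sum_(n <- s) f n = 0 -> forall n, n \in s -> f n = 0
}.

Hypothesis grP : grading.

Lemma gr_degX y n : gr 1 y -> gr n (y ^+ n).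
Proof.
move=> y1; elim: n => [|n IHn]; first exact: gr_deg1.
by rewrite exprS -add1n; exact: gr_degM.
Qed.

Section RegularModule.
Variable sh : int.

(* R(-sh), the regular module generated by 1 in degree sh. *)
Definition reg_comp (n : int) : set R^o :=
  if n - sh is Posz k then gr k else [set 0].

Lemma reg_comp0 n : reg_comp n 0.
Proof. by rewrite /reg_comp; case: (n - sh) => // k; exact: gr_deg0. Qed.

Lemma reg_compB n x y : reg_comp n x -> reg_comp n y -> reg_comp n (x - y).
Proof.
rewrite /reg_comp; case: (n - sh) => [k|k /= -> ->]; first exact: gr_degB.
by rewrite subrr.
Qed.

Lemma reg_compZ i n r (x : R^o) : gr i r -> reg_comp n x -> reg_comp (i%:Z + n) (r *: x).
Proof.
move=> ri; rewrite /reg_comp -addrA; case: (n - sh) => [k xk|k /= ->].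
  by rewrite -PoszD; exact: gr_degM.
by rewrite scaler0; case: (i%:Z + _) => // j; exact: gr_deg0.
Qed.

Lemma reg_gen (x : R^o) : exists (s : seq int) (f : int -> R^o),
  (forall n, reg_comp n (f n)) /\ x = \sum_(n <- s) f n.
Proof.
have [s [f [fn ->]]] := gr_gen grP x.
exists [seq k%:Z + sh | k <- s], (fun n => if n - sh is Posz k then f k else 0); split.
  by move=> n; rewrite /reg_comp; case: (n - sh).
by rewrite big_map; apply: eq_bigr => k _; rewrite addrK.
Qed.

Lemma reg_free (s : seq int) (f : int -> R^o) :
  uniq s -> (forall n, reg_comp n (f n)) -> \sum_(n <- s) f n = 0 ->
  forall n, n \in s -> f n = 0.
Proof.
move=> us fn s0 n ns.
have := fn n; rewrite /reg_comp; case E : (n - sh) => [k|k] // _.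
pose t := [seq `|i - sh|%N | i <- s & 0 <= i - sh].
have nE i : 0 <= i - sh -> i = `|i - sh|%N%:Z + sh by move=> /gez0_abs ->; rewrite subrK.
have h : forall j, j \in t -> f (j%:Z + sh) = 0.
  apply: (gr_free grP (f := fun j => f (j%:Z + sh))) => [|j|].
  - rewrite map_inj_in_uniq ?filter_uniq // => i j.
    by rewrite !mem_filter => /andP[i0 _] /andP[j0 _] ij; rewrite (nE i) // (nE j) // ij.
  - by have := fn (j%:Z + sh); rewrite /reg_comp addrK.
  - rewrite big_map big_filter -[RHS]s0 [RHS](bigID (fun i => 0 <= i - sh)) /=.
    rewrite [X in _ + X]big1 ?addr0; first by apply: eq_bigr => i i0; rewrite -nE.
    by move=> i; have := fn i; rewrite /reg_comp; case: (i - sh).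
rewrite (nE n) ?E //; apply: h; apply/mapP; exists n; last by rewrite E.
by rewrite mem_filter E.
Qed.

Definition reg_module : gmod := GradedModule reg_comp0 reg_compB reg_compZ reg_gen reg_free.

End RegularModule.

Definition rproj (n : int) (r : R) : R := gm_proj (M := reg_module 0) n r.

Lemma rproj_mul (i : int) j r z : gr j z -> rproj i (r * z) = rproj (i - j%:Z) r * z.
Proof.
move=> zj; rewrite mulrC /rproj -[z * r]/(z *: (r : R^o)) -{1}[i](subrK j%:Z) addrC.
by rewrite (gm_projZ (M := reg_module 0) _ _ zj) mulrC.
Qed.

Lemma rprojD n r s : rproj n (r + s) = rproj n r + rproj n s.
Proof. exact: (gm_projD (M := reg_module 0)). Qed.

Lemma rproj0 n : rproj n 0 = 0.
Proof. exact: (gm_proj0 (reg_module 0)). Qed.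

Record homIdeal := HomIdeal {
  hi_set :> set R;
  hi_ideal : is_ideal hi_set;
  hi_homog : forall n r, hi_set r -> hi_set (rproj n r)
}.

Section IdealModule.
Variable K : homIdeal.

Definition hi_pred : {pred R^o} := fun r => `[< hi_set K r >].

Lemma hi_predP (r : R) : reflect (hi_set K r) (r \in hi_pred).
Proof. exact: asboolP. Qed.

Lemma hi_submod : GRing.submod_closed hi_pred.
Proof.
split; first by apply/hi_predP; exact: (ideal0 (hi_ideal K)).
move=> r x y /hi_predP Kx /hi_predP Ky; apply/hi_predP.
by apply: (idealD (hi_ideal K)) => //; exact: (ideal_mull _ (hi_ideal K)).
Qed.

HB.instance Definition _ := GRing.isSubmodClosed.Build R R^o hi_pred hi_submod.

Record hi_elt := HiElt { hi_val :> R^o; hi_valP : hi_val \in hi_pred }.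
HB.instance Definition _ := [isSub for hi_val].
HB.instance Definition _ := [Choice of hi_elt by <:].
HB.instance Definition _ := [SubChoice_isSubLmodule of hi_elt by <:].

Variable sh : int.

Definition hi_comp (n : int) : set hi_elt := [set x | gm_comp (g := reg_module sh) n (val x)].

Lemma hi_comp0 n : hi_comp n 0.
Proof. by rewrite /hi_comp /mkset raddf0; exact: (reg_comp0 sh n). Qed.

Lemma hi_compB n x y : hi_comp n x -> hi_comp n y -> hi_comp n (x - y).
Proof. by rewrite /hi_comp /mkset raddfB; exact: (@reg_compB sh n). Qed.

Lemma hi_compZ i n r (x : hi_elt) : gr i r -> hi_comp n x -> hi_comp (i%:Z + n) (r *: x).
Proof. by rewrite /hi_comp /mkset linearZ; exact: (@reg_compZ sh i n). Qed.

Lemma hi_gen (x : hi_elt) : exists (s : seq int) (f : int -> hi_elt),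
  (forall n, hi_comp n (f n)) /\ x = \sum_(n <- s) f n.
Proof.
have Kp n : rproj n (val x) \in hi_pred.
  by apply/hi_predP; apply: hi_homog; exact/hi_predP/hi_valP.
have [s us xs] := @gm_proj_sum (reg_module 0) (val x).
exists [seq n + sh | n <- s], (fun n => HiElt (Kp (n - sh))); split.
  move=> n; have := @gm_proj_comp (reg_module 0) (n - sh) (val x).
  by rewrite /hi_comp /= /reg_comp subr0.
apply: val_inj; rewrite raddf_sum big_map {1}xs; apply: eq_bigr => n _ /=.
by rewrite addrK.
Qed.

Lemma hi_free (s : seq int) (f : int -> hi_elt) :
  uniq s -> (forall n, hi_comp n (f n)) -> \sum_(n <- s) f n = 0 ->
  forall n, n \in s -> f n = 0.
Proof.
move=> us fn s0 n ns; apply: val_inj; rewrite raddf0.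
apply: (@reg_free sh s (fun n => val (f n))) => //.
by rewrite -raddf_sum s0 raddf0.
Qed.

Definition ideal_module : gmod := GradedModule hi_comp0 hi_compB hi_compZ hi_gen hi_free.

Lemma hi_val_linear : linear (hi_val : hi_elt -> R^o).
Proof. by move=> r x y; rewrite -![hi_val _]/(val _) linearP. Qed.

HB.instance Definition _ := GRing.isLinear.Build R hi_elt R^o _ hi_val hi_val_linear.

Definition ideal_incl : gradedHom ideal_module (reg_module sh) :=
  @GradedHom _ _ ideal_module (reg_module sh) hi_val (fun n x xn => xn).

End IdealModule.

(* Extending l + y ^ (k + t) r |-> y ^ k r e from the ideal L + (y ^ (k + t)) to R. *)
Lemma injective_divisible (E : gmod) (L : homIdeal) y k t (n : int) (e : E) :
  graded_injective E -> gr 1 y ->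
  (forall r, hi_set L (y ^+ (k + t) * r) -> hi_set L (y ^+ k * r)) ->
  gm_comp n e -> (forall r, hi_set L r -> r *: e = 0) ->
  exists e' : E, [/\ gm_comp (n - t%:Z) e', forall r, hi_set L r -> r *: e' = 0 &
    y ^+ (k + t) *: e' = y ^+ k *: e].
Proof.
move=> injE y1 colL en Le; pose z := y ^+ (k + t).
have zk : gr (k + t) z by exact: gr_degX.
have Li := hi_ideal L.
pose Ks := add_ideal L (principal z).
have Ki : is_ideal Ks by exact: add_ideal_ideal (principal_ideal z).
have projz (i : int) r := rproj_mul i r zk.
have Kh i r : Ks r -> Ks (rproj i r).
  move=> [l Ll [_ [s ->] ->]]; exists (rproj i l); first exact: hi_homog.
  exists (rproj i (s * z)); last exact: rprojD.
  by rewrite projz; exists (rproj (i - (k + t)%:Z) s).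
(* With 1 placed in degree n - t, [z] gets the degree k + n of y^k e. *)
pose K := HomIdeal Ki Kh; pose sh := n - t%:Z.
(* If (s - s') z is in [L], then [colL] puts (s - s') y^k in [L], which kills [e]. *)
have wd l s l' s' : hi_set L l -> hi_set L l' -> l + s * z = l' + s' * z ->
    s *: (y ^+ k *: e) = s' *: (y ^+ k *: e).
  move=> Ll Ll' E1; apply/eqP; rewrite -subr_eq0 -scalerBl scalerA; apply/eqP/Le.
  rewrite mulrC; apply: colL; have -> : y ^+ (k + t) * (s - s') = l' - l.
    rewrite -/z mulrC mulrBl; apply/eqP; rewrite subr_eq -addrA [- l + _]addrC addrA.
    by rewrite -E1 addrAC subrr add0r.
  exact: idealB.
have Kdec (x : hi_elt K) : exists s, exists2 l, hi_set L l & val x = l + s * z.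
  have /hi_predP [l Ll [_ [s ->] xE]] := hi_valP x.
  by exists s, l.
have [s sP] := choice Kdec.
pose f (x : ideal_module K sh) : E := s x *: (y ^+ k *: e).
have fE (x : hi_elt K) l r : hi_set L l -> val x = l + r * z -> f x = r *: (y ^+ k *: e).
  move=> Ll xE; have [l' Ll' xE'] := sP x.
  by apply: (wd l' _ l) => //; rewrite -xE' xE.
have flin : linear f.
  move=> r x x'; have [l Ll xE] := sP x; have [l' Ll' xE'] := sP x'.
  rewrite (fE _ (r * l + l') (r * s x + s x')); first by rewrite scalerDl -scalerA.
    by apply: (idealD Li) => //; exact: (ideal_mull _ Li).
  rewrite linearP /= -[hi_val x]/(val x) -[hi_val x']/(val x') xE xE'.
  by rewrite /GRing.scale /= mulrDr mulrDl addrACA mulrA.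
pose F : {linear ideal_module K sh -> E} := HB.pack f (GRing.isLinear.Build R _ _ _ f flin).
(* By [fE] any decomposition of [x] computes [f x]; the one projected to the degree of [x] shows the
   degree of the image. *)
have Fdeg i x : gm_comp i x -> gm_comp i (F x).
  rewrite -[F x]/(f x) => xi.
  have xi' : gm_comp (g := reg_module 0) (i - sh) (val x : R^o).
    by move: xi; rewrite /= /hi_comp /= /reg_comp subr0.
  have [l Ll xE] := sP x.
  have E2 : val x = rproj (i - sh) l + rproj (i - sh - (k + t)%:Z) (s x) * z.
    have := gm_proj_homog (i - sh) xi'; rewrite eqxx => {1}<-.
    by rewrite -projz xE; exact: rprojD.
  rewrite (fE _ _ _ (hi_homog _ Ll) E2).
  have := @gm_proj_comp (reg_module 0) (i - sh - (k + t)%:Z) (s x).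
  rewrite -/(rproj _ _) /= /reg_comp subr0; case E3 : (i - sh - _) => [j|j].
    move=> sj; have -> : i = j%:Z + (k%:Z + n).
      by move/eqP: E3; rewrite /sh !subr_eq => /eqP ->; rewrite PoszD; ring.
    by apply: gm_compZ => //; apply: gm_compZ => //; exact: gr_degX.
  by move=> /= ->; rewrite scale0r; exact: gm_comp0.
have inj : injective (ideal_incl K sh) by exact: val_inj.
have [g gP] := injE _ _ (ideal_incl K sh) (GradedHom Fdeg) inj.
exists (g 1); split.
- by apply: gh_deg; rewrite /= /reg_comp subrr; exact: gr_deg1.
- move=> r Lr; rewrite -linearZ; have Kr : r \in hi_pred K.
    by apply/hi_predP; apply: add_ideal_subl => //; exact: principal_ideal.
  have -> : r *: (1 : R^o) = ideal_incl K sh (HiElt Kr) by rewrite /GRing.scale /= mulr1.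
  rewrite gP -[LHS]/(f (HiElt Kr)) (fE _ r 0) ?scale0r //= mul0r addr0 //.
- rewrite -linearZ; have Kr : z \in hi_pred K.
    by apply/hi_predP; apply: add_ideal_subr => //; exact: principal_self.
  have -> : y ^+ (k + t) *: (1 : R^o) = ideal_incl K sh (HiElt Kr).
    by rewrite /GRing.scale /= mulr1.
  rewrite gP -[LHS]/(f (HiElt Kr)) (fE _ 0 1) ?scale1r //; first exact: ideal0.
  by rewrite /= mul1r add0r.
Qed.

End GradedModules.

(** * Local cohomology by parameters *)

Section LocalCohomologyByParameters.
Variables (R : comNzRingType) (gr : nat -> set R).
Hypotheses (nR : noetherian R) (grP : grading gr).
Variable y : nat -> R.
Hypothesis y1 : forall i, gr 1 (y i).
Local Notation gmod := (gradedModule gr).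

Let yX i n : gr n (y i ^+ n). Proof. exact: gr_degX. Qed.

(* x is killed by a power of the ideal (y 0, ..., y (j - 1)). *)
Definition killed (j : nat) (N : gmod) (x : N) : Prop :=
  forall i, (i < j)%N -> exists t, y i ^+ t *: x = 0.

Lemma killedZ j (N : gmod) r (x : N) : killed j x -> killed j (r *: x).
Proof.
move=> kx i ij; have [t tx] := kx i ij; exists t.
by rewrite scalerA mulrC -scalerA tx scaler0.
Qed.

Lemma killedB j (N : gmod) (x x' : N) : killed j x -> killed j x' -> killed j (x - x').
Proof.
move=> kx kx' i ij; have [t tx] := kx i ij; have [t' tx'] := kx' i ij.
exists (t + t')%N; rewrite scalerBr exprD -[X in _ - X]scalerA tx' scaler0 subr0.
by rewrite mulrC -scalerA tx scaler0.
Qed.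

Lemma killed_hom j (M N : gmod) (h : gradedHom M N) x : killed j x -> killed j (h x).
Proof.
by move=> kx i ij; have [t tx] := kx i ij; exists t; rewrite -linearZ tx linear0.
Qed.

Lemma killedS j (N : gmod) (x : N) : killed j.+1 x -> killed j x.
Proof. by move=> kx i ij; apply: kx; exact: ltnW. Qed.

Lemma killed_recr j (N : gmod) (x : N) t : killed j x -> y j ^+ t *: x = 0 -> killed j.+1 x.
Proof.
move=> kx tx i; rewrite ltnS leq_eqVlt => /orP[/eqP ->|/kx //].
by exists t.
Qed.

Lemma killed_uniform j (N : gmod) (x : N) : killed j x ->
  exists T, forall i, (i < j)%N -> y i ^+ T *: x = 0.
Proof.
elim: j => [|j IHj] kx; first by exists 0%N.
have [T TP] := IHj (killedS kx); have [t tx] := kx j (ltnSn j).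
exists (T + t)%N => i; rewrite ltnS leq_eqVlt => /orP[/eqP ->|ij].
  by rewrite exprD -scalerA tx scaler0.
by rewrite addnC exprD -scalerA TP // scaler0.
Qed.

(** In the localisation at [y j], e' is e / y_j^t. The exponent [k] is where the colon ideals of
    (y_i^T : i < j) by powers of [y j] become stationary, which is the hypothesis of
    [injective_divisible]. *)
Lemma killed_divisible j (E : gmod) t (n : int) (e : E) : graded_injective E ->
  gm_comp n e -> killed j e -> exists k (e' : E), [/\ gm_comp (n - t%:Z) e', killed j e' &
    y j ^+ (k + t) *: e' = y j ^+ k *: e].
Proof.
move=> injE en /killed_uniform [T TP].
pose x (i : 'I_j) := y i ^+ T.
have Lh i r : fspan x r -> fspan x (rproj grP i r).
  move=> [c ->]; apply: (big_ind (fun r => fspan x (rproj grP i r))).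
  - by rewrite rproj0; exact: (ideal0 (fspan_ideal x)).
  - by move=> r1 r2 h1 h2; rewrite rprojD; apply: (idealD (fspan_ideal x)).
  - move=> l _; rewrite (rproj_mul grP _ _ (yX l T)).
    by apply: (ideal_mull _ (fspan_ideal x)); exact: (fspan_gen x).
pose L := HomIdeal (fspan_ideal x) Lh.
have [k kP] : exists k, forall n, (k <= n)%N ->
    colon (fspan x) (y j ^+ n) = colon (fspan x) (y j ^+ k).
  apply: (noetherian_acc nR (I := fun n => colon (fspan x) (y j ^+ n))) => [i|i r].
    exact/colon_ideal/fspan_ideal.
  by rewrite /colon /= exprS mulrCA; exact: (ideal_mull _ (fspan_ideal x)).
have [||e' [e'n Le' e'E]] := @injective_divisible _ _ grP E L (y j) k t n e injE (y1 j) _ en.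
- move=> r; have := kP (k + t)%N (leq_addr _ _) => /seteqP[h _].
  by rewrite mulrC [y j ^+ k * r]mulrC; exact: h.
- move=> r [c ->]; rewrite scaler_suml big1 // => i _.
  by rewrite -scalerA TP // scaler0.
exists k, e'; split=> // i ij; exists T; apply: Le'.
exact: (fspan_gen x (Ordinal ij)).
Qed.

(** * Cohomology of the subcomplexes killed by powers of parameters *)

Variables (M : gmod) (E : injectiveResolution M).

Lemma diff_diff i (x : ir_obj E i) : ir_diff E i.+1 (ir_diff E i x) = 0.
Proof. by apply/ir_exact; exists x. Qed.

Lemma diff_aug x : ir_diff E 0 (ir_aug E x) = 0.
Proof. by apply/ir_exact0; exists x. Qed.

Lemma gm_hom_preim (N N' : gmod) (h : gradedHom N N') n x x' :
  gm_comp n x -> x = h x' -> exists2 u, gm_comp n u & x = h u.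
Proof.
move=> xn xE; exists (gm_proj n x'); first exact: gm_proj_comp.
by rewrite -gm_proj_hom -xE (gm_proj_homog _ xn) eqxx.
Qed.

(* With C j the subcomplex of E killed by powers of y 0, ..., y (j - 1), divisibility
   gives 0 -> C (j + 1) -> C j -> (C j) localised at y j -> 0, so that H^i (C j) = 0 for i > j. *)
Lemma killed_acyclic j i n (z : ir_obj E i.+1) : (j <= i)%N -> gm_comp n z -> killed j z ->
  ir_diff E i.+1 z = 0 -> exists w, [/\ gm_comp n w, killed j w & z = ir_diff E i w].
Proof.
elim: j i n z => [|j IHj] i n z.
  move=> _ zn _ /ir_exact [w zE]; have [u un uE] := gm_hom_preim zn zE.
  by exists u.
case: i z => // i z ji zn kz z0.
have [w [wn kw zE]] := IHj i.+1 n z (ltnW ji) zn (killedS kz) z0.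
have [t tz] := kz j (ltnSn j).
have [|||v [vn kv vE]] := IHj i (t%:Z + n) (y j ^+ t *: w) ji.
- exact: gm_compZ.
- exact: killedZ.
- by rewrite linearZ -zE.
have [k [v' [v'n kv' v'E]]] := killed_divisible t (@ir_inj _ _ _ E i) vn kv.
rewrite addrAC subrr add0r in v'n.
(* The correction has differential 0 and agrees with [w] after multiplication by y_j^(k+t). *)
exists (w - ir_diff E i v'); split.
- by apply: gm_compB => //; exact: gh_deg.
- apply: (@killed_recr j _ _ (k + t)).
    by apply: killedB => //; exact: killed_hom.
  by rewrite scalerBr -linearZZ v'E linearZZ -vE exprD -scalerA subrr.
- by rewrite linearB /= diff_diff subr0.
Qed.

(* rep z t g: the cocycle z of C j represents the class of g / (y 0 ... y (j - 1)) ^ t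
   in the direct limit of the M / (y 0 ^ t, ..., y (j - 1) ^ t) M. *)
Fixpoint rep (j : nat) (n : int) : ir_obj E j -> nat -> M -> Prop :=
  match j return ir_obj E j -> nat -> M -> Prop with
  | 0 => fun z _ g => gm_comp n g /\ z = ir_aug E g
  | j'.+1 => fun z t g => exists w, [/\ gm_comp n w, killed j' w, z = ir_diff E j' w &
      rep (t%:Z + n) (y j' ^+ t *: w) t g]
  end.

Definition yprod j s : R := \prod_(i < j) y i ^+ s.

Lemma yprodS j s : yprod j.+1 s = yprod j s * y j ^+ s.
Proof. by rewrite /yprod big_ord_recr. Qed.

Lemma yprodD j s t : yprod j (s + t) = yprod j s * yprod j t.
Proof. by rewrite /yprod -big_split; apply: eq_bigr => i _; rewrite exprD. Qed.

Lemma yprod_deg j s : gr (j * s) (yprod j s).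
Proof.
elim: j => [|j IHj]; first by rewrite mul0n /yprod big_ord0; exact: gr_deg1.
by rewrite yprodS mulSnr; apply: gr_degM.
Qed.

Lemma rep_cocycle j n z t g : rep (j := j) n z t g ->
  [/\ gm_comp n z, killed j z, ir_diff E j z = 0 & gm_comp ((j * t)%N%:Z + n) g].
Proof.
elim: j n z => [|j IHj] n z.
  by move=> [gn ->]; split=> //; [exact: gh_deg|exact: diff_aug|rewrite mul0n add0r].
move=> [w [wn kw -> /IHj [_ _ w0 gn]]]; split.
- exact: gh_deg.
- apply: (@killed_recr j _ _ t); first exact: killed_hom.
  by rewrite -linearZ.
- exact: diff_diff.
- by rewrite mulSnr PoszD -addrA.
Qed.

Lemma rep_scale j n z t g i r : gr i r ->
  rep (j := j) n z t g -> rep (i%:Z + n) (r *: z) t (r *: g).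
Proof.
move=> ri; elim: j n z => [|j IHj] n z.
  by move=> [gn ->]; split; [exact: gm_compZ|rewrite linearZ].
move=> [w [wn kw -> rw]]; exists (r *: w); split.
- exact: gm_compZ.
- exact: killedZ.
- by rewrite linearZ.
- by rewrite addrCA scalerA mulrC -scalerA; exact: IHj.
Qed.

Lemma repB j n z z' t g g' : rep (j := j) n z t g -> rep n z' t g' ->
  rep n (z - z') t (g - g').
Proof.
elim: j n z z' => [|j IHj] n z z'.
  by move=> [gn ->] [g'n ->]; split; [exact: gm_compB|rewrite linearB].
move=> [w [wn kw -> rw]] [w' [w'n kw' -> rw']]; exists (w - w'); split.
- exact: gm_compB.
- exact: killedB.
- by rewrite linearB.
- by rewrite scalerBr; exact: IHj.
Qed.

Lemma rep_raise j n z t g s : rep (j := j) n z t g -> rep n z (t + s) (yprod j s *: g).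
Proof.
elim: j n z g => [|j IHj] n z g; first by rewrite /yprod big_ord0 scale1r.
move=> [w [wn kw zE rw]]; exists w; split=> //.
rewrite yprodS [(t + s)%N]addnC PoszD -addrA exprD -scalerA [yprod j s * _]mulrC -scalerA.
by apply: rep_scale => //; rewrite [(s + t)%N]addnC; exact: IHj.
Qed.

(** As [rep_raise], but for a given preimage [w], which the existential in [rep] would forget. *)
Lemma rep_raise_witness j n (w : ir_obj E j) t g s :
  rep (t%:Z + n) (y j ^+ t *: w) t g ->
  rep ((t + s)%N%:Z + n) (y j ^+ (t + s) *: w) (t + s) (yprod j.+1 s *: g).
Proof.
move=> rw; rewrite yprodS [(t + s)%N]addnC PoszD -addrA exprD -scalerA mulrC -scalerA.
by apply: rep_scale => //; rewrite addnC; exact: rep_raise.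
Qed.

Lemma rep_surj j n (z : ir_obj E j) : gm_comp n z -> killed j z -> ir_diff E j z = 0 ->
  exists t g, rep n z t g.
Proof.
elim: j n z => [|j IHj] n z zn kz.
  move=> /ir_exact0 [g zE]; have [u un uE] := gm_hom_preim zn zE.
  by exists 0%N, u.
move=> z0; have [w [wn kw zE]] := killed_acyclic (leqnn j) zn (killedS kz) z0.
have [t tz] := kz j (ltnSn j).
have [|||t' [g rw]] := IHj (t%:Z + n) (y j ^+ t *: w).
- exact: gm_compZ.
- exact: killedZ.
- by rewrite linearZ -zE.
(* The exponent [t] that kills [z] and the level [t'] of the induction hypothesis are both raised to
   [t' + t]. *)
exists (t' + t)%N, (yprod j t *: (y j ^+ t' *: g)), w; split=> //.
rewrite PoszD -addrA exprD -scalerA; apply: rep_raise; exact: rep_scale.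
Qed.

(** The cocycle z' of C j attached to [g] is divided by y_j^t, and [z] is the differential of the
    quotient. Division holds only up to a power of y_j, so [g] is represented after a transition
    map. *)
Lemma rep_ex j n t g : gm_comp ((j * t)%N%:Z + n) g ->
  exists k (z : ir_obj E j), rep n z (t + k) (yprod j k *: g).
Proof.
elim: j n g => [|j IHj] n g gn.
  exists 0%N, (ir_aug E g); rewrite /yprod big_ord0 scale1r; split=> //.
  by move: gn; rewrite mul0n add0r.
have [|k1 [z' rz']] := IHj (t%:Z + n) g; first by rewrite addrA -PoszD -mulSnr.
have [z'n kz' z'0 _] := rep_cocycle rz'.
have [k2 [w [wn kw wE]]] := killed_divisible t (@ir_inj _ _ _ E j) z'n kz'.
rewrite addrAC subrr add0r in wn.
exists (k1 + k2)%N, (ir_diff E j w), w; split=> //.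
have -> : (t + (k1 + k2))%N%:Z + n = (k1 + k2)%N%:Z + (t%:Z + n) by rewrite !PoszD; ring.
have -> : y j ^+ (t + (k1 + k2)) *: w = y j ^+ (k1 + k2) *: z'.
  by rewrite [in RHS]exprD -[in RHS]scalerA -wE scalerA -exprD; congr (_ ^+ _ *: _); lia.
rewrite yprodS mulrC -scalerA; apply: rep_scale => //.
by rewrite yprodD mulrC -scalerA addnA; exact: rep_raise.
Qed.

(** The class of [g] at level [t] of the direct limit becomes 0 at level [t + s]. *)
Definition vanishing j t (g : M) : Prop :=
  exists s (h : nat -> M), yprod j s *: g = \sum_(i < j) y i ^+ (t + s) *: h i.

Lemma vanishing_lower j t s g : vanishing j (t + s) (yprod j s *: g) -> vanishing j t g.
Proof.
move=> [k [h hE]]; exists (k + s)%N, h; rewrite yprodD -scalerA hE.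
by apply: eq_bigr => i _; rewrite -addnA [(s + k)%N]addnC.
Qed.

Lemma vanishing_sum j t k (h : nat -> M) :
  vanishing j (t + k) (yprod j k *: \sum_(i < j) y i ^+ t *: h i).
Proof.
pose c i := \prod_(l < j | (l : nat) != i) y l ^+ k.
exists 0%N, (fun i => c i *: h i).
rewrite /yprod [X in X *: _]big1 ?scale1r => [|i _]; last by rewrite expr0.
rewrite scaler_sumr; apply: eq_bigr => i _; rewrite !scalerA addn0 (bigD1 i) //=.
by congr (_ *: _); rewrite /c exprD; rewrite mulrAC [y i ^+ k * _]mulrC.
Qed.

Lemma vanishing_homog j t e g : gm_comp e g -> vanishing j t g -> exists s (h : nat -> M),
  (forall i, gm_comp ((j * s)%N%:Z + e - (t + s)%N%:Z) (h i)) /\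
  yprod j s *: g = \sum_(i < j) y i ^+ (t + s) *: h i.
Proof.
move=> ge [s [h hE]]; exists s, (fun i => gm_proj ((j * s)%N%:Z + e - (t + s)%N%:Z) (h i)).
split=> [i|]; first exact: gm_proj_comp.
have := gm_proj_homog ((j * s)%N%:Z + e) (gm_compZ (yprod_deg j s) ge).
rewrite eqxx => <-; rewrite hE.
have projS (P : 'I_j -> M) n : gm_proj n (\sum_i P i) = \sum_i gm_proj n (P i).
  exact: (big_morph _ (gm_projD n) (gm_proj0 M n)).
rewrite projS; apply: eq_bigr => i _.
by rewrite -(gm_projZ _ _ (yX i (t + s))); congr (gm_proj _ _); rewrite [RHS]addrC subrK.
Qed.

Definition boundary j n : ir_obj E j -> Prop :=
  match j return ir_obj E j -> Prop with
  | 0 => fun z => z = 0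
  | j'.+1 => fun z => exists v, [/\ gm_comp n v, killed j'.+1 v & z = ir_diff E j' v]
  end.

Lemma boundary0 j n : @boundary j n 0.
Proof.
case: j => // j; exists 0; split; first exact: gm_comp0.
  by move=> i _; exists 0%N; rewrite scaler0.
by rewrite linear0.
Qed.

(** If z = dv, then w - v is a cocycle of C j, and a power of y_j that kills v identifies its
    multiple with that of w. So the representative of w is, up to [vanishing j], a multiple of a
    power of y_j. *)
Lemma rep_boundary_vanishing j n z t g : rep (j := j) n z t g -> boundary n z -> vanishing j t g.
Proof.
elim: j n z t g => [|j IHj] n z t g.
  move=> [_ ->] /= ag0; exists 0%N, (fun=> 0); rewrite big_ord0 /yprod big_ord0 scale1r.
  by apply: (@ir_aug_inj _ _ _ E); rewrite ag0 linear0.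
move=> [w [wn kw zE rw]] [v [vn kv zE']].
have [T Tv] := kv j (ltnSn j).
apply: (@vanishing_lower _ _ T).
have rw' := rep_raise_witness T rw.
set g' := yprod j.+1 T *: g in rw' *; set t' := (t + T)%N in rw' *.
have [|||t2 [g2 r2]] := @rep_surj j n (w - v).
- exact: gm_compB.
- by apply: killedB => //; exact: killedS.
- by rewrite linearB /= -zE -zE' subrr.
have r2' := rep_raise t' (rep_scale (yX j t') r2).
have E1 : y j ^+ t' *: (w - v) = y j ^+ t' *: w.
  by rewrite scalerBr {2}/t' exprD -[X in _ - X]scalerA Tv scaler0 subr0.
rewrite E1 [(t2 + t')%N]addnC in r2'.
have r3 := repB (rep_raise t2 rw') r2'; rewrite subrr in r3.
have [s [h hE]] := IHj _ _ _ _ r3 (boundary0 _ _).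
pose u := yprod j s *: (yprod j t' *: g2).
exists (s + t2)%N, (fun i => if i == j then yprod j t' *: (yprod j s *: g2)
                   else y j ^+ (s + t2) *: h i).
rewrite big_ord_recr /= eqxx (eq_bigr (fun i : 'I_j => y j ^+ (s + t2) *: (y i ^+ (t' + t2 + s) *: h i))).
  rewrite -scaler_sumr -hE; apply/eqP; rewrite -subr_eq; apply/eqP.
  rewrite !scalerBr !scalerA; congr (_ *: _ - _ *: _).
    by rewrite yprodS yprodD; ring.
  by rewrite !exprD; ring.
move=> i _; rewrite ltn_eqF // !scalerA; congr (_ *: _); rewrite mulrC; congr (_ * _ ^+ _).
by lia.
Qed.

(** Let x be a cocycle of C j representing the coefficient [h j]. Then y_j^t' (w - x) is represented
    in the ideal of the other parameters, so by induction it is a boundary dv; dividing v by y_j^t'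
    corrects w - x to a preimage of [z] killed by a power of y_j. *)
Lemma rep_vanishing_boundary j n z t g : rep (j := j) n z t g -> vanishing j t g -> boundary n z.
Proof.
elim: j n z t g => [|j IHj] n z t g.
  by move=> [_ ->] [s [h]]; rewrite big_ord0 /yprod big_ord0 scale1r => ->; rewrite linear0.
move=> rz; have [_ _ _ gn] := rep_cocycle rz.
move=> /(vanishing_homog gn) [s [h [hn hE]]].
have [w [wn kw zE rw]] := rz.
have := rep_raise_witness s rw; rewrite hE; set t' := (t + s)%N => rw'.
have hj : gm_comp ((j * t')%N%:Z + n) (h j).
  have := hn j; congr (gm_comp _ (h j)); rewrite /t'.
  have -> : (j.+1 * t)%N = (j * t + t)%N by rewrite mulSnr.
  have -> : (j.+1 * s)%N = (j * s + s)%N by rewrite mulSnr.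
  by rewrite mulnDr !PoszD; ring.
have [k [x rx]] := rep_ex hj.
have [xn kx x0 _] := rep_cocycle rx.
have r3 := repB (rep_raise k rw') (rep_scale (yX j t') rx).
rewrite -(scalerBr _ w x) big_ord_recr /= [yprod j k *: _]scalerDr in r3.
have E1 : yprod j k *: (y j ^+ t' *: h j) = y j ^+ t' *: (yprod j k *: h j).
  by rewrite !scalerA mulrC.
rewrite E1 addrK in r3.
have bnd := IHj _ _ _ _ r3 (vanishing_sum _ _ _ _).
have [u [un ku uE [l ul]]] : exists u : ir_obj E j,
    [/\ gm_comp n u, killed j u, ir_diff E j u = z & exists l, y j ^+ l *: u = 0].
  have wxn := gm_compB wn xn; have kwx := killedB kw kx.
  have wxz : ir_diff E j (w - x) = z by rewrite linearB /= x0 subr0.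
  clear IHj rz gn rw r3 E1 rx hj rw' hE hn.
  (* For [j = 0] a boundary is 0, so w - x itself is killed by y_0^t'. *)
  case: j z w x bnd wxn kwx wxz kw kx wn xn x0 zE => [|j] z w x bnd wxn kwx wxz kw kx wn xn x0 zE.
    by exists (w - x); split=> //; exists t'.
  have [v [vn kv vE]] := bnd.
  have [k2 [v' [v'n kv' v'E]]] := killed_divisible t' (@ir_inj _ _ _ E j) vn kv.
  rewrite addrAC subrr add0r in v'n.
  exists (w - x - ir_diff E j v'); split.
  - by apply: gm_compB => //; exact: gh_deg.
  - by apply: killedB => //; exact: killed_hom.
  - by rewrite linearB /= wxz diff_diff subr0.
  - by exists (k2 + t')%N; rewrite scalerBr -linearZZ v'E linearZZ -vE exprD -scalerA subrr.
exists u; split=> //; exact: killed_recr ul.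
Qed.

Variables (I : set R) (d : nat).
Hypothesis torsionE : forall (N : gmod) (x : N), torsion I x <-> killed d x.

Lemma lc_boundaryE n z : @lc_boundaries R gr I M E d n z <-> boundary n z.
Proof.
case: d torsionE z => [|j] tE z //=; split=> -[v].
  by move=> [/tE kv vn ->]; exists v.
by move=> [vn /tE kv ->]; exists v.
Qed.

Lemma lc_zero n : (forall t g, gm_comp ((d * t)%N%:Z + n) g -> vanishing d t g) ->
  ~ lc_nonzero I E d n.
Proof.
move=> h; apply => z [/torsionE kz zn z0].
have [t [g rz]] := rep_surj zn kz z0; have [_ _ _ gn] := rep_cocycle rz.
by apply/lc_boundaryE; apply: (rep_vanishing_boundary rz); exact: h.
Qed.

Lemma vanishing_of_lc_zero n t g : ~ lc_nonzero I E d n ->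
  gm_comp ((d * t)%N%:Z + n) g -> vanishing d t g.
Proof.
move=> /contrapT h gn; have [k [z rz]] := rep_ex gn.
have [zn kz z0 _] := rep_cocycle rz.
apply: (@vanishing_lower _ _ k); apply: (rep_boundary_vanishing rz).
by apply/lc_boundaryE; apply: h; split=> //; exact/torsionE.
Qed.

End LocalCohomologyByParameters.

(** * Change of parameters *)

Section ChangeOfParameters.
Variables (G : comNzRingType) (d : nat).
Implicit Types (z w f : 'I_d -> G).

Let mulv (B : 'M[G]_d) z : 'I_d -> G := fun i => \sum_j B i j * z j.

Lemma cramer (B : 'M[G]_d) z i : \det B * z i = \sum_j \adj B i j * mulv B z j.
Proof.
have -> : \det B * z i = \sum_k (\adj B *m B) i k * z k.
  rewrite mul_adj_mx (bigD1 i) //= mxE eqxx mulr1n big1 ?addr0 // => j ji.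
  by rewrite mxE eq_sym (negPf ji) mulr0n mul0r.
rewrite (eq_bigr (fun k => \sum_j \adj B i j * B j k * z k)); last first.
  by move=> k _; rewrite mxE mulr_suml.
rewrite exchange_big /=; apply: eq_bigr => j _; rewrite /mulv mulr_sumr.
by apply: eq_bigr => k _; rewrite mulrA.
Qed.

(* If B z = C z = w, passing from B to C one row at a time changes the determinant by
   \det X, where X z is w with the r-th entry replaced by 0; then z_r \det X lies in
   the ideal generated by the w_i with i <> r. *)
Lemma det_congruence (B C : 'M[G]_d) z w : (forall i, mulv B z i = w i) ->
  (forall i, mulv C z i = w i) ->
  fspan (fun i => w i * z i) ((\prod_i z i) * (\det B - \det C)).
Proof.
move=> Bz Cz; pose D (r : nat) : 'M[G]_d := \matrix_(i, j) if (i < r)%N then C i j else B i j.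
have Si := fspan_ideal (fun i => w i * z i).
have -> : \det B - \det C = \sum_(r < d) (\det (D r) - \det (D r.+1)).
  pose u r := - \det (D r); rewrite (eq_bigr (fun r : 'I_d => u r.+1 - u r)); last first.
    by move=> r _; rewrite /u opprK addrC.
  rewrite -(big_mkord xpredT (fun r => u r.+1 - u r)) telescope_sumr // /u opprK.
  have -> : D d = C by apply/matrixP => i j; rewrite mxE ltn_ord.
  have -> : D 0%N = B by apply/matrixP => i j; rewrite mxE.
  by rewrite addrC.
rewrite mulr_sumr; apply: (ideal_sum _ Si) => r _.
pose X : 'M[G]_d := \matrix_(i, j) if i == r then B i j - C i j else D r i j.
have -> : \det (D r) - \det (D r.+1) = \det X.
  rewrite (@determinant_multilinear _ _ (D r) (D r.+1) X r 1 1) ?mul1r 1?addrAC ?subrr ?add0r //.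
  - by apply/rowP => j; rewrite !mxE ltnn ltnSn eqxx !mul1r addrC subrK.
  - apply/matrixP => i j; rewrite !mxE ltnS leq_eqVlt val_eqE eq_sym.
    by rewrite (negPf (neq_lift _ _)).
  - by apply/matrixP => i j; rewrite !mxE eq_sym (negPf (neq_lift _ _)).
rewrite (bigD1 r) //= mulrAC [z r * _]mulrC cramer mulr_suml; apply: (ideal_sum _ Si) => i _.
have [->|ir] := eqVneq i r.
  have -> : mulv X z r = 0.
    rewrite /mulv (eq_bigr (fun j => B r j * z j - C r j * z j)).
      by rewrite sumrB -/(mulv B z r) -/(mulv C z r) Bz Cz subrr.
    by move=> j _; rewrite mxE eqxx mulrBl.
  by rewrite mulr0 mul0r; exact: (ideal0 Si).
have -> : mulv X z i = w i.
  have [lt|ge] := ltnP i r.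
    rewrite -Cz; apply: eq_bigr => j _; by rewrite !mxE (negPf ir) lt.
  rewrite -Bz; apply: eq_bigr => j _; by rewrite !mxE (negPf ir) ltnNge ge.
rewrite (bigD1 i) //= mulrA; apply: (ideal_mulr _ Si).
rewrite -mulrA; apply: (ideal_mull _ Si); exact: (fspan_gen (fun i => w i * z i)).
Qed.

(* The class of g / (Y_1 ... Y_d) ^ t in the limit of the G / (Y_i ^ t) equals that of
   \det a * g / (f_1 ... f_d), so it vanishes as soon as \det a * g lies in (f). *)
Lemma change_parameters (Y f : 'I_d -> G) (a b : 'M[G]_d) t T g : (t <= T)%N ->
  (forall i, f i = \sum_j a i j * Y j ^+ t) ->
  (forall j, Y j ^+ T = \sum_i b j i * f i) ->
  fspan f (\det a * g) ->
  fspan (fun i => Y i ^+ (t + T)) ((\prod_i Y i ^+ T) * g).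
Proof.
move=> tT fE YE [c cE].
have Si := fspan_ideal (fun i => Y i ^+ (t + T)).
(* [C] and [b *m a] both send the vector of the Y_j^t to that of the Y_i^T; [det_congruence]
   compares their determinants. *)
pose C : 'M[G]_d := diag_mx (\row_i Y i ^+ (T - t)).
have Cz i : mulv C (fun j => Y j ^+ t) i = Y i ^+ T.
  rewrite /mulv (bigD1 i) //= big1 ?addr0 => [|j ji].
    by rewrite !mxE eqxx mulr1n -exprD subnK.
  by rewrite !mxE eq_sym (negPf ji) mulr0n mul0r.
have Bz i : mulv (b *m a) (fun j => Y j ^+ t) i = Y i ^+ T.
  rewrite /mulv YE (eq_bigr (fun j => \sum_k b i k * a k j * Y j ^+ t)).
    rewrite exchange_big /=; apply: eq_bigr => k _; rewrite fE mulr_sumr.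
    by apply: eq_bigr => j _; rewrite mulrA.
  by move=> j _; rewrite mxE mulr_suml.
have h1 := det_congruence Bz Cz.
have {}h1 : fspan (fun i => Y i ^+ (t + T)) ((\prod_i Y i ^+ t) * (\det (b *m a) - \det C)).
  by move: h1; congr (fspan _ _); apply/funext => i; rewrite -exprD addnC.
(* Here det(a) g is in (f), and Cramer's rule for [b] turns det(b) f_i into a combination of the
   Y_j^T. *)
have h2 : fspan (fun i => Y i ^+ (t + T)) ((\prod_i Y i ^+ t) * (\det (b *m a) * g)).
  rewrite det_mulmx -mulrA cE mulr_sumr mulr_sumr; apply: (ideal_sum _ Si) => i _.
  rewrite [_ * (c i * f i)]mulrCA cramer !mulr_sumr; apply: (ideal_sum _ Si) => j _.
  have -> : mulv b f j = Y j ^+ T by rewrite YE.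
  rewrite (bigD1 j) //=; set P := \prod_(k < d | _) _.
  have -> : Y j ^+ t * P * (c i * (\adj b i j * Y j ^+ T)) =
      (P * c i * \adj b i j) * Y j ^+ (t + T) by rewrite exprD; ring.
  by apply: (ideal_mull _ Si); exact: (fspan_gen (fun i => Y i ^+ (t + T))).
have -> : (\prod_i Y i ^+ T) * g = (\prod_i Y i ^+ t) * (\det (b *m a) * g) -
    g * ((\prod_i Y i ^+ t) * (\det (b *m a) - \det C)).
  have detC : (\prod_i Y i ^+ t) * \det C = \prod_i Y i ^+ T.
    rewrite det_diag -big_split /=; apply: eq_bigr => i _.
    by rewrite mxE -exprD addnC subnK.
  by rewrite -detC; ring.
by apply: (idealB Si) => //; exact: (ideal_mull _ Si).
Qed.

End ChangeOfParameters.

(** * Associated graded rings *)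

Section GradedRing.
Variables (A : comNzRingType) (F : filtration A).

(** The class of [x] in F_n / F_(n+1); for [x] outside [F n] it is 0, inherited from [rmono]. *)
Definition gmono n x : gr F := gr_pi (rmono F n x).

Lemma fil_0 n : F n 0. Proof. exact: (ideal0 (fil_ideal F n)). Qed.

Lemma gmono_eq0 n x : F n x -> gmono n x = 0 <-> F n.+1 x.
Proof.
move=> Fx; rewrite /gmono; split=> [/gr_pi_eq0 /(_ n)|Fx1].
  by rewrite val_rmono // coefZ coefXn eqxx mulr1.
apply/gr_pi_eq0 => i; rewrite val_rmono // coefZ coefXn.
by case: eqP => [->|_]; rewrite ?mulr1 // mulr0; exact: fil_0.
Qed.

Lemma gmonoB n x z : F n x -> F n z -> gmono n (x - z) = gmono n x - gmono n z.
Proof.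
move=> Fx Fz; rewrite /gmono -rmorphB; congr gr_pi; apply: val_inj.
rewrite rmorphB /= -![rees_val _]/(val _) !val_rmono ?scalerBl //.
exact: (idealB (fil_ideal F n)).
Qed.

Lemma gmono0 n : gmono n 0 = 0.
Proof. by apply/(gmono_eq0 (fil_0 n)); exact: fil_0. Qed.

Lemma gmonoD n x z : F n x -> F n z -> gmono n (x + z) = gmono n x + gmono n z.
Proof.
move=> Fx Fz; rewrite -[z in LHS]opprK gmonoB //; last exact: filN.
by rewrite -[- z]sub0r gmonoB ?gmono0 ?sub0r ?opprK //; exact: fil_0.
Qed.

Lemma gmono_sum n (T : Type) (s : seq T) (P : pred T) (x : T -> A) :
  (forall i, P i -> F n (x i)) ->
  gmono n (\sum_(i <- s | P i) x i) = \sum_(i <- s | P i) gmono n (x i).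
Proof.
move=> Fx; suff [] : gmono n (\sum_(i <- s | P i) x i) = \sum_(i <- s | P i) gmono n (x i)
  /\ F n (\sum_(i <- s | P i) x i) by [].
elim/big_rec2: _ => [|i z u Pi [<- Fu]]; first by split; [exact: gmono0|exact: fil_0].
split; first by rewrite gmonoD //; exact: Fx.
by apply: (idealD (fil_ideal F n)) => //; exact: Fx.
Qed.

Lemma gmonoM n k x z : F n x -> F k z -> gmono (n + k) (x * z) = gmono n x * gmono k z.
Proof.
move=> Fx Fz; rewrite /gmono -rmorphM; congr gr_pi; apply: val_inj.
rewrite rmorphM /= -![rees_val _]/(val _) !val_rmono //; last exact: filM.
by rewrite -scalerAl -scalerAr scalerA exprD.
Qed.

Definition gconst (c : A) : gr F := gr_pi (rees_const F c).

Lemma gconst_zmod : zmod_morphism gconst.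
Proof. by move=> x z; rewrite /gconst !rmorphB. Qed.

Lemma gconst_monoid : monoid_morphism gconst.
Proof. by split=> [|x z]; rewrite /gconst ?rmorph1 // !rmorphM. Qed.

HB.instance Definition _ := GRing.isZmodMorphism.Build A (gr F) gconst gconst_zmod.
HB.instance Definition _ := GRing.isMonoidMorphism.Build A (gr F) gconst gconst_monoid.

Lemma fil_setT c : F 0 c. Proof. by rewrite fil0. Qed.

Lemma gconstE c : gconst c = gmono 0 c.
Proof.
rewrite /gconst /gmono; congr gr_pi; apply: val_inj.
by rewrite val_rmono; [rewrite /= expr0 alg_polyC|exact: fil_setT].
Qed.

Lemma gmono1 : gmono 0 1 = 1.
Proof. by rewrite -gconstE /gconst rmorph1 rmorph1. Qed.

Lemma gconstM c n x : F n x -> gconst c * gmono n x = gmono n (c * x).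
Proof. by move=> Fx; rewrite gconstE -gmonoM //; exact: fil_setT. Qed.

Lemma filX n x k : F n x -> F (n * k)%N (x ^+ k).
Proof.
move=> Fx; elim: k => [|k IHk]; first by rewrite muln0; exact: fil_setT.
by rewrite exprS mulnS; exact: filM.
Qed.

Lemma gmonoX n x k : F n x -> gmono (n * k) (x ^+ k) = gmono n x ^+ k.
Proof.
move=> Fx; elim: k => [|k IHk].
  by rewrite muln0 !expr0 gmono1.
by rewrite exprS mulnS gmonoM ?IHk ?exprS //; exact: filX.
Qed.

Lemma gmono_comp n x : F n x -> gr_comp n (gmono n x).
Proof. by move=> Fx; exists (rmono F n x) => //; exists x; exact: val_rmono. Qed.

Lemma gr_compP n (z : gr F) : gr_comp n z -> exists2 x, F n x & z = gmono n x.
Proof.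
move=> [p -> [x px]]; have Fx : F n x.
  by have := fil_coef p n; rewrite px coefZ coefXn eqxx mulr1.
by exists x => //; rewrite /gmono; congr gr_pi; apply: val_inj; rewrite val_rmono.
Qed.

Lemma gr_comp_prod (I : Type) (s : seq I) (n : I -> nat) (z : I -> gr F) :
  (forall i, gr_comp (n i) (z i)) -> gr_comp (\sum_(i <- s) n i) (\prod_(i <- s) z i).
Proof.
move=> zn; elim/big_rec2: _ => [|i u w _ wu].
  by rewrite -gmono1; exact/gmono_comp/fil_setT.
have [x Fx ->] := gr_compP (zn i); have [x' Fx' ->] := gr_compP wu.
by rewrite -gmonoM //; apply: gmono_comp; exact: filM.
Qed.

Lemma gr_compM n k (z w : gr F) : gr_comp n z -> gr_comp k w -> gr_comp (n + k) (z * w).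
Proof.
move=> /gr_compP [x Fx ->] /gr_compP [x' Fx' ->].
by rewrite -gmonoM //; apply: gmono_comp; exact: filM.
Qed.

Lemma gr_compB n (z w : gr F) : gr_comp n z -> gr_comp n w -> gr_comp n (z - w).
Proof.
move=> /gr_compP [x Fx ->] /gr_compP [x' Fx' ->].
by rewrite -gmonoB //; apply: gmono_comp; exact: (idealB (fil_ideal F n)).
Qed.

Lemma gr_comp0 n : gr_comp n (0 : gr F).
Proof. by rewrite -(gmono0 n); apply: gmono_comp; exact: fil_0. Qed.

Lemma gr_comp_sum n (I : Type) (s : seq I) (P : pred I) (z : I -> gr F) :
  (forall i, P i -> gr_comp n (z i)) -> gr_comp n (\sum_(i <- s | P i) z i).
Proof.
move=> zn; apply: (big_ind (gr_comp n)) => //; first exact: gr_comp0.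
move=> u w un wn; rewrite -[w]opprK -[- w]sub0r.
by apply: gr_compB => //; apply: gr_compB => //; exact: gr_comp0.
Qed.

Lemma gr_comp_det d k (a : 'M[gr F]_d) : (forall i j, gr_comp k (a i j)) ->
  gr_comp (d * k) (\det a).
Proof.
move=> ak; apply: gr_comp_sum => s _.
have h : gr_comp (d * k) (\prod_i a i (perm.fun_of_perm s i)).
  have := @gr_comp_prod _ (index_enum 'I_d) (fun=> k) (fun i => a i (perm.fun_of_perm s i)) (fun i => ak _ _).
  by rewrite sum_nat_const card_ord.
rewrite -signr_odd; case: (odd _); rewrite ?expr0 ?mul1r // expr1 mulN1r -sub0r.
by apply: gr_compB => //; exact: gr_comp0.
Qed.

Lemma gr_pi_sum (p : rees F) : gr_pi p = \sum_(i < size (val p)) gmono i (val p)`_i.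
Proof. by rewrite {1}(rees_sum_rmono (leqnn (size (val p)))) rmorph_sum. Qed.

Lemma gr_mono_sum (z : gr F) : exists N (x : nat -> A),
  (forall i, F i (x i)) /\ z = \sum_(i < N) gmono i (x i).
Proof.
exists (size (val (repr z))), (fun i => (val (repr z))`_i); split.
  by move=> i; exact: fil_coef.
by rewrite -{1}(gr_repr z) gr_pi_sum.
Qed.

Lemma gr_grading : grading (@gr_comp A F).
Proof.
split.
- exact: gr_comp0.
- exact: gr_compB.
- by rewrite -gmono1; exact/gmono_comp/fil_setT.
- exact: gr_compM.
- move=> z; have [N [x [Fx ->]]] := gr_mono_sum z.
  exists (iota 0 N), (fun i => gmono i (x i)); split; first by move=> n; exact: gmono_comp.
  by rewrite -(big_mkord xpredT (fun i => gmono i (x i))) /index_iota subn0.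
- move=> s f us fn s0 n ns.
  have [x xP] := choice (fun k => let: ex_intro2 x Fx E := gr_compP (fn k) in
    ex_intro (fun x => F k x /\ f k = gmono k x) x (conj Fx E)).
  have : gr_pi (\sum_(k <- s) rmono F k (x k)) = 0.
    by rewrite rmorph_sum -[RHS]s0; apply: eq_bigr => k _; case: (xP k).
  move=> /gr_pi_eq0 /(_ n); rewrite rmorph_sum coef_sum (bigD1_seq n) //=.
  have [Fx ->] := xP n; rewrite -[rees_val _]/(val _) val_rmono // coefZ coefXn eqxx mulr1.
  rewrite big1 ?addr0 => [|k kn]; first by move=> h; exact/gmono_eq0.
  have [Fk _] := xP k; rewrite -[rees_val _]/(val _) val_rmono // coefZ coefXn.
  by rewrite eq_sym (negPf kn) mulr0.
Qed.

End GradedRing.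

(** Transparent, because [torsion_killed] relies on its filtration being [adic a] by conversion. *)
Definition adic_stable (A : comNzRingType) (a : properIdeal A) : stableFiltration a.
Proof.
apply: (@StableFiltration A a (adic a)).
  by move=> x ax; have := ax; rewrite -[X in X x](exp_ideal1 (pid_ideal a)).
by exists 0%N => n _.
Defined.

(** * The parameters in the associated graded rings *)

Section SystemOfParameters.
Variables (A : comNzRingType) (a : properIdeal A) (d : nat) (y : 'I_d -> A).
Hypothesis d0 : (0 < d)%N.
Hypothesis ry : generates_reduction a y.

Lemma stable_exp (F : stableFiltration a) : exists N0, forall k n, (N0 <= n)%N ->
  F (k + n)%N = mul_ideal (exp_ideal a k) (F n).
Proof.
have [N0 h] := sfil_stable F; exists N0; elim=> [|k IHk] n N0n.
  by rewrite mul_idealT //; exact: fil_ideal.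
rewrite addSn -h; last by rewrite (leq_trans N0n) // leq_addl.
by rewrite IHk // mul_idealA.
Qed.

(** In other words G / (Y_i^t) vanishes in high degrees. For large N, F_N is (y)^e a^(k-e) F_N0 with
    k = N - N0, and e = dt + 1 is the pigeonhole exponent that makes every monomial divisible by
    some y_i^t. *)
Lemma parameters_cover (F : stableFiltration a) t : exists N1, forall N, (N1 <= N)%N ->
  (t <= N)%N /\ F N `<=` fmul (fun i => y i ^+ t) (F (N - t)%N).
Proof.
have [N0 hN0] := stable_exp F; have [ya [r rE]] := ry.
pose e := (d * t).+1; exists (t + e + r + N0)%N => N le.
split; first by move: le; lia.
pose k := (N - N0)%N.
have yI : fspan y `<=` a by apply: fspan_min => //; exact: pid_ideal.
have -> : N = (k + N0)%N by rewrite /k; move: le; lia.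
rewrite hN0 //; have kE : k = (e + (k - e))%N by rewrite /k; move: le; lia.
have Ki : is_ideal (fmul (fun i => y i ^+ t) (F (k + N0 - t)%N)) by apply: fmul_ideal; exact: fil_ideal.
have red : exp_ideal a k = mul_ideal (exp_ideal (fspan y) e) (exp_ideal a (k - e)).
  rewrite {1}kE; apply/esym/reduction_exp; apply: (reduction_later rE).
  by rewrite /k; move: le; lia.
rewrite red -mul_idealA -hN0 //; apply: (mul_ideal_min Ki) => u v /exp_fspan [c cP ->] Fv.
rewrite mulr_suml; apply: (ideal_sum _ Ki) => i _; rewrite mulrAC.
apply: fmul_gen; first exact: fil_ideal.
have -> : (k + N0 - t = (d.-1 * t).+1 + (k - e + N0))%N.
  have : (d * t = d.-1 * t + t)%N by rewrite -mulSnr prednK.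
  by move: le kE; rewrite /e /k; lia.
apply: filM => //; apply: exp_sub_sfil.
by have := cP i; exact: exp_ideal_mono.
Qed.

(** Indexed by [nat], with 0 from [d] on, to fit the sequences of the dimension shifting. *)
Definition param (i : nat) : gr (adic a) :=
  if insub i is Some j then gmono (adic a) 1 (y j) else 0.

Lemma adic1_param i : adic a 1 (y i).
Proof. by have := ry.1 i; rewrite -[X in X _ -> _](exp_ideal1 (pid_ideal a)). Qed.

Lemma param_ord (i : 'I_d) : param i = gmono (adic a) 1 (y i).
Proof. by rewrite /param valK. Qed.

Lemma param_deg i : gr_comp 1 (param i).
Proof.
rewrite /param; case: insubP => [j _ _|_]; last exact: gr_comp0.
by apply: gmono_comp; exact: adic1_param.
Qed.

Local Notation irr := (irrelevant_ideal (@gr_comp A (adic a))).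

Lemma irrelevant_exp k : exp_ideal irr k `<=`
  [set z | exists2 p : rees (adic a), z = gr_pi p & forall i, (i < k)%N -> (val p)`_i = 0].
Proof.
pose H k : set (gr (adic a)) :=
  [set z | exists2 p : rees (adic a), z = gr_pi p & forall i, (i < k)%N -> (val p)`_i = 0].
have Hi j : is_ideal (H j).
  split.
  - by exists 0; [rewrite rmorph0|move=> i _; rewrite rmorph0 coef0].
  - move=> _ _ [p -> p0] [q -> q0]; exists (p + q); first by rewrite rmorphD.
    by move=> i ij; rewrite rmorphD coefD p0 // q0 // addr0.
  - move=> r _ [q -> q0]; exists (repr r * q).
      by rewrite rmorphM; congr (_ * _); exact/esym/gr_repr.
    move=> i ij; rewrite rmorphM coefM big1 // => l _; rewrite q0 ?mulr0 //.
    by apply: leq_ltn_trans ij; exact: leq_subr.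
elim: k => [|k IHk]; first by move=> z _; exists (repr z) => [|i] //; exact/esym/gr_repr.
rewrite exp_idealS; apply: (mul_ideal_min (Hi k.+1)) => x w irrx /IHk [q -> q0].
have [p -> p0] : H 1%N x.
  move: x irrx; apply: (ideal_gen_min (Hi 1%N)) => _ [n /= n0 [p -> [x px]]].
  exists p => // -[] // _; rewrite px coefZ coefXn.
  by case: eqP n0 => [<-//|_ _]; rewrite mulr0.
exists (p * q); first by rewrite rmorphM.
move=> i ik; rewrite rmorphM coefM big1 // => -[[|l] /= li] _; first by rewrite p0 ?mul0r.
by rewrite q0 ?mulr0 //; move: ik li; lia.
Qed.

(** A high power of the irrelevant ideal lives in high degrees ([irrelevant_exp]), where
    [parameters_cover] puts every element in (Y_i^T). *)
Lemma torsion_killed (N : gradedModule (@gr_comp A (adic a))) (x : N) :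
  torsion irr x <-> killed param d x.
Proof.
split=> [[k kx] i id|/killed_uniform [T TP]].
  exists k; apply: kx; apply: exp_ideal_gen; apply: ideal_gen_sub.
  by exists 1%N => //; exact: param_deg.
have [N1 hN1] := parameters_cover (adic_stable a) T.
exists N1 => r /irrelevant_exp [p -> p0].
rewrite gr_pi_sum scaler_suml big1 // => i _.
have [iN|Ni] := ltnP i N1.
  by rewrite p0 // gmono0 scale0r.
have [Ti cov] := hN1 i Ni; have [c cP cE] := cov _ (fil_coef p i).
have yT j : adic a T (y j ^+ T) by rewrite -[T in adic a T]mul1n; apply: filX; exact: adic1_param.
have -> : gmono (adic a) i (val p)`_i = \sum_j gmono (adic a) (i - T) (c j) * param j ^+ T.
  rewrite cE gmono_sum; last first.
    by move=> j _; rewrite -[in X in adic a X](subnK Ti); apply: filM => //; exact: cP.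
  apply: eq_bigr => j _; rewrite param_ord -gmonoX ?mul1n; last exact: adic1_param.
  by rewrite -gmonoM ?subnK //; exact: cP.
rewrite scaler_suml big1 // => j _; rewrite -scalerA TP ?scaler0 //.
Qed.

Variable F : stableFiltration a.

Definition gparam (i : 'I_d) : gr F := gmono F 1 (y i).

Lemma gparam_fil i : F 1 (y i). Proof. by apply: sfil_sub; exact: ry.1. Qed.

Lemma gr_map_param (i : 'I_d) : gr_map F (param i) = gparam i.
Proof.
rewrite param_ord /gmono gr_map_pi; congr gr_pi; apply: val_inj.
rewrite val_rmono; last exact: gparam_fil.
by rewrite /= -[rees_val _]/(val _) val_rmono //; exact: adic1_param.
Qed.

Lemma vanishing_ideal t (g : assoc_graded_module F) : vanishing param d t g <->
  exists s, fspan (fun i => gparam i ^+ (t + s)) ((\prod_i gparam i ^+ s) * (g : gr F)).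
Proof.
have scE s (z : assoc_graded_module F) (i : 'I_d) :
    param i ^+ s *: z = gparam i ^+ s * (z : gr F) :> gr F.
  by rewrite -[LHS]/(gr_map F (param i ^+ s) * (z : gr F)) rmorphXn /= gr_map_param.
have prE s : yprod param d s *: g = (\prod_i gparam i ^+ s) * (g : gr F) :> gr F.
  rewrite -[LHS]/(gr_map F (yprod param d s) * (g : gr F)) rmorph_prod; congr (_ * _).
  by apply: eq_bigr => i _; rewrite rmorphXn /= gr_map_param.
split=> [[s [h hE]]|[s [c cE]]]; exists s.
  exists (fun i => h i : gr F); rewrite -prE hE; apply: eq_bigr => i _.
  by rewrite scE mulrC.
exists (fun i => if insub i is Some j then c j : assoc_graded_module F else 0).
apply: etrans (prE s) _; rewrite cE; apply: eq_bigr => i _.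
by rewrite valK mulrC -scE.
Qed.

End SystemOfParameters.

(** * Vanishing in nonnegative degrees *)

Lemma gmono_lincomb (A : comNzRingType) (F : filtration A) n (c x : 'I_n -> A) k l :
  (forall i, F k (c i)) -> (forall i, F l (x i)) ->
  gmono F (k + l) (\sum_i c i * x i) = \sum_i gmono F k (c i) * gmono F l (x i).
Proof.
move=> ck xl; rewrite gmono_sum => [|i _]; last exact: filM.
by apply: eq_bigr => i _; rewrite gmonoM.
Qed.

Lemma fil_le (A : comNzRingType) (F : filtration A) n k : (n <= k)%N -> F k `<=` F n.
Proof.
move=> /subnKC <-; elim: (k - n)%N => [|j IHj]; first by rewrite addn0.
by rewrite addnS; apply: subset_trans IHj; exact: fil_decr.
Qed.

Section Vanishing.
Variables (A : comNzRingType) (m : set A) (d e0 c : nat).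
Hypotheses (nA : noetherian A) (loc : local_ring m) (dimA : krull_dim A d).
Hypotheses (d0 : (0 < d)%N) (c0 : (0 < c)%N).
Hypothesis inf : infinite_set (residue_classes m).
Variables (a : properIdeal A) (F : stableFiltration a) (y : 'I_d -> A).
Hypotheses (ma : exp_ideal m e0 `<=` a) (ry : generates_reduction a y).
Hypothesis verF : forall n, veronese F c n = exp_ideal (F c) n.
Hypothesis redF : exists N, forall n, (N <= n)%N ->
  exists2 r, reduction_number (exp_ideal (F c) n) r & (r < d)%N.

Local Notation Y := (gparam y F).

(** For [N = n * c] the powers of J^n are the [F (N * k)]. A reduction number at most [d.-1] gives
    equality at exponent [d.-1], so every class of degree [N * d] in G lies in the ideal of the
    classes of the [f i]. *)
Lemma reduction_of_power N0 : exists N (f : 'I_d -> A), [/\ (N0 <= N)%N, forall i, F N (f i) &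
  F (N * d)%N = fmul f (F (N * d.-1)%N)].
Proof.
have [N2 hN2] := redF; pose n := (N0 + N2).+1; pose N := (n * c)%N.
have nN : (n <= N)%N by rewrite leq_pmulr.
have FN k : F (N * k)%N = exp_ideal (exp_ideal (F c) n) k.
  by rewrite exp_idealM -verF /veronese /N mulnAC.
have FN1 : F N = exp_ideal (F c) n by rewrite -[N]muln1 FN exp_ideal1 //; exact: exp_ideal_ideal.
have [|r [[Q Qmin [Qr _]] _] rd] := hN2 n; first by rewrite /n; lia.
have Im : exp_ideal (F c) n `<=` m.
  rewrite -FN1; apply: subset_trans; first by apply: (@fil_le _ F 1); apply: leq_trans nN.
  by apply: (proper_sub_local nA loc); [exact: fil_ideal|exact: fil1].
have mI : exp_ideal m (e0 * N) `<=` exp_ideal (F c) n.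
  rewrite -FN1 -exp_idealM; apply: subset_trans; first exact: exp_ideal_mono ma.
  exact: exp_sub_sfil.
have [f Qf] := minimal_reduction_gen nA loc inf dimA (exp_ideal_ideal _ _) Im mI Qmin.
exists N, f; split.
- by apply: leq_trans nN; rewrite /n; lia.
- by move=> i; rewrite FN1; case: Qmin => -[_ + _] _; apply; rewrite Qf; exact: fspan_gen.
- rewrite !FN -mul_fspan; last exact: exp_ideal_ideal.
  rewrite -{1}(prednK d0) -Qf; apply/esym; apply: (reduction_later Qr).
  by rewrite -ltnS prednK.
Qed.

Lemma vanishing_degree0 t (g : gr F) : gr_comp (d * t) g ->
  exists s, fspan (fun i => Y i ^+ (t + s)) ((\prod_i Y i ^+ s) * g).
Proof.
move=> gt; have [N1 hN1] := parameters_cover d0 ry F t.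
have [N [f [NN1 fN FNd]]] := reduction_of_power N1.
have [tN cov] := hN1 N NN1.
have yt i k : F k (y i ^+ k) by rewrite -[k in F k]mul1n; apply: filX; exact: (gparam_fil ry).
have YE i k : gmono F k (y i ^+ k) = Y i ^+ k.
  by rewrite -[X in gmono F X _]mul1n gmonoX //; exact: (gparam_fil ry).
have [al alP] := choice (fun i => let: ex_intro2 c cP cE := cov _ (fN i) in
  ex_intro (fun c : 'I_d -> A => (forall j, F (N - t)%N (c j)) /\ f i = \sum_j c j * y j ^+ t)
    c (conj cP cE)).
have yNd j : fmul f (F (N * d.-1)%N) (y j ^+ (N * d)) by rewrite -FNd.
have [be beP] := choice (fun j => let: ex_intro2 c cP cE := yNd j in
  ex_intro (fun c : 'I_d -> A => (forall i, F (N * d.-1)%N (c i)) /\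
    y j ^+ (N * d) = \sum_i c i * f i) c (conj cP cE)).
have NdE : (N * d.-1 + N = N * d)%N by rewrite -mulnSr prednK.
pose am : 'M[gr F]_d := \matrix_(i, j) gmono F (N - t) (al i j).
pose bm : 'M[gr F]_d := \matrix_(j, i) gmono F (N * d.-1) (be j i).
(* The level [N * d] is where y_j^(Nd), an element of [F (N * d)], is a combination of the [f i];
   its coefficients form [bm], while [am] comes from [parameters_cover]. *)
exists (N * d)%N; apply: (@change_parameters _ _ Y (fun i => gmono F N (f i)) am bm).
- by apply: leq_trans tN _; rewrite leq_pmulr.
- move=> i; have [cP ->] := alP i; rewrite -[in LHS](subnK tN) gmono_lincomb //.
  by apply: eq_bigr => j _; rewrite mxE YE.
- move=> j; have [cP cE] := beP j; rewrite -YE cE -[in LHS]NdE gmono_lincomb //.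
  by apply: eq_bigr => i _; rewrite mxE.
have : gr_comp (N * d) (\det am * g).
  have -> : (N * d = d * (N - t) + d * t)%N by rewrite -mulnDr subnK // mulnC.
  apply: gr_compM => //; apply: gr_comp_det => i j; rewrite mxE; apply: gmono_comp.
  by case: (alP i).
move=> /gr_compP [v]; rewrite FNd => -[b bP ->] ->.
by exists (fun i => gmono F (N * d.-1) (b i)); rewrite -NdE gmono_lincomb.
Qed.

(* Multiplication by Y_1 maps the limit of the G / (Y_i ^ t) onto itself, so vanishing in
   degree 0 propagates to all degrees n >= 0. *)
Lemma vanishing_nonneg n t (g : gr F) : gr_comp (d * t + n) g ->
  exists s, fspan (fun i => Y i ^+ (t + s)) ((\prod_i Y i ^+ s) * g).
Proof.
move=> gn; pose i0 := Ordinal d0; pose P s := \prod_(i | i != i0) Y i ^+ s.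
have PE s : \prod_i Y i ^+ s = Y i0 ^+ s * P s by rewrite (bigD1 i0).
have Yc i k : gr_comp k (Y i ^+ k).
  have Fy := gparam_fil ry F i.
  by rewrite -gmonoX // mul1n; apply: gmono_comp; rewrite -[k in F k]mul1n; exact: filX.
have Pn : gr_comp (d.-1 * n) (P n).
  have -> : P n = \prod_(i <- [seq i <- index_enum 'I_d | i != i0]) Y i ^+ n by rewrite big_filter.
  have := @gr_comp_prod _ F _ [seq i <- index_enum 'I_d | i != i0] (fun=> n) _ (fun i => Yc i n).
  rewrite big_filter sum_nat_const; congr (gr_comp (_ * n) _).
  by rewrite -[d in RHS]card_ord -(cardC1 i0); apply: eq_card.
(* The class of [g] at level [t] has degree [n]; it is Y_1^n (index [i0]) times that of [P n * g] at
   level [t + n], of degree 0. *)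
have gPn : gr_comp (d * (t + n)) (P n * g).
  have -> : (d * (t + n) = d.-1 * n + (d * t + n))%N.
    by rewrite mulnDr -{2}(prednK d0) mulSnr; lia.
  exact: gr_compM.
have [s hs] := vanishing_degree0 gPn; exists (n + s)%N.
have -> : (\prod_i Y i ^+ (n + s)) * g = Y i0 ^+ n * ((\prod_i Y i ^+ s) * (P n * g)).
  have -> : \prod_i Y i ^+ (n + s) = (\prod_i Y i ^+ n) * \prod_i Y i ^+ s.
    by rewrite -big_split; apply: eq_bigr => i _; rewrite exprD.
  by rewrite [\prod_i Y i ^+ n]PE; ring.
rewrite addnA; apply: (ideal_mull _ (fspan_ideal _)); exact: hs.
Qed.

End Vanishing.

(** * Nonvanishing *)

Section NonVanishing.
Variables (A : comNzRingType) (m : set A) (d e0 : nat).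
Hypotheses (nA : noetherian A) (loc : local_ring m) (d0 : (0 < d)%N).
Variables (a : properIdeal A) (F : stableFiltration a) (y : 'I_d -> A).
Hypotheses (ma : exp_ideal m e0 `<=` a) (ry : generates_reduction a y).
Hypothesis iy : analytically_independent m a y.

Local Notation Y := (gparam y F).
Local Notation P := {mpoly A[d]}.
Let mi := local_ideal loc.
Let mp := local_prime nA loc.

Definition geval : {rmorphism P -> gr F} := mmap (@gconst A F) Y.

Lemma gevalC c : geval c%:MP = gconst F c.
Proof. exact: mmapC. Qed.

Lemma gevalXm k : geval 'X_[k] = \prod_i Y i ^+ k i.
Proof. exact: mmapX. Qed.

Lemma geval_mono k : geval 'X_[k] = gmono F (mdeg k) (\prod_i y i ^+ k i).
Proof.
rewrite gevalXm mdegE.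
suff : gmono F (\sum_i k i) (\prod_i y i ^+ k i) = \prod_i Y i ^+ k i
  /\ F (\sum_i k i)%N (\prod_i y i ^+ k i); first by case.
elim/big_rec3: _ => [|i u v w _ [<- Fv]]; first by rewrite gmono1; split=> //; exact: fil_setT.
have Fy := gparam_fil ry F i.
have Fyk : F (k i) (y i ^+ k i) by rewrite -[X in fil F X]mul1n; exact: filX.
split; last exact: filM.
by rewrite gmonoM // -gmonoX // mul1n.
Qed.

Lemma meval_fil D (p : P) : p \is D.-homog -> F D p.@[y].
Proof. by move=> ph; apply: exp_sub_sfil; apply: meval_in_exp ph; exact: ry.1. Qed.

Lemma geval_homog D (p : P) : p \is D.-homog -> geval p = gmono F D p.@[y].
Proof.
move=> /dhomogP ph; rewrite mevalE {1}[p]mpolyE rmorph_sum big_seq [in RHS]big_seq gmono_sum.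
  apply: eq_bigr => k kp; rewrite -mul_mpolyC rmorphM gevalC geval_mono /= (ph k kp).
  rewrite gconstM // -(ph k kp); apply: exp_sub_sfil; apply: mmap1_in_exp; exact: ry.1.
move=> k kp; apply: (ideal_mull _ (fil_ideal F D)); rewrite -(ph k kp).
by apply: exp_sub_sfil; apply: mmap1_in_exp; exact: ry.1.
Qed.

(* The ideal m G, through coefficients in the Rees algebra. *)
Definition mgr : set (gr F) := [set z | exists2 q : rees F, z = gr_pi q &
  forall i, add_ideal (mul_ideal m (F i)) (F i.+1) (val q)`_i].

Let mFi i : is_ideal (add_ideal (mul_ideal m (F i)) (F i.+1)).
Proof. exact: add_ideal_ideal (mul_ideal_ideal _ _) (fil_ideal F _). Qed.

Lemma mgr_ideal : is_ideal mgr.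
Proof.
split.
- by exists 0; [rewrite rmorph0|move=> i; rewrite rmorph0 coef0; exact: (ideal0 (mFi i))].
- move=> _ _ [p -> pm] [q -> qm]; exists (p + q); first by rewrite rmorphD.
  by move=> i; rewrite rmorphD coefD; exact: (idealD (mFi i)).
- move=> r _ [q -> qm]; exists (repr r * q).
    by rewrite rmorphM; congr (_ * _); exact/esym/gr_repr.
  move=> i; rewrite rmorphM coefM; apply: (ideal_sum _ (mFi i)) => j _.
  have Fr := fil_coef (repr r) j; have [u mu [v Fv ->]] := qm (i - j)%N.
  have ij : (j + (i - j) = i)%N by rewrite subnKC // -ltnS.
  rewrite mulrDr; exists ((val (repr r))`_j * u); last first.
    exists ((val (repr r))`_j * v) => //; rewrite -[X in fil F X.+1]ij -addnS; exact: filM.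
  suff sub : mul_ideal m (F (i - j)%N) `<=` colon (mul_ideal m (F (j + (i - j))%N)) (val (repr r))`_j.
    by rewrite -[X in fil F X]ij mulrC; exact: sub.
  apply: (mul_ideal_min (colon_ideal _ (mul_ideal_ideal _ _))) => s w ms Fw.
  rewrite /colon /= -mulrA.
  by apply: mul_idealP => //; rewrite mulrC; exact: filM.
Qed.

Lemma geval_coef (h : P) D (q : rees F) : geval h = gr_pi q ->
  F D.+1 ((pihomog mdeg D h).@[y] - (val q)`_D).
Proof.
move=> hq; pose N := (D + msize h).+1.
have hE : h = \sum_(i < N) pihomog mdeg i h.
  by apply: pihomog_partitionE; rewrite /N ltnW // ltnS leq_addl.
have Fh i := meval_fil (pihomogP mdeg i h).
have : gr_pi (\sum_(i < N) rmono F i (pihomog mdeg i h).@[y] - q) = 0.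
  rewrite rmorphB; apply/eqP; rewrite subr_eq0; apply/eqP; apply: etrans hq.
  rewrite {2}hE !rmorph_sum; apply: eq_bigr => i _.
  by rewrite (geval_homog (pihomogP mdeg i h)).
move=> /gr_pi_eq0 /(_ D); rewrite rmorphB rmorph_sum coefB coef_sum.
have DN : (D < N)%N by rewrite /N ltnS leq_addr.
rewrite (bigD1 (Ordinal DN)) //= -[rees_val (rmono _ _ _)]/(val _) val_rmono //.
rewrite coefZ coefXn eqxx mulr1 big1 ?addr0 // => i iD.
rewrite -[rees_val _]/(val _) val_rmono // coefZ coefXn; case: eqP => [E|]; last by rewrite mulr0.
by case/eqP: iD; apply: val_inj.
Qed.

(* If a form of degree D lies in m F_D + F_(D+1), a power of it lies in m a ^ (its degree). *)
Lemma geval_mgr (h : P) : mgr (geval h) -> coefs_in m h.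
Proof.
move=> [q hq qm] k; pose D := mdeg k; pose p := pihomog mdeg D h.
have ph : p \is D.-homog := pihomogP mdeg D h.
have pk : p@_k = h@_k.
  rewrite /p pihomogE raddf_sum /= -(big_filter _ (fun l => mdeg l == D)).
  have [kh|kh] := boolP (k \in msupp h); last first.
    rewrite (memN_msupp_eq0 kh) big_filter big_seq_cond big1 // => l /andP[lh _].
    rewrite mcoeffZ mcoeffX; case: eqP => [E|]; last by rewrite mulr0.
    by move: kh; rewrite -E lh.
  rewrite (bigD1_seq k) ?mem_filter ?eqxx ?filter_uniq ?msupp_uniq //=.
  rewrite mcoeffZ mcoeffX eqxx mulr1 big1 ?addr0 // => l lk.
  by rewrite mcoeffZ mcoeffX (negPf lk) mulr0.
rewrite -pk; apply: contrapT => npk.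
have np : ~ coefs_in m p by move=> /(_ k).
have pw : add_ideal (mul_ideal m (F D)) (F D.+1) p.@[y].
  rewrite -[p.@[y]](subrK (val q)`_D); apply: (idealD (mFi D)) => //.
  by apply: add_ideal_subr; [exact: mul_ideal_ideal|exact: geval_coef].
(* A product of i factors collects m^i or gains a degree. At [i = e0] the power m^e0 lies in [a],
   hence in [F 1], and gains a degree too. *)
pose T i := add_ideal (mul_ideal (exp_ideal m i) (F (i * D)%N)) (F (i * D).+1).
have Ti i : is_ideal (T i) by exact: add_ideal_ideal (mul_ideal_ideal _ _) (fil_ideal F _).
have pT i : T i (p.@[y] ^+ i).
  elim: i => [|i IHi].
    exists 1; last by exists 0; [exact: fil_0|rewrite addr0].
    by rewrite mul_idealT; [exact: fil_setT|exact: fil_ideal].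
  have FT j : T j `<=` F (j * D)%N.
    by apply: (add_ideal_min (fil_ideal F _)); [exact: mul_ideal_subr (fil_ideal F _)|exact: fil_decr].
  have [u mu [v Fv pE]] := pw; have [u' mu' [v' Fv' pE']] := IHi.
  have Fu : F D u by exact: mul_ideal_subr (fil_ideal F _) _ mu.
  rewrite exprS {1}pE mulrDl; apply: (idealD (Ti _)); last first.
    apply: add_ideal_subr; first exact: mul_ideal_ideal.
    by rewrite mulSn -addSn; apply: filM => //; exact: FT.
  rewrite pE' mulrDr; exists (u * u'); last first.
    by exists (u * v') => //; rewrite mulSn -addnS; exact: filM.
  rewrite exp_idealS -mul_idealA mulSn.
  have FF : mul_ideal (F D) (F (i * D)%N) `<=` F (D + i * D)%N by exact: fil_mul.
  have : mul_ideal (mul_ideal m (F D)) (mul_ideal (exp_ideal m i) (F (i * D)%N)) (u * u').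
    exact: mul_idealP.
  rewrite -mul_idealA [mul_ideal (F D) _]mul_idealA [mul_ideal (F D) (exp_ideal m i)]mul_idealC.
  by rewrite -mul_idealA; apply: mul_ideal_mono => //; exact: mul_ideal_mono.
have pe : F (e0 * D).+1 (p.@[y] ^+ e0).
  move: (pT e0); apply: (add_ideal_min (fil_ideal F _)) => //.
  rewrite -add1n; apply: subset_trans (@fil_mul _ F 1 (e0 * D)).
  by apply: mul_ideal_mono => //; apply: subset_trans ma _; exact: sfil_sub.
have [N0 hN0] := stable_exp F.
(* Each factor p^e0 gains one degree, so [N0.+1] of them put H(y) in F_(n+1+N0) = a^(n+1) F_N0, n
   being the degree of [H]: back to powers of [a], where independence is stated. *)
pose j := N0.+1; pose H := p ^+ (e0 * j).
have Hh : H \is (D * (e0 * j)).-homog by exact: dhomogMn.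
have Hm : mul_ideal m (exp_ideal a (D * (e0 * j))) H.@[y].
  have sub : exp_ideal a (D * (e0 * j)).+1 `<=` mul_ideal m (exp_ideal a (D * (e0 * j))).
    rewrite exp_idealS; apply: mul_ideal_mono => //.
    exact: (proper_sub_local nA loc (pid_ideal a) (@pid_proper _ a)).
  apply: sub; have : F ((e0 * D).+1 * j)%N H.@[y].
    by rewrite /H rmorphXn exprM; exact: filX.
  have -> : ((e0 * D).+1 * j = (D * (e0 * j)).+1 + N0)%N by rewrite /j; lia.
  by rewrite hN0 //; apply: mul_ideal_subl; exact: exp_ideal_ideal.
exact/np/(coefs_in_exp mp)/(iy Hh Hm).
Qed.

(* The A[Y]-submodule of G generated by S and m G. *)
Fixpoint gspan (S : seq (gr F)) : set (gr F) :=
  if S is s :: S' then [set z | exists h, exists2 w, gspan S' w & z = geval h * s + w]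
  else mgr.

Lemma gspan0 S : gspan S 0.
Proof.
elim: S => [|s S IHS]; first exact: (ideal0 mgr_ideal).
by exists 0, 0; rewrite // rmorph0 mul0r addr0.
Qed.

Lemma gspanD S z w : gspan S z -> gspan S w -> gspan S (z + w).
Proof.
elim: S z w => [|s S IHS] z w; first exact: (idealD mgr_ideal).
move=> [h [z' Sz ->]] [k [w' Sw ->]]; exists (h + k), (z' + w'); first exact: IHS.
by rewrite rmorphD mulrDl addrACA.
Qed.

Lemma gspanM S h z : gspan S z -> gspan S (geval h * z).
Proof.
elim: S z => [|s S IHS] z; first exact: (ideal_mull _ mgr_ideal).
move=> [k [w Sw ->]]; exists (h * k), (geval h * w); first exact: IHS.
by rewrite rmorphM mulrDr mulrA.
Qed.

Lemma gspan_sum S (T : Type) (r : seq T) (Q : pred T) (z : T -> gr F) :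
  (forall i, Q i -> gspan S (z i)) -> gspan S (\sum_(i <- r | Q i) z i).
Proof. by move=> h; apply: (big_ind (gspan S)) => //; [exact: gspan0|exact: gspanD]. Qed.

Lemma gspan_cons S s z : gspan S z -> gspan (s :: S) z.
Proof. by move=> Sz; exists 0, z; rewrite // rmorph0 mul0r add0r. Qed.

Lemma gspan_cat S T z : gspan S z -> gspan (T ++ S) z.
Proof. by move=> Sz; elim: T => //= t T IHT; exact: gspan_cons. Qed.

Lemma gspan_mem S s : s \in S -> gspan S s.
Proof.
elim: S => // t S IHS; rewrite inE => /orP[/eqP ->|/IHS]; last exact: gspan_cons.
by exists 1, 0; [exact: gspan0|rewrite rmorph1 mul1r addr0].
Qed.

Definition homogeneous (z : gr F) : Prop := exists n, gr_comp n z.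

(** Below [N1] generators of each [F n] suffice; from [N1] on, F_n is the sum of the y_j F_(n-1). *)
Lemma gspan_full : exists S, {in S, forall s, homogeneous s} /\ forall z, gspan S z.
Proof.
have [N1 hN1] := parameters_cover d0 ry F 1.
have [S [Sh Ssp]] : exists S, {in S, forall s, homogeneous s} /\
    forall n x, (n < N1)%N -> F n x -> gspan S (gmono F n x).
  elim: N1 {hN1} => [|N [S [Sh Ssp]]]; first by exists [::].
  have [k [x xE]] := noetherian_fspan nA (fil_ideal F N).
  have Fx i : F N (x i) by rewrite xE; exact: fspan_gen.
  pose T := [seq gmono F N (x i) | i <- enum 'I_k].
  exists (T ++ S); split.
    move=> s; rewrite mem_cat => /orP[/mapP[i _ ->]|/Sh //].
    by exists N; exact: gmono_comp.
  move=> n z; rewrite ltnS leq_eqVlt => /orP[/eqP ->|nN] Fz; last first.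
    by apply: gspan_cat; exact: Ssp.
  move: Fz; rewrite xE => -[c ->]; rewrite gmono_sum => [|i _]; last exact: (ideal_mull _ (fil_ideal F N)).
  apply: gspan_sum => i _; rewrite -gconstM // -gevalC; apply: gspanM.
  by apply: gspan_mem; rewrite mem_cat (map_f (fun i => gmono F N (x i))) ?mem_enum.
exists S; split=> // z; have [N [x [Fx ->]]] := gr_mono_sum z.
apply: gspan_sum => i _; move: (Fx i); move: (x i) => {z x Fx} z.
elim/ltn_ind: (nat_of_ord i) z => n IHn z Fz.
have [nN|Nn] := ltnP n N1; first exact: Ssp.
have [n1 cov] := hN1 n Nn; have [c cP ->] := cov z Fz.
rewrite -(subnK n1) gmono_lincomb // => [|j]; last by rewrite expr1; exact: (gparam_fil ry).
apply: gspan_sum => j _; rewrite expr1 mulrC.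
have -> : gmono F 1 (y j) = geval 'X_[U_(j)].
  by rewrite -[RHS]/(mmap _ _ _) mmapX mmap1U.
by apply: gspanM; apply: IHn => //; rewrite ltn_subrL (leq_trans _ n1).
Qed.

(* If h G lies in the span of s :: S and no h' outside m[Y] sends s into the span of S,
   then s is torsion-free modulo S: the vanishing of the class of s / Y ^ t says that
   (Y_1 ... Y_d) ^ k h is congruent mod m to an element of (Y_i ^ (t + k)), which is
   impossible for t > deg h.  Otherwise h' h G lies in the span of S. *)
Lemma gspan_contradiction S (h : P) :
  (forall s, homogeneous s -> forall t, exists k,
     fspan (fun i => Y i ^+ (t + k)) ((\prod_i Y i ^+ k) * s)) ->
  {in S, forall s, homogeneous s} -> ~ coefs_in m h -> ~ forall z, gspan S (geval h * z).
Proof.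
move=> van; elim: S h => [|s S IHS] h Sh nh hS.
  by apply: nh; apply: geval_mgr; have := hS 1; rewrite mulr1.
have ShS : {in S, forall s, homogeneous s} by move=> z zS; apply: Sh; rewrite inE zS orbT.
suff [h' nh' h's] : exists2 h' : P, ~ coefs_in m h' & gspan S (geval h' * s).
  apply: (IHS (h' * h)) => //; first by case/(coefs_in_mul mp).
  move=> z; have [k [w Sw hz]] := hS z.
  rewrite rmorphM -mulrA hz mulrDr mulrCA; apply: gspanD; exact: gspanM.
apply: contrapT => nex.
have free h' : gspan S (geval h' * s) -> coefs_in m h'.
  by move=> h's; apply: contrapT => nh'; apply: nex; exists h'.
have [k [z zE]] := van s (Sh s (mem_head _ _)) (msize h).
have [q qP] := choice (fun i => hS (z i)).
have [w wP] := choice (fun i => let: ex_intro2 w Sw E := qP i in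
  ex_intro (fun w => gspan S w /\ geval h * z i = geval (q i) * s + w) w (conj Sw E)).
pose u : 'X_{1..d} := [multinom k | i < d].
pose b (i : 'I_d) : 'X_{1..d} := (U_(i) *+ (msize h + k))%MM.
have bE i : geval 'X_[b i] = Y i ^+ (msize h + k).
  by rewrite gevalXm (bigD1 i) //= big1 ?mulr1 => [|j ji];
     rewrite /b mulmnE mnm1E ?eqxx ?mul1n // eq_sym (negPf ji) mul0n expr0.
have hb : coefs_in m (h * 'X_[u] - \sum_i q i * 'X_[b i]).
  apply: free; have -> : geval (h * 'X_[u] - \sum_i q i * 'X_[b i]) * s =
      \sum_i geval 'X_[b i] * w i.
    have uE : geval 'X_[u] * s = \sum_i z i * Y i ^+ (msize h + k).
      rewrite -zE gevalXm; congr (_ * _); apply: eq_bigr => i _; by rewrite mnmE.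
    rewrite rmorphB rmorphM mulrBl -mulrA uE mulr_sumr rmorph_sum mulr_suml -sumrB.
    apply: eq_bigr => i _; have [_ hz] := wP i.
    by rewrite rmorphM bE mulrA hz mulrDl mulrAC addrAC subrr add0r mulrC.
  by apply: gspan_sum => i _; apply: gspanM; case: (wP i).
apply: nh => l; have [lh|/memN_msupp_eq0 ->] := boolP (l \in msupp h); last exact: ideal0.
(* At u + l the first product has the coefficient of [h] at l. No X^(b i) divides u + l, whose i-th
   exponent k + l_i is below [msize h + k]. *)
have := hb (u + l)%MM; rewrite mcoeffB mcoeffMX raddf_sum /= big1 ?subr0 // => i _.
apply: memN_msupp_eq0; rewrite (perm_mem (msuppMX _ _)); apply/mapP => -[v _ E].
have := congr1 (fun w : 'X_{1..d} => w i) E.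
rewrite !mnmDE /u mnmE /b mulmnE mnm1E eqxx mul1n.
have : (l i <= mdeg l)%N by rewrite mdegE (bigD1 i) //= leq_addr.
by have := msize_mdeg_lt lh; lia.
Qed.

End NonVanishing.

(** * Existence and negativity of the a-invariant *)

Theorem theorem1p7 (A : comNzRingType) (m : set A) (d c : nat)
    (a : properIdeal A) (F : stableFiltration a)
    (E : injectiveResolution (assoc_graded_module F)) :
  noetherian A -> local_ring m -> krull_dim A d -> (1 <= d)%N ->
  infinite_set (residue_classes m) ->
  primary_to m a ->
  (1 <= c)%N ->
  (forall n, veronese F c n = exp_ideal (F c) n) ->
  (exists N, forall n, (N <= n)%N ->
     exists2 r, reduction_number (exp_ideal (F c) n) r & (r < d)%N) ->
  exists2 b : int,
    is_a_invariant (irrelevant_ideal (@gr_comp A (adic a))) E d b & (b < 0)%R.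
Proof.
move=> nA loc dimA d0 inf pma c0 verF redF.
have [e0 ma] := primary_exp nA loc pma.
have [y [ry iy]] := exists_parameters nA loc inf dimA ma.
have nR := noetherian_gr (a := a) nA.
have grP := gr_grading (adic a).
have pdeg := param_deg ry.
have tors := torsion_killed d0 ry.
pose lc n := lc_nonzero (irrelevant_ideal (@gr_comp A (adic a))) E d n.
have lc_neg n : lc n -> exists k, n = Negz k.
  case: n => [n|k _]; last by exists k.
  move=> lcn; exfalso; apply: (lc_zero nR grP pdeg tors _ lcn) => t g gn.
  apply/(vanishing_ideal ry).
  exact: (vanishing_nonneg nA loc dimA d0 c0 inf ma ry verF redF gn).
have [k0 lck0] : exists k, lc (Negz k).
  suff [n lcn] : exists n, lc n by have [k nE] := lc_neg n lcn; exists k; rewrite -nE.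
  apply: contrapT => nlc; have [S [Sh Sfull]] := gspan_full m nA d0 F ry.
  apply: (gspan_contradiction nA loc d0 ma ry iy (S := S) (h := 1)) => //.
  - move=> s [e se] t; apply/(vanishing_ideal ry (F := F)).
    (* The degree of the class of s / (Y_1 ... Y_d)^t. *)
    pose n := e%:Z - (d * t)%N%:Z.
    have nlcn : ~ lc n by move=> lcn; apply: nlc; exists n.
    by apply: (vanishing_of_lc_zero nR grP pdeg tors nlcn); rewrite addrC subrK.
  - by move=> /(_ 0%MM); rewrite mcoeff1 eqxx; exact: local_n1.
have exk : exists k, `[< lc (Negz k) >] by exists k0; exact/asboolP.
(* [Negz k] is -(k + 1), so the least [k] gives the greatest degree. *)
case: (ex_minnP exk) => k /asboolP lck kmin; exists (Negz k) => //.
split=> // n lcn; have [j nE] := lc_neg n lcn; rewrite nE in lcn *.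
by have := kmin j (asboolT lcn); rewrite !NegzE lerN2 lez_nat ltnS.
Qed.
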